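(* Let $T>0$, $c\in\mathbb{R}$, let $\omega:\mathbb{R}\to\mathbb{R}$ satisfy $\omega(-k)=-\omega(k)$ for all $k\in\mathbb{R}$, and let $Q:\mathbb{R}\to\mathbb{R}$ be $T$-periodic with zero mean over one period, $Q(x)=\sum_{k\in\mathbb{Z},\,k\neq 0}\widehat{Q}_k e^{2\pi i k x/T}$, with $\|\widehat{Q}\|_1=\sum_{k\in\mathbb{Z},\,k\neq0}|\widehat{Q}_k|<\infty$. For $\mu\in(-\tfrac12,\tfrac12]$ consider the eigenvalue problem $$\lambda v=\big(i\omega(-i\partial_x)+c\,\partial_x\big)v+\partial_x\big(Q(x)v\big),\qquad \lambda\in\mathbb{C},$$ subject to $v(T)=e^{2\pi i\mu}v(0)$ along with its derivatives, and for $k\in\mathbb{Z}$ define $$D_k(\mu)=\Big\{\lambda\in\mathbb{C}:\Big|\lambda-i\omega\Big(\tfrac{2\pi}{T}(k+\mu)\Big)-\tfrac{2\pi i c}{T}(k+\mu)\Big|\le \tfrac{2\pi}{T}|k+\mu|\,\|\widehat{Q}\|_1\Big\}.$$ Then for each $\mu\in(-\tfrac12,\tfrac12]$, every nonzero eigenvalue of this problem is contained in $\bigcup_{k\in\mathbb{Z}}D_k(\mu)$. Furthermore, any connected component (of the union of the disks) consisting of $n$ intersecting disks $D_k(\mu)$ must contain precisely $n$ eigenvalues. In particular, if a disk $D_k(\mu)$ is disjoint from all other disks, then it contains exactly one eigenvalue.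
   Context: The operator $i\omega(-i\partial_x)$ is the Fourier multiplier acting on functions $v(x)=\sum_{k\in\mathbb{Z}}\widehat{v}_k e^{2\pi i(k+\mu)x/T}$ (those satisfying the quasi-periodic boundary condition) by multiplying $\widehat v_k$ by $i\omega\big(\tfrac{2\pi}{T}(k+\mu)\big)$. Eigenvalues are counted with algebraic multiplicity.
   Formalization: In the last sentence the disk must also be a connected component of the union, since other disks may accumulate at it and it may then hold no eigenvalue; eigenfunctions are Fourier series with coefficients tending to 0, as the count can fail for square-summable ones. *)

(* Defs.v *)
From HB Require Import structures.
From mathcomp Require Import all_boot all_order all_algebra.
From mathcomp Require Import complex.
From mathcomp Require Import all_classical all_reals all_analysis.

Set Implicit Arguments.
Unset Strict Implicit.
Unset Printing Implicit Defensive.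

Import Order.TTheory GRing.Theory Num.Theory.
Import numFieldNormedType.Exports.
Import ComplexField.

Local Open Scope classical_set_scope.
Local Open Scope ring_scope.

(* [R[i]^o] rather than [R[i]]: only the regular module carries the topology. *)
Notation CC R := (R[i]%type^o).

Definition cexpi (R : realType) (t : R) : CC R := Complex (cos t) (sin t).

(* Every series summed below converges absolutely, so the limit of the
   symmetric partial sums is its unconditional sum. *)
Definition sumZ (R : realType) (f : int -> CC R) : CC R :=
  limn (fun N : nat => \sum_(j < N.*2.+1) f (j%:Z - N%:Z)).

Section Fourier.
Context {R : realType}.

Definition fourier_coef (T : R) (Q : R -> R) (k : int) : CC R :=
  Complex
    (T^-1 * \int[lebesgue_measure]_(x in `[0, T])
              (Q x * cos (2 * pi * k%:~R * x / T)))
    (- (T^-1 * \int[lebesgue_measure]_(x in `[0, T])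
              (Q x * sin (2 * pi * k%:~R * x / T)))).

Definition l1enorm (q : int -> CC R) : \bar R :=
  \esum_(k in [set k | k != 0]) (Normc.normc (q k))%:E.

Definition l1norm (q : int -> CC R) : R := fine (l1enorm q).

Definition wavenumber (T mu : R) (k : int) : R := 2 * pi / T * (k%:~R + mu).

Definition quasi_mode (T mu : R) (k : int) (x : R) : CC R :=
  cexpi (2 * pi * (k%:~R + mu) * x / T).

(* A solution v(x) = \sum_k v_k e^{2 pi i (k + mu) x / T} is represented by its
   coefficients [v : int -> CC R]; each mode satisfies the quasi-periodic
   boundary condition (see [quasi_mode_shift]).  The series is formal, i.e. a
   mu-quasi-periodic distribution, of which only v_k -> 0 is required: by the
   Riemann-Lebesgue lemma this covers every v integrable over one period. *)
Definition vanishing (v : int -> CC R) : Prop :=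
  (fun n : nat => Normc.normc (v n%:Z)) @ \oo --> (0 : R) /\
  (fun n : nat => Normc.normc (v (- n%:Z))) @ \oo --> (0 : R).

Definition multiplier (T mu : R) (m : R -> CC R) (v : int -> CC R)
  : int -> CC R := fun k => m (wavenumber T mu k) * v k.

Definition i_omega_D (T mu : R) (omega : R -> R) : (int -> CC R) -> int -> CC R :=
  multiplier T mu (fun xi => Complex 0 (omega xi)).

Definition ddx (T mu : R) : (int -> CC R) -> int -> CC R :=
  multiplier T mu (fun xi => Complex 0 xi).

(* Coefficients of Q(x) v(x): the product of the two Fourier series. *)
Definition mulQ (T : R) (Q : R -> R) (v : int -> CC R) : int -> CC R :=
  fun k => sumZ (fun m => fourier_coef T Q (k - m) * v m).

Definition linop (T c mu : R) (omega Q : R -> R) (v : int -> CC R)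
  : int -> CC R :=
  fun k => i_omega_D T mu omega v k + Complex c 0 * ddx T mu v k
           + ddx T mu (mulQ T Q v) k.

Definition op_eigenvalue (L : (int -> CC R) -> int -> CC R) (lam : CC R) : Prop :=
  exists v : int -> CC R,
    [/\ vanishing v, v <> (fun=> 0) & forall k, lam * v k = L v k].

(* Kernel of (L - lam)^j, where L has its maximal domain
   {v | v and L v vanish at infinity}. *)
Fixpoint gen_ker (L : (int -> CC R) -> int -> CC R) (lam : CC R) (j : nat)
  : set (int -> CC R) :=
  if j is j'.+1 then
    [set v | vanishing v /\ gen_ker L lam j' (fun k => L v k - lam * v k)]
  else [set v | v = (fun=> 0)].

Definition gen_eigenspace (L : (int -> CC R) -> int -> CC R) (lam : CC R)
  : set (int -> CC R) := [set v | exists j, gen_ker L lam j v].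

Definition has_dim (V : set (int -> CC R)) (n : nat) : Prop :=
  exists b : 'I_n -> int -> CC R,
    [/\ forall i, V (b i),
        forall a : 'I_n -> CC R,
          (forall k, \sum_(i < n) a i * b i k = 0) -> forall i, a i = 0
      & forall v, V v -> exists a : 'I_n -> CC R,
          forall k, v k = \sum_(i < n) a i * b i k].

(* [A] contains exactly [n] eigenvalues of [L], with algebraic multiplicity. *)
Definition eigenvalue_count (L : (int -> CC R) -> int -> CC R)
    (A : set (CC R)) (n : nat) : Prop :=
  exists (s : seq (CC R)) (mult : CC R -> nat),
    [/\ uniq s,
        forall lam, lam \in s <-> A lam /\ op_eigenvalue L lam,
        forall lam, lam \in s -> has_dim (gen_eigenspace L lam) (mult lam)
      & (\sum_(lam <- s) mult lam)%N = n].

Definition disk_center (T c mu : R) (omega : R -> R) (k : int) : CC R :=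
  Complex 0 (omega (wavenumber T mu k) + c * wavenumber T mu k).

Definition disk (T c mu : R) (omega Q : R -> R) (k : int) : set (CC R) :=
  [set lam | Normc.normc (lam - disk_center T c mu omega k)
             <= 2 * pi / T * `|k%:~R + mu| * l1norm (fourier_coef T Q)].

Definition disks (T c mu : R) (omega Q : R -> R) : set (CC R) :=
  \bigcup_(k in [set: int]) disk T c mu omega Q k.

Definition is_component (U A : set (CC R)) : Prop :=
  exists2 z, U z & A = connected_component U z.

End Fourier.

Lemma cexpiD (R : realType) (s t : R) : cexpi (s + t) = cexpi s * cexpi t.
Proof. by rewrite /cexpi cosD sinD [sin s * _ + _]addrC. Qed.

Lemma cexpi_2pi_int (R : realType) (k : int) :
  cexpi (2 * pi * k%:~R : R) = 1.
Proof.
have e1 : cexpi (2 * pi : R) = 1.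
  by rewrite /cexpi mulr_natl cos2pi sin2pi.
have en (n : nat) : cexpi (2 * pi * n%:R : R) = 1.
  elim: n => [|n IH]; first by rewrite mulr0 /cexpi cos0 sin0.
  by rewrite -(natr1 n) mulrDr mulr1 cexpiD IH e1 mulr1.
case: k => n; first by rewrite -pmulrn en.
rewrite NegzE mulrNz -pmulrn mulrN.
have := cexpiD (- (2 * pi * n.+1%:R)) (2 * pi * n.+1%:R : R).
by rewrite addNr en mulr1 => <-; rewrite /cexpi cos0 sin0.
Qed.

Lemma quasi_mode_shift (R : realType) (T mu : R) (k : int) (x : R) : T != 0 ->
  quasi_mode T mu k (x + T) = cexpi (2 * pi * mu) * quasi_mode T mu k x.
Proof.
move=> T0; rewrite /quasi_mode.
have -> : 2 * pi * (k%:~R + mu) * (x + T) / T =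
    2 * pi * k%:~R + (2 * pi * mu + 2 * pi * (k%:~R + mu) * x / T).
  by rewrite mulrDr mulrDl mulfK // addrC mulrDr -addrA.
by rewrite cexpiD cexpi_2pi_int mul1r cexpiD.
Qed.

(* Main.v *)
Require Import Defs.
From HB Require Import structures.
From mathcomp Require Import all_boot all_order all_algebra.
From mathcomp Require Import complex.
From mathcomp Require Import all_classical all_reals all_analysis.
From mathcomp Require Import zify ring lra.
Set Implicit Arguments.
Unset Strict Implicit.
Unset Printing Implicit Defensive.
Import Order.TTheory GRing.Theory Num.Theory.
Import numFieldNormedType.Exports.
Local Open Scope classical_set_scope.
Local Open Scope ring_scope.

(* Write L = i H with (H v)_k = c_k v_k + kappa_k (q * v)_k and real c_k, so that
   the disks are centred on the imaginary axis and have radii r_k = |kappa_k| |q|_1.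
   A component made of the disks D_k, k in S, with S finite of cardinal n, is
   separated from all other disks by two horizontal strips of positive width: disks
   accumulating at it would be large, hence share a point, and would belong to it.

   On a finite-dimensional H-invariant space of sequences in c_0, diagonal dominance
   makes the vectors whose maximum sits on an index above (below) the component a
   cone that is stable under the forward (backward) flow of H and in which vectors
   grow faster than eigenvalues in the component allow.  So vectors belonging to
   eigenvalues in the component attain their maximum on S.  For a finite section of
   H, this bound for each of the three groups of eigenvalues and a count of
   dimensions give an invariant space of dimension exactly n, the graph over the
   coordinates in S of a map of norm at most 1.  The limit of these graphs as the
   sections grow carries an n x n matrix whose eigenvalues lie in the component,
   and the cone property shows that it contains all generalized eigenvectors.

   It remains to see that the limit lies in c_0, although r_k / |lambda - i c_k| may
   tend to 1.  By a maximum principle the rows of the graphs are dominated by any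
   G > 0 with |q| * G <= (|q|_1 + rho_k) G_k, where rho_k is of order 1 / |k|.  Such a
   G is a limit of Green functions, on Z / M, of the random walk with steps
   distributed like |q| and killed at rate rho.  It is positive definite, it varies
   slowly at infinity because bounded harmonic functions are periodic, and
   sum_k rho_k G_k <= 1; together these force G to tend to 0. *)

(** * A decaying supersolution *)

(** The coupling is only critically dominated by the diagonal: for lambda in the strip of the
    component and k outside S one has |lambda - i c_k| >= r_k + d, where r_k grows like |k|. So a
    Neumann series for the resolvent need not converge, and a homotopy of spectral projections is
    not at hand; finite sections replace it, since dimensions can be counted there. The relative
    gain (r_k + d) / |kappa_k| = |q|_1 + d / |kappa_k| is the origin of rho: as kappa_k is linear in
    k, the surplus is of order 1 / |k|. This is the borderline rate, for sum_k 1 / |k| still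
    diverges, so that sum_k rho_k G_k <= 1 excludes a positive density of large values of G; a
    summable rate would exclude nothing. The walk is symmetric because Q is real, so that |q_{-k}| =
    |q_k|. Limits are taken along ultrafilters, which makes all coordinates converge at once. If all
    coefficients of Q vanish, the operator is diagonal and the radii are 0; this case is treated
    apart. *)

Section SymmetricSums.

(** The index set is that of the partial sums in [sumZ], so that [sumZ f] unfolds to the limit of
    [isum N f]. *)
Definition isum (V : nmodType) (J : nat) (f : int -> V) : V :=
  \sum_(j < J.*2.+1) f (j%:Z - J%:Z).

Lemma eq_isum (V : nmodType) J (f g : int -> V) : f =1 g -> isum J f = isum J g.
Proof. by move=> fg; apply: eq_bigr => j _; exact: fg. Qed.

Lemma isum0 (V : nmodType) (f : int -> V) : isum 0 f = f 0.
Proof. by rewrite /isum big_ord1. Qed.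

Lemma isumS (V : nmodType) J (f : int -> V) :
  isum J.+1 f = isum J f + (f J.+1%:Z + f (- J.+1%:Z)).
Proof.
rewrite /isum doubleS big_ord_recr big_ord_recl /= sub0r -addrA addrC -addrA.
congr (_ + (_ + _)).
  by apply: eq_bigr => j _; rewrite /= /bump /=; congr f; lia.
by congr f; lia.
Qed.

Lemma isumN (V : nmodType) J (f : int -> V) :
  isum J (fun j => f (- j)) = isum J f.
Proof.
elim: J => [|J IH]; first by rewrite !isum0 oppr0.
by rewrite !isumS IH opprK [f (- _) + _]addrC.
Qed.

Lemma isumB (V : zmodType) J (f g : int -> V) :
  isum J (fun j => f j - g j) = isum J f - isum J g.
Proof. exact: sumrB. Qed.

Lemma isumZ (V : pzRingType) J a (f : int -> V) :
  isum J (fun j => a * f j) = a * isum J f.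
Proof. by rewrite /isum mulr_sumr. Qed.

Lemma isumZr (V : pzRingType) J a (f : int -> V) :
  isum J (fun j => f j * a) = isum J f * a.
Proof. by rewrite /isum mulr_suml. Qed.

Lemma isum_exchange (V : nmodType) (I : finType) J (f : int -> I -> V) :
  isum J (fun j => \sum_(i : I) f j i) = \sum_(i : I) isum J (f^~ i).
Proof. exact: exchange_big. Qed.

Lemma le_isum (R : numDomainType) J (f g : int -> R) :
  (forall j, f j <= g j) -> isum J f <= isum J g.
Proof. by move=> fg; apply: ler_sum => j _; exact: fg. Qed.

Lemma isum_ge0 (R : numDomainType) J (f : int -> R) :
  (forall j, 0 <= f j) -> 0 <= isum J f.
Proof. by move=> f0; apply: sumr_ge0 => j _; exact: f0. Qed.

Lemma isum_le_nat (R : numDomainType) J J' (f : int -> R) :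
  (forall j, 0 <= f j) -> (J <= J')%N -> isum J f <= isum J' f.
Proof.
move=> f0; elim: J' => [|J' IH]; first by rewrite leqn0 => /eqP ->.
rewrite leq_eqVlt => /orP[/eqP -> //|]; rewrite ltnS => /IH h.
by rewrite isumS (le_trans h) // lerDl addr_ge0.
Qed.

Lemma isum_ge_term (R : numDomainType) J (f : int -> R) k :
  (forall j, 0 <= f j) -> (`|k| <= J)%N -> f k <= isum J f.
Proof.
move=> f0 kJ; apply: le_trans (isum_le_nat f0 kJ).
case hk: `|k|%N => [|n].
  by rewrite isum0; have -> : k = 0 by lia.
rewrite isumS; have [->|->] : k = n.+1%:Z \/ k = - n.+1%:Z by lia.
  by rewrite addrCA lerDl addr_ge0 // isum_ge0.
by rewrite addrA addrC lerDl addr_ge0 // isum_ge0.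
Qed.

End SymmetricSums.

Section PeriodicSums.
Variable R : realFieldType.

Definition per (T : Type) (M : nat) (f : int -> T) := forall x, f (x + M%:Z) = f x.

Definition psum (M : nat) (f : int -> R) : R := \sum_(x < M) f x%:Z.

Lemma psum_shift1 M f : per M f -> psum M (fun x => f (x + 1)) = psum M f.
Proof.
move=> pf; rewrite /psum; case: M pf => [|M] pf; first by rewrite !big_ord0.
rewrite big_ord_recr big_ord_recl /= addrC; congr (_ + _).
  by rewrite -(pf 0) add0r; congr f; lia.
by apply: eq_bigr => i _; rewrite /= /bump /=; congr f; lia.
Qed.

Lemma per_shift (T : Type) M (f : int -> T) s : per M f -> per M (fun x => f (x + s)).
Proof. by move=> pf x; rewrite addrAC pf. Qed.

Lemma psum_shift M f s : per M f -> psum M (fun x => f (x + s)) = psum M f.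
Proof.
move=> pf; have h n : psum M (fun x => f (x + n%:Z)) = psum M f.
  elim: n => [|n <-]; first by apply: eq_bigr => i _; rewrite addr0.
  rewrite -[RHS](psum_shift1 (per_shift _ pf)).
  by apply: eq_bigr => i _; congr f; lia.
case: s => n; first exact: h.
rewrite NegzE -(h n.+1).
have pg : per M (fun x => f (x - n.+1%:Z)) by exact: per_shift.
have hg m : psum M (fun x => f (x - n.+1%:Z + m%:Z)) = psum M (fun x => f (x - n.+1%:Z)).
  elim: m => [|m <-]; first by apply: eq_bigr => i _; rewrite addr0.
  have p2 : per M (fun x => f (x - n.+1%:Z + m%:Z)).
    by move=> x; rewrite -(pf (x - _ + _)); congr f; lia.
  rewrite -[RHS](psum_shift1 p2).
  by apply: eq_bigr => i _; congr f; lia.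
rewrite -(hg n.+1) (h n.+1).
by apply: eq_bigr => i _; congr f; lia.
Qed.

Lemma perM M f g : per M f -> per M g -> per M (fun x => f x * g x : R).
Proof. by move=> pf pg x; rewrite pf pg. Qed.

Lemma per_shiftN (T : Type) M (f : int -> T) s : per M f -> per M (fun x => f (x - s)).
Proof. exact: per_shift. Qed.

End PeriodicSums.

Section Green.
Variable R : realType.
Implicit Types (p a c u : int -> R) (Q e B : R).

Lemma cvg_isum J (f : nat -> int -> R) (l : int -> R) (F : set_system nat) {FF : Filter F} :
  (forall j, f^~ j @ F --> l j) -> (fun n => isum J (f n)) @ F --> isum J l.
Proof.
move=> h; elim: J => [|J IH].
  by rewrite isum0; under eq_fun do rewrite isum0; exact: h.
rewrite isumS; under eq_fun do rewrite isumS.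
by apply: cvgD => //; apply: cvgD.
Qed.

(** Partial sums of the Neumann series for a u = c + p * u, ordered by the number of steps of the
    walk. *)
Fixpoint green_iter J p a c (n : nat) (k : int) : R :=
  if n is n'.+1 then
    (c k + isum J (fun j => p j * green_iter J p a c n' (k - j))) / a k
  else 0.

(** The iterates increase, and the constant [B] is a supersolution because c <= (a - Q) B, so they
    stay below [B] and converge. Starting from 0 keeps every period common to [c] and [a]. *)
Lemma green_exists J p a c Q e B :
  (forall j, 0 <= p j) -> isum J p <= Q -> 0 < e -> (forall k, Q + e <= a k) ->
  (forall k, 0 <= c k) -> (forall k, c k <= (a k - Q) * B) ->
  exists u, [/\ forall k, 0 <= u k <= B,
    forall k, a k * u k = c k + isum J (fun j => p j * u (k - j))
    & forall M, per M c -> per M a -> per M u].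
Proof.
move=> p0 pQ e0 aQ c0 cB.
have Q0 : 0 <= Q by apply: le_trans pQ; exact: isum_ge0.
have a0 k : 0 < a k by apply: lt_le_trans (aQ k); lra.
have B0 : 0 <= B.
  have := le_trans (c0 0) (cB 0); rewrite pmulr_rge0 //; have := aQ 0; lra.
pose U := green_iter J p a c.
have U0 n k : 0 <= U n k.
  elim: n k => //= n IH k; rewrite divr_ge0 ?(ltW (a0 k)) // addr_ge0 //.
  by apply: isum_ge0 => j; rewrite mulr_ge0.
have UB n k : U n k <= B.
  elim: n k => //= n IH k; rewrite ler_pdivrMr //.
  have h : isum J (fun j => p j * U n (k - j)) <= Q * B.
    apply: (@le_trans _ _ (isum J p * B)); last by rewrite ler_wpM2r.
    by rewrite -isumZr; apply: le_isum => j; rewrite ler_wpM2l.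
  apply: le_trans (lerD (cB k) h) _; lra.
have US n k : U n k <= U n.+1 k.
  elim: n k => [|n IH] k; first exact: U0.
  rewrite /= ler_wpM2r ?invr_ge0 ?(ltW (a0 k)) // lerD2l.
  by apply: le_isum => j; rewrite ler_wpM2l //; exact: IH.
have Ucv k : cvgn (U^~ k).
  apply: nondecreasing_is_cvgn; first by apply/nondecreasing_seqP => n; exact: US.
  by exists B => _ [n _ <-].
pose u k := limn (U^~ k).
exists u; split=> [k|k|M pc pa k].
- apply/andP; split.
    have h : \forall n \near \oo, 0 <= U n k by near=> n; exact: U0.
    exact: limr_ge (Ucv k) h.
  have h : \forall n \near \oo, U n k <= B by near=> n; exact: UB.
  exact: limr_le (Ucv k) h.
- have h1 : (fun n => a k * U n.+1 k) @ \oo --> a k * u k.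
    by apply: cvgM; [exact: cvg_cst|rewrite (@cvg_shiftS _ (U^~ k)); exact: Ucv].
  have h2 : (fun n => a k * U n.+1 k) @ \oo --> c k + isum J (fun j => p j * u (k - j)).
    under eq_fun do rewrite /= mulrC divfK ?gt_eqF //.
    apply: cvgD; first exact: cvg_cst.
    by apply: cvg_isum => j; apply: cvgM; [exact: cvg_cst|exact: Ucv].
  exact: cvg_unique h1 h2.
- suff UE : U^~ (k + M%:Z) = U^~ k by rewrite /u UE.
  apply/funext => n; elim: n k => [//|n IH k]; rewrite /U /= pc pa; congr (_ / _).
  congr (_ + _); apply: eq_isum => j; congr (_ * _).
  by rewrite -[RHS]IH /U; congr green_iter; lia.
Unshelve. all: by end_near.
Qed.

End Green.

Lemma per_dvdz (R : pzRingType) M : per M (fun x => (M%:Z %| x)%Z%:R : R).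
Proof. by move=> x; rewrite !(sameP dvdz_mod0P eqP) modzDr. Qed.

Lemma psum_delta (R : realFieldType) M (x : int) (f : int -> R) : (0 < M)%N ->
  per M f -> psum M (fun y => (M%:Z %| x - y)%Z%:R * f y) = f x.
Proof.
case: M => // M _ pf.
have pd : per M.+1 (fun y => (M.+1%:Z %| x - y)%Z%:R * f y).
  move=> y; rewrite pf; congr (_ * _).
  by rewrite -[LHS]per_dvdz; congr (_ %| _)%Z%:R; lia.
rewrite -(psum_shift x pd) /psum big_ord_recl big1 ?addr0 => [|i _].
  by rewrite add0r subrr dvdz0 mul1r.
rewrite (_ : (_ %| _)%Z = false) ?mul0r //; apply/negP => /dvdzP[q].
rewrite /= /bump /= => hq; have := ltn_ord i; case: q hq => [[|q]|q]; nia.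
Qed.

(** * Positive definiteness of Green functions *)

Section PosDef.
Variable R : realType.
Variables (p : int -> R) (J M : nat) (Q e : R).
Hypotheses (p_ge0 : forall j, 0 <= p j) (p_even : forall j, p (- j) = p j).
Hypotheses (pQ : isum J p <= Q) (e_gt0 : 0 < e).

Let dot (u v : int -> R) : R := psum M (fun x => u x * v x).
Let Bop (u : int -> R) (x : int) : R :=
  (Q + e) * u x - isum J (fun j => p j * u (x - j)).

Let dotC u v : dot u v = dot v u.
Proof. by apply: eq_bigr => i _; rewrite mulrC. Qed.

Let dotBr u v w : dot u (fun x => v x - w x) = dot u v - dot u w.
Proof. by rewrite -sumrB; apply: eq_bigr => i _; rewrite mulrBr. Qed.

Let dotBl u v w : dot (fun x => v x - w x) u = dot v u - dot w u.
Proof. by rewrite dotC dotBr !(dotC u). Qed.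

Let dot_ge0 u : 0 <= dot u u.
Proof. by apply: sumr_ge0 => i _; rewrite -expr2 sqr_ge0. Qed.

Let dot_shift u v s : per M u -> per M v ->
  dot (fun x => u (x + s)) (fun x => v (x + s)) = dot u v.
Proof. by move=> pu pv; exact: (psum_shift s (perM pu pv)). Qed.

Let dot_isum u (f : int -> int -> R) :
  dot u (fun x => isum J (f^~ x)) = isum J (fun j => dot u (f j)).
Proof.
rewrite /dot /psum isum_exchange; apply: eq_bigr => x _.
by rewrite -isumZ.
Qed.

Let dotZ u a v : dot u (fun x => a * v x) = a * dot u v.
Proof. by rewrite /dot /psum mulr_sumr; apply: eq_bigr => i _; rewrite mulrCA. Qed.

Let dotT u v : dot u (fun x => isum J (fun j => p j * v (x - j))) =
  isum J (fun j => p j * dot u (fun x => v (x - j))).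
Proof.
rewrite (dot_isum u (fun j x => p j * v (x - j))).
by apply: eq_isum => j; rewrite dotZ.
Qed.

Let dotB u v : dot u (Bop v) = (Q + e) * dot u v
  - isum J (fun j => p j * dot u (fun x => v (x - j))).
Proof. by rewrite /Bop dotBr dotZ dotT. Qed.

Let dotB_sym u v : per M u -> per M v -> dot u (Bop v) = dot v (Bop u).
Proof.
move=> pu pv; rewrite !dotB (dotC u v); congr (_ - _).
rewrite -isumN; apply: eq_isum => j; rewrite p_even dotC; congr (_ * _).
rewrite -(dot_shift j pv (per_shift (- j) pu)).
by apply: eq_bigr => i _; congr (v _ * u _); lia.
Qed.

(** Each shifted product is at most [dot u u], because the square of u - u(. - j) is nonnegative and
    shifts preserve [dot]; the total weight of [p] is at most [Q]. *)
Let dotB_ge0 u : per M u -> 0 <= dot u (Bop u).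
Proof.
move=> pu; rewrite dotB subr_ge0.
have h j : dot u (fun x => u (x - j)) <= dot u u.
  have := dot_ge0 (fun x => u x - u (x - j)).
  rewrite dotBl !dotBr (dotC _ u) (dot_shift (- j) pu pu); lra.
apply: (@le_trans _ _ (isum J p * dot u u)).
  by rewrite -isumZr; apply: le_isum => j; rewrite ler_wpM2l.
apply: ler_wpM2r; first exact: dot_ge0.
by apply: le_trans pQ _; rewrite lerDl ltW.
Qed.

Let perB u : per M u -> per M (Bop u).
Proof.
move=> pu x; rewrite /Bop pu; congr (_ - _).
by apply: eq_isum => j; rewrite -(pu (x - j)); congr (_ * u _); lia.
Qed.

(* With [e] the Green function of [Bop] one has [g * c = B^-1 (c - nu * c)], and
   [1 - nu] is a positive combination of the forms [(1 - tau)(1 - tau^-1)], which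
   commute with [Bop]. *)
Lemma green_posdef (g nu c : int -> R) : per M g -> per M nu -> per M c ->
  (forall x, 0 <= nu x) -> psum M nu <= 1 ->
  (forall x, Bop g x = (M%:Z %| x)%Z%:R - nu x) ->
  0 <= \sum_(x < M) \sum_(y < M) c x%:Z * c y%:Z * g (x%:Z - y%:Z).
Proof.
move=> pg pnu pc nu0 nu1 gE.
have [M0|M0] := posnP M.
  rewrite big1 // => i _; have := ltn_ord i; lia.
pose dl (x : int) : R := (M%:Z %| x)%Z%:R.
have pdl : per M dl.
  exact: per_dvdz.
have Q0 : 0 <= Q by apply: le_trans pQ; exact: isum_ge0.
(* The Green function of [Bop] on Z / M; the uniform killing [e] keeps it below [e^-1]. *)
have [E [_ EE pE]] : exists u, [/\ forall k, 0 <= u k <= e^-1,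
    forall k, (Q + e) * u k = dl k + isum J (fun j => p j * u (k - j))
    & forall M', per M' dl -> per M' (fun _ : int => Q + e) -> per M' u].
  apply: (@green_exists _ J p (fun=> Q + e) dl Q e) => // k.
  by rewrite addrAC subrr add0r divff ?gt_eqF // /dl lern1 leq_b1.
have {}pE : per M E by exact: pE.
pose conv (f : int -> R) (x : int) := \sum_(y < M) c y%:Z * f (x - y%:Z).
have pconv f : per M f -> per M (conv f).
  move=> pf x; apply: eq_bigr => y _; rewrite -(pf (x - y%:Z)).
  by congr (_ * f _); lia.
have conv_dl x : conv dl x = c x.
  by rewrite -[RHS](psum_delta x M0 pc); apply: eq_bigr => y _; rewrite mulrC.
have Bconv f x : Bop (conv f) x = conv (Bop f) x.
  rewrite /Bop /conv mulr_sumr.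
  under eq_isum => j do rewrite mulr_sumr.
  rewrite isum_exchange -sumrB; apply: eq_bigr => y _.
  rewrite mulrBr mulrCA; congr (_ - _).
  by rewrite -isumZ; apply: eq_isum => j; rewrite mulrCA; congr (_ * (_ * f _)); lia.
(* [d] is the solution of Bop d = c, so the form becomes dot d (c - nu * c). *)
pose d := conv E.
have pd : per M d by exact: pconv.
have Bd x : Bop d x = c x.
  rewrite Bconv -conv_dl; apply: eq_bigr => y _; congr (_ * _).
  by rewrite /Bop EE addrK.
have -> : \sum_(x < M) \sum_(y < M) c x%:Z * c y%:Z * g (x%:Z - y%:Z) = dot c (conv g).
  apply: eq_bigr => x _; rewrite mulr_sumr; apply: eq_bigr => y _.
  by rewrite mulrA.
have -> : dot c (conv g) = dot d (Bop (conv g)).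
  rewrite [RHS](dotB_sym pd (pconv _ pg)) [LHS]dotC.
  by apply: eq_bigr => x _; rewrite Bd.
have -> : dot d (Bop (conv g)) = dot d c - dot d (conv nu).
  rewrite -dotBr; apply: eq_bigr => x _; congr (_ * _).
  rewrite Bconv -conv_dl -sumrB; apply: eq_bigr => y _.
  by rewrite gE -mulrBr.
have dc : dot d c = dot d (Bop d) by apply: eq_bigr => x _; rewrite Bd.
rewrite subr_ge0.
have -> : dot d (conv nu) = psum M (fun z => nu z * dot d (fun x => Bop d (x - z))).
  rewrite /dot /psum.
  under eq_bigr => x _ do rewrite mulr_sumr.
  under [RHS]eq_bigr => x _ do rewrite mulr_sumr.
  rewrite exchange_big [RHS]exchange_big /=.
  transitivity (\sum_(y < M) \sum_(z < M) d (z%:Z + y%:Z) * (c y%:Z * nu z%:Z)).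
    apply: eq_bigr => y _; rewrite -/(psum M (fun z => d (z + y%:Z) * (c y%:Z * nu z))).
    have pf : per M (fun x => d x * (c y%:Z * nu (x - y%:Z))).
      by move=> x; rewrite pd (per_shiftN _ pnu).
    apply: etrans (esym (psum_shift y%:Z pf)) _.
    by apply: eq_bigr => z _ /=; rewrite addrK.
  rewrite exchange_big [RHS]exchange_big /=; apply: eq_bigr => z _.
  have pf : per M (fun x => nu z%:Z * (d x * c (x - z%:Z))).
    by move=> x; rewrite pd (per_shiftN _ pc).
  transitivity (psum M (fun x => nu z%:Z * (d x * c (x - z%:Z)))); last first.
    by apply: eq_bigr => x _; rewrite Bd.
  apply/esym/(etrans (esym (psum_shift z%:Z pf)))/eq_bigr => y _ /=.
  by rewrite addrK addrC mulrCA (mulrC (nu _)) !mulrA.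
rewrite dc; apply: (@le_trans _ _ (psum M nu * dot d (Bop d))); last first.
  by rewrite ler_piMl // dotB_ge0.
rewrite /psum mulr_suml; apply: ler_sum => z _; rewrite ler_wpM2l //.
have ps : per M (fun x => d (x - z%:Z)) by exact: per_shift.
have -> : dot d (fun x => Bop d (x - z%:Z)) = dot d (Bop (fun x => d (x - z%:Z))).
  apply: eq_bigr => x _; congr (_ * (_ - _)).
  by apply: eq_isum => j; congr (_ * d _); lia.
(* Positivity on d - d(. - z), whose two diagonal terms agree by translation invariance, bounds the
   mixed term by [dot d (Bop d)]. *)
have := dotB_ge0 (u := fun x => d x - d (x - z%:Z)).
have pdd : per M (fun x => d x - d (x - z%:Z)) by move=> x; rewrite pd ps.
move=> /(_ pdd).
have -> : dot (fun x => d x - d (x - z%:Z)) (Bop (fun x => d x - d (x - z%:Z))) =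
  dot (fun x => d x - d (x - z%:Z)) (Bop d)
  - dot (fun x => d x - d (x - z%:Z)) (Bop (fun x => d (x - z%:Z))).
  rewrite -dotBr; apply: eq_bigr => x _; congr (_ * _).
  rewrite /Bop; under eq_isum => j do rewrite mulrBr.
  by rewrite isumB /=; ring.
rewrite !dotBl (dotB_sym ps pd).
have -> : dot (fun x => d (x - z%:Z)) (Bop (fun x => d (x - z%:Z))) = dot d (Bop d).
  rewrite -(dot_shift (- z%:Z) pd (perB pd)); apply: eq_bigr => x _.
  congr (_ * (_ - _)).
  by apply: eq_isum => j; congr (_ * d _); lia.
lra.
Qed.
End PosDef.

Section UltraLimits.
Variable R : realType.

(** An ultrafilter chosen once serves all bounded sequences, which spares a diagonal extraction over
    the coordinates. *)
Lemma ultra_bounded_cvg (F : set_system nat) (UF : UltraFilter F) (f : nat -> R) B :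
  (forall n, `|f n| <= B) -> exists l : R, f @ F --> l.
Proof.
move=> fB.
have cpt : compact [set` `[- B, B]] by exact: segment_compact.
have [|l [_ cl]] := cpt (f @ F) _.
  by apply: (@filterS _ F _ setT) => [n _|]; [rewrite /= in_itv /= -ler_norml|exact: filterT].
exists l => V Vl; have [//|FnV] := in_ultra_setVsetC (f @^-1` V) UF.
by have [x [/= nVx Vx]] := cl (~` V) V FnV Vl; case: nVx.
Qed.

Lemma ultra_nat : exists2 F : set_system nat, UltraFilter F &
  forall P : set nat, (\forall n \near \oo, P n) -> F P.
Proof.
have [F [UF sF]] := ultraFilterLemma (eventually_filter).
by exists F => // P; exact: sF.
Qed.

End UltraLimits.

(** * Green functions on Z / M and their limit *)

Section PeriodicGreen.
Variable R : realType.
Variables (p : int -> R) (Q dlt : R).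
Hypotheses (p_ge0 : forall j, 0 <= p j) (p_even : forall j, p (- j) = p j).
Hypotheses (pQ : forall J, isum J p <= Q) (dlt_gt0 : 0 < dlt).

Definition rho (k : int) : R := dlt / (`|k|%N%:R + 1).

(** [rho] of the distance to the nearest multiple of [M]. *)
Definition rho_per (M : nat) (k : int) : R :=
  dlt / ((minn `|(k %% M%:Z)%Z| `|(M%:Z - (k %% M%:Z)%Z)|)%N%:R + 1).

Lemma rho_perE M k : (`|k|.*2 < M)%N -> rho_per M k = rho k.
Proof.
move=> kM; rewrite /rho_per /rho; congr (_ / (_%:R + _)).
case: k kM => k kM.
  by rewrite modz_small; lia.
have -> : (Negz k %% M%:Z)%Z = M%:Z - k.+1%:Z.
  rewrite -(@modz_small (M%:Z - k.+1%:Z) M%:Z); last lia.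
  by rewrite NegzE modzDl.
lia.
Qed.

Lemma per_rho_per M : per M (rho_per M).
Proof. by move=> x; rewrite /rho_per modzDr. Qed.

Lemma rho_per_gt0 M k : 0 < rho_per M k.
Proof. by rewrite divr_gt0 // ltr_wpDl. Qed.

Lemma rho_gt0 k : 0 < rho k.
Proof. by rewrite divr_gt0 // ltr_wpDl. Qed.

(** On Z / M all sums are finite, and [green_posdef] applies with the non-uniform killing moved to
    the right-hand side as nu = rho g. The extra uniform killing 1 / M makes [Bop] invertible and
    disappears in the limit. *)
Lemma periodic_green n (M := n.+1) (e : R := M%:R^-1) : exists g : int -> R,
  [/\ forall k, 0 <= g k <= dlt^-1,
      forall k, (Q + e + rho_per M k) * g k =
        (M%:Z %| k)%Z%:R + isum n (fun j => p j * g (k - j)),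
      forall N, (N.*2 < M)%N -> isum N (fun k => rho_per M k * g k) <= 1
    & forall (I : finType) (w : I -> R) (pt : I -> int),
        0 <= \sum_a \sum_b w a * w b * g (pt a - pt b)].
Proof.
have e0 : 0 < e by rewrite invr_gt0 ltr0n.
pose dl (x : int) : R := (M%:Z %| x)%Z%:R.
have pdl : per M dl by exact: per_dvdz.
have prho := @per_rho_per M.
have [g [gB gE pg]] : exists u, [/\ forall k, 0 <= u k <= dlt^-1,
    forall k, (Q + e + rho_per M k) * u k = dl k + isum n (fun j => p j * u (k - j))
    & forall M', per M' dl -> per M' (fun k : int => Q + e + rho_per M k) -> per M' u].
  apply: (green_exists (e := e) p_ge0 (pQ n) e0) => k.
  - by rewrite lerDl ltW // rho_per_gt0.
  - exact: ler0n.
  - rewrite /dl; have r0 := rho_per_gt0 M k.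
    have i0 : 0 < dlt^-1 by rewrite invr_gt0.
    (* The source sits at the multiples of [M], where [rho_per] equals [dlt]; hence the bound
       [dlt^-1]. *)
    case: (boolP (_ %| _)%Z) => [/dvdz_mod0P kM|_]; last by apply: mulr_ge0; lra.
    have -> : rho_per M k = dlt.
      by rewrite /rho_per kM min0n add0r divr1.
    rewrite -(mulfV (lt0r_neq0 dlt_gt0)) ler_wpM2r //; lra.
have {}pg : per M g by apply: pg => // x; rewrite prho.
have g0 k : 0 <= g k by case/andP: (gB k).
pose nu k := rho_per M k * g k.
have nu0 k : 0 <= nu k by rewrite mulr_ge0 // ltW // rho_per_gt0.
have pnu : per M nu by move=> x; rewrite /nu prho pg.
have nu1 : psum M nu <= 1.
  have dl1 : psum M dl = 1.
    rewrite /psum big_ord_recl big1 => [|i _]; first by rewrite /dl dvdz0 addr0.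
    rewrite /dl (_ : (_ %| _)%Z = false) //; apply/negP => /dvdzP[q].
    rewrite /= /bump /= => hq; have := ltn_ord i; case: q hq => [[|q]|q]; rewrite /M; nia.
  have gs : 0 <= psum M g by apply: sumr_ge0.
  (* The equation is summed over a period: the source gives 1, and the walk returns at most Q times
     the total of g. *)
  have : psum M (fun k => (Q + e + rho_per M k) * g k) =
      psum M (fun k => dl k + isum n (fun j => p j * g (k - j))).
    by apply: eq_bigr => k _; rewrite gE.
  rewrite [RHS]big_split /= -/(psum M dl) dl1 -isum_exchange.
  have -> : isum n (fun j => \sum_(i < M) p j * g (i%:Z - j)) = isum n p * psum M g.
    rewrite -isumZr; apply: eq_isum => j; rewrite -(psum_shift (- j) pg).
    by rewrite /psum mulr_sumr.
  have -> : psum M (fun k => (Q + e + rho_per M k) * g k) = (Q + e) * psum M g + psum M nu.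
    by rewrite /psum mulr_sumr -big_split; apply: eq_bigr => k _; rewrite /= -mulrDl.
  have := ler_wpM2r gs (pQ n); have := mulr_ge0 (ltW e0) gs; lra.
exists g; split=> // [N NM|I w pt].
  apply: le_trans nu1; rewrite -(psum_shift (- N%:Z) pnu) /isum /psum.
  rewrite -!(big_mkord xpredT (fun j : nat => nu (j%:Z - N%:Z))).
  rewrite (big_cat_nat (leq0n N.*2.+1) NM) /= lerDl.
  by apply: sumr_ge0.
(* Weights at arbitrary integer points are gathered into one weight on Z / M. *)
pose c x := \sum_a w a * dl (pt a - x).
have pc : per M c.
  move=> x; apply: eq_bigr => a _; congr (_ * _).
  by rewrite -[LHS]pdl; congr dl; lia.
have := @green_posdef _ p n M Q e p_ge0 p_even (pQ n) e0 g nu c pg pnu pc nu0 nu1.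
have h x : (Q + e) * g x - isum n (fun j => p j * g (x - j)) = dl x - nu x.
  by have := gE x; rewrite /nu mulrDl; lra.
move=> /(_ h); congr (_ <= _).
transitivity (\sum_(x < M) c x%:Z * \sum_b w b * g (x%:Z - pt b)).
  apply: eq_bigr => x _.
  transitivity (c x%:Z * psum M (fun y => c y * g (x%:Z - y))).
    by rewrite /psum mulr_sumr; apply: eq_bigr => y _; rewrite mulrA.
  congr (_ * _); rewrite /psum.
  under eq_bigr => y _ do rewrite /c mulr_suml.
  rewrite exchange_big; apply: eq_bigr => b _.
  have pf : per M (fun y => g (x%:Z - y)).
    by move=> y; rewrite -[LHS]pg; congr g; lia.
  rewrite -[in RHS](psum_delta (pt b) _ pf) // /psum mulr_sumr.
  by apply: eq_bigr => y _; rewrite mulrA.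
under eq_bigr => x _ do rewrite /c mulr_suml.
rewrite exchange_big; apply: eq_bigr => a _.
have pf : per M (fun x => \sum_b w b * g (x - pt b)).
  by move=> y; apply: eq_bigr => b _; rewrite -[in RHS]pg; congr (_ * g _); lia.
transitivity (w a * psum M (fun x => dl (pt a - x) * \sum_b w b * g (x - pt b))).
  by rewrite /psum mulr_sumr; apply: eq_bigr => x _; rewrite mulrA.
rewrite (psum_delta (pt a) _ pf) // mulr_sumr.
by apply: eq_bigr => b _; rewrite mulrA.
Qed.

(** The clauses on p * G use truncated sums so that limits pass termwise. When [isum J p] tends to
    [Q], they say together that G solves the equation with killing [rho] at every k other than 0. *)
Lemma green_limit : exists G : int -> R,
  [/\ forall k, 0 <= G k <= dlt^-1, 0 < G 0,
      forall J k, isum J (fun j => p j * G (k - j)) <= (Q + rho k) * G k,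
      forall J k, k != 0 -> (Q + rho k) * G k - isum J (fun j => p j * G (k - j)) <=
         dlt^-1 * (Q - isum J p)
    & (forall N, isum N (fun k => rho k * G k) <= 1) /\
      forall (I : finType) (w : I -> R) (pt : I -> int),
        0 <= \sum_a \sum_b w a * w b * G (pt a - pt b)].
Proof.
have [F UF Foo] := ultra_nat.
have /choice[g gP] := periodic_green.
have gB n k : 0 <= g n k <= dlt^-1 by case: (gP n).
have di0 : 0 <= dlt^-1 by rewrite invr_ge0 ltW.
have /choice[G GP] : forall k, exists l : R, (g ^~ k) @ F --> l.
  move=> k; apply: (@ultra_bounded_cvg _ _ UF _ dlt^-1) => n.
  by have /andP[h1 h2] := gB n k; rewrite ger0_norm.
have PF : ProperFilter F by exact: ultra_proper.
have sub (f h : nat -> R) a b : f @ F --> a -> h @ F --> b ->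
    (\forall n \near \oo, f n <= h n) -> a <= b.
  by move=> fa hb fh; apply: (ler_cvg_to fa hb); exact: Foo.
have GB k : 0 <= G k <= dlt^-1.
  apply/andP; split.
    by apply: (sub (fun=> 0) _ _ _ (cvg_cst _) (GP k)); near=> n; case/andP: (gB n k).
  by apply: (sub _ (fun=> dlt^-1) _ _ (GP k) (cvg_cst _)); near=> n; case/andP: (gB n k).
have ecv : (fun n : nat => n.+1%:R^-1 : R) @ F --> (0 : R).
  by move=> V /cvg_harmonic hV; exact: Foo.
have Tcv J k : (fun n => isum J (fun j => p j * g n (k - j))) @ F -->
    isum J (fun j => p j * G (k - j)).
  by apply: cvg_isum => j; apply: cvgM; [exact: cvg_cst|exact: GP].
have Lcv k : (fun n => (Q + n.+1%:R^-1 + rho k) * g n k) @ F --> (Q + rho k) * G k.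
  rewrite -[in X in _ --> X](addr0 Q); apply: cvgM; last exact: GP.
  apply: cvgD; last exact: cvg_cst.
  by apply: cvgD; [exact: cvg_cst|exact: ecv].
have gE n k : (`|k|.*2 < n.+1)%N -> (Q + n.+1%:R^-1 + rho k) * g n k =
    (n.+1%:Z %| k)%Z%:R + isum n (fun j => p j * g n (k - j)).
  by move=> kn; rewrite -(rho_perE kn); case: (gP n).
have pg0 n k j : 0 <= p j * g n (k - j).
  by rewrite mulr_ge0 //; case/andP: (gB n (k - j)).
have b J k : isum J (fun j => p j * G (k - j)) <= (Q + rho k) * G k.
  apply: (sub _ _ _ _ (Tcv J k) (Lcv k)); near=> n.
  rewrite gE; last by near: n; exists `|k|.*2 => //= n; rewrite ltnS.
  apply: (@le_trans _ _ (isum n (fun j => p j * g n (k - j)))).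
    by apply: isum_le_nat => [j|]; [exact: pg0|near: n; exact: nbhs_infty_ge].
  by rewrite lerDr ler0n.
have Q0 : 0 <= Q by apply: le_trans (pQ 0); exact: isum_ge0.
exists G; split=> //.
- have h : 1 <= (Q + rho 0) * G 0.
    apply: (sub (fun=> 1) _ _ _ (cvg_cst _) (Lcv 0)); near=> n.
    by rewrite gE // dvdz0 lerDl; apply: isum_ge0 => j; exact: pg0.
  have := rho_gt0 0; have /andP[] := GB 0; rewrite le_eqVlt => /orP[/eqP g0|//].
  by move: h; rewrite -g0 mulr0; lra.
- move=> J k k0.
  have h : (fun n => (Q + n.+1%:R^-1 + rho k) * g n k - isum J (fun j => p j * g n (k - j)))
      @ F --> (Q + rho k) * G k - isum J (fun j => p j * G (k - j)) by apply: cvgB.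
  apply: (sub _ (fun=> dlt^-1 * (Q - isum J p)) _ _ h (cvg_cst _)); near=> n.
  have kn : (`|k|.*2 < n.+1)%N by near: n; exists `|k|.*2 => //= n; rewrite ltnS.
  have Jn : (J <= n)%N by near: n; exact: nbhs_infty_ge.
  rewrite /= gE //.
  have -> : (n.+1%:Z %| k)%Z = false.
    apply/negP => /dvdzP[q hq]; move: k0; rewrite hq mulf_eq0 negb_or => /andP[q0 _].
    by move: kn; rewrite hq abszM; nia.
  rewrite add0r.
  (* Since g <= dlt^-1, the terms with J < |j| <= n weigh at most dlt^-1 times the mass of [p]
     there. *)
  have tail : forall m (f : int -> R), (forall j, 0 <= f j <= dlt^-1) ->
    isum (J + m) (fun j => p j * f j) - isum J (fun j => p j * f j) <=
      dlt^-1 * (isum (J + m) p - isum J p).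
    move=> m f fB; elim: m => [|m IH]; first by rewrite addn0 !subrr mulr0.
    rewrite addnS !isumS.
    have hj j : p j * f j <= dlt^-1 * p j.
      by rewrite mulrC ler_wpM2r //; case/andP: (fB j).
    have := hj (J + m).+1%:Z; have := hj (- (J + m).+1%:Z); lra.
  have := tail (n - J)%N (fun j => g n (k - j)) (fun j => gB n (k - j)).
  rewrite subnKC // => /le_trans; apply; rewrite ler_wpM2l // lerB //.
- split=> [N|I w pt].
    have h : (fun n => isum N (fun k => rho k * g n k)) @ F --> isum N (fun k => rho k * G k).
      by apply: cvg_isum => j; apply: cvgM; [exact: cvg_cst|exact: GP].
    apply: (sub _ (fun=> 1) _ _ h (cvg_cst _)); near=> n.
    have Nn : (N.*2 < n.+1)%N by near: n; exists N.*2 => //= n; rewrite ltnS.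
    have [_ _ + _] := gP n => /(_ N Nn); congr (_ <= _).
    apply: eq_bigr => j _; rewrite rho_perE //.
    have := ltn_ord j; lia.
  have h : (fun n => \sum_a \sum_b w a * w b * g n (pt a - pt b)) @ F -->
      \sum_a \sum_b w a * w b * G (pt a - pt b).
    apply: cvg_big => [|a _]; first exact: add_continuous.
    apply: cvg_big => [|b' _]; first exact: add_continuous.
    by apply: cvgM; [exact: cvg_cst|exact: GP].
  apply: (sub (fun=> 0) _ _ _ (cvg_cst _) h); near=> n.
  by case: (gP n).
Unshelve. all: by end_near.
Qed.

End PeriodicGreen.

Section SlowVariation.
Variable R : realType.
Variables (p : int -> R) (Q : R).
Hypotheses (p_ge0 : forall j, 0 <= p j) (p_even : forall j, p (- j) = p j).
Hypotheses (pQ : forall J, isum J p <= Q).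
Hypothesis pQ_lim : forall e, 0 < e -> exists J, Q - isum J p <= e.

Let pQ_lim_ge J0 e : 0 < e -> exists2 J, (J0 <= J)%N & Q - isum J p <= e.
Proof.
move=> /pQ_lim[J Je]; exists (maxn J0 J); first exact: leq_maxl.
by apply: le_trans Je; rewrite lerB // isum_le_nat // leq_maxr.
Qed.

(* The increment [u k = G (k + s) - G k] is again harmonic; where it is close to
   its supremum it stays so along the progression [k + i s], which a positive
   supremum makes impossible for bounded [G]. *)
Lemma harmonic_shift_le (G : int -> R) (B : R) (s : int) :
  (forall k, 0 <= G k <= B) ->
  (forall J k, `|Q * G k - isum J (fun j => p j * G (k - j))| <= B * (Q - isum J p)) ->
  0 < p s -> forall k, G (k + s) <= G k.
Proof.
move=> GB Gh ps k0; rewrite leNgt; apply/negP => Gk0.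
pose u k := G (k + s) - G k.
have uB k : u k <= B by have := GB (k + s); have := GB k; rewrite /u; lra.
have u0 : 0 < u k0 by rewrite /u; lra.
have B0 : 0 <= B by have := GB 0; lra.
pose D := sup (range u).
have hs : has_sup (range u) by split; [exists (u k0), k0|exists B => _ [k _ <-]].
have uD k : u k <= D by apply: sup_upper_bound => //; exists k.
have D0 : 0 < D by apply: lt_le_trans (uD k0).
have Q0 : 0 < Q.
  by apply: lt_le_trans ps (le_trans _ (pQ `|s|)); apply: isum_ge_term.
have psQ : p s <= Q by apply: le_trans (pQ `|s|); apply: isum_ge_term.
(* The deficit D - u is averaged with weights [p], so at k + s, which has weight [p s], it is at
   most Q / p s times its value at k. *)
pose r := Q / p s.
have r1 : 1 <= r by rewrite ler_pdivlMr // mul1r.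
have key k : D - u (k + s) <= r * (D - u k).
  rewrite /r mulrAC ler_pdivlMr // mulrC; apply/ler_addgt0Pr => e e0.
  have [|J sJ Je] := pQ_lim_ge `|s|%N (e := e / (2 * B + 1)).
    by rewrite divr_gt0 //; lra.
  have h1 := Gh J k; have h2 := Gh J (k + s).
  have h3 : p s * (D - u (k + s)) <= isum J (fun j => p j * (D - u (k - j))).
    have := @isum_ge_term _ J (fun j => p j * (D - u (k - j))) (- s).
    rewrite p_even opprK abszN; apply => // j.
    by rewrite mulr_ge0 // subr_ge0.
  have h4 : isum J (fun j => p j * (D - u (k - j))) = isum J p * D
     - (isum J (fun j => p j * G (k + s - j)) - isum J (fun j => p j * G (k - j))).
    rewrite -isumZr -!isumB; apply: eq_isum => j.
    by rewrite /u addrAC mulrBr mulrBr.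
  have h5 : 2 * B * (Q - isum J p) <= e.
    have : 2 * B * (Q - isum J p) <= 2 * B * (e / (2 * B + 1)) by rewrite ler_wpM2l //; lra.
    move=> /le_trans; apply; rewrite mulrA ler_pdivrMr; lra.
  have h6 : isum J p * D <= Q * D by rewrite ler_wpM2r // ltW.
  move: h1 h2; rewrite !ler_norml => /andP[h1 h1'] /andP[h2 h2'].
  by rewrite /u in h3 h4 *; lra.
have iter i k : D - u (k + s *+ i) <= r ^+ i * (D - u k).
  elim: i k => [|i IH] k; first by rewrite mulr0n addr0 expr0 mul1r.
  rewrite mulrSr addrA; apply: le_trans (key _) _.
  by rewrite exprS -mulrA ler_wpM2l //; lra.
(* [n] increments of size D / 2 would exceed the bound [B] on G; k is then taken so close to the
   supremum that the deficit stays below D / 2 for all of them. *)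
have [n nB] : exists n : nat, B < n%:R * (D / 2).
  exists (Num.truncn (B / (D / 2))).+1; rewrite -ltr_pdivrMr; last lra.
  exact: truncnS_gt.
have [|_ [k _ <-] uk] := @sup_adherent _ (range u) (D / 2 / r ^+ n) _ hs.
  by rewrite divr_gt0 ?exprn_gt0 //; lra.
have uk2 i : (i <= n)%N -> D / 2 <= u (k + s *+ i).
  move=> i_n; have := iter i k.
  have : r ^+ i * (D - u k) <= r ^+ n * (D / 2 / r ^+ n).
    apply: ler_pM; rewrite ?exprn_ge0 ?subr_ge0 //; first by lra.
      by rewrite ler_weXn2l.
    by rewrite -/D in uk; lra.
  rewrite mulrCA divff ?mulr1; last by rewrite gt_eqF // exprn_gt0 //; lra.
  lra.
have : forall i, (i <= n)%N -> i%:R * (D / 2) <= G (k + s *+ i) - G k.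
  elim=> [_|i IH i_n]; first by rewrite mul0r mulr0n addr0 subrr.
  have := uk2 i (ltnW i_n); have := IH (ltnW i_n).
  by rewrite /u [s *+ i.+1]mulrSr addrA -natr1; lra.
by move=> /(_ n (leqnn n)); have := GB k; have := GB (k + s *+ n); lra.
Qed.

Variables (dlt B : R) (G : int -> R).
Hypotheses (dlt_gt0 : 0 < dlt) (GB : forall k, 0 <= G k <= B).
Hypothesis Gsup : forall J k, isum J (fun j => p j * G (k - j)) <= (Q + rho dlt k) * G k.
Hypothesis Gnear : forall J k, k != 0 ->
  (Q + rho dlt k) * G k - isum J (fun j => p j * G (k - j)) <= B * (Q - isum J p).

Lemma rho_small e : 0 < e -> exists N, forall k, (N <= `|k|)%N -> rho dlt k <= e.
Proof.
move=> e0; exists (Num.truncn (dlt / e)).+1 => k Nk.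
rewrite /rho ler_pdivrMr ?ltr_wpDl // mulrC -ler_pdivrMr //.
have := truncnS_gt (dlt / e); have : (Num.truncn (dlt / e)).+1%:R <= `|k|%N%:R :> R.
  by rewrite ler_nat.
lra.
Qed.

(** If the increment exceeded [e] arbitrarily far out, the translates of G to such points would have
    a limit along an ultrafilter. There rho has disappeared and the limit is harmonic, so
    [harmonic_shift_le] forbids the increment. *)
Lemma slow_variation s e : 0 < p s -> 0 < e ->
  exists K, forall k, (K <= `|k|)%N -> G (k + s) - G k <= e.
Proof.
move=> ps e0; apply: contrapT => /forallNP noK.
have /choice[kk kkP] : forall n : nat, exists k, (n <= `|k|)%N /\ e < G (k + s) - G k.
  move=> n; have /existsNP[k /not_implyP[nk /negP]] := noK n.
  by rewrite -ltNge; exists k.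
have [F UF Foo] := ultra_nat.
have PF : ProperFilter F by exact: ultra_proper.
have /choice[H HP] : forall x, exists l : R, (fun n => G (kk n + x)) @ F --> l.
  move=> x; apply: (@ultra_bounded_cvg _ _ UF _ B) => n.
  by have /andP[h1 h2] := GB (kk n + x); rewrite ger0_norm.
have sub (f h : nat -> R) a b : f @ F --> a -> h @ F --> b ->
    (\forall n \near \oo, f n <= h n) -> a <= b.
  by move=> fa hb fh; apply: (ler_cvg_to fa hb); exact: Foo.
have HB k : 0 <= H k <= B.
  apply/andP; split.
    by apply: (sub (fun=> 0) _ _ _ (cvg_cst _) (HP k)); near=> n; case/andP: (GB (kk n + k)).
  by apply: (sub _ (fun=> B) _ _ (HP k) (cvg_cst _)); near=> n; case/andP: (GB (kk n + k)).
have B0 : 0 <= B by have := GB 0; lra.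
have Hs : forall k, H (k + s) <= H k.
  apply: (harmonic_shift_le HB) => // J k.
  have cv : (fun n => `|Q * G (kk n + k) - isum J (fun j => p j * G (kk n + (k - j)))|) @ F
      --> `|Q * H k - isum J (fun j => p j * H (k - j))|.
    apply: cvg_norm; apply: cvgB.
      by apply: cvgM; [exact: cvg_cst|exact: HP].
    by apply: cvg_isum => j; apply: cvgM; [exact: cvg_cst|exact: HP].
  apply/ler_addgt0Pr => d d0.
  have [|N NP] := @rho_small (d / (B + 1)); first by rewrite divr_gt0 //; lra.
  apply: (sub _ (fun=> B * (Q - isum J p) + d) _ _ cv (cvg_cst _)); near=> n.
  have nk : (N + `|k| < n)%N by near: n; exists (N + `|k|).+1.
  have kn : (n <= `|kk n|)%N by case: (kkP n).
  have Nk : (N <= `|(kk n + k)%R|)%N by lia.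
  have k0 : kk n + k != 0 by lia.
  have := Gnear J k0; have := Gsup J (kk n + k).
  have -> : isum J (fun j => p j * G (kk n + k - j)) = isum J (fun j => p j * G (kk n + (k - j))).
    by apply: eq_isum => j; rewrite addrA.
  have : rho dlt (kk n + k) * G (kk n + k) <= d.
    apply: (@le_trans _ _ (d / (B + 1) * B)).
      have /andP[h1 h2] := GB (kk n + k).
      by apply: ler_pM => //; [exact: ltW (rho_gt0 dlt_gt0 _)|exact: NP].
    rewrite mulrAC ler_pdivrMr; lra.
  have : 0 <= rho dlt (kk n + k) * G (kk n + k).
    by rewrite mulr_ge0 // ?(ltW (rho_gt0 dlt_gt0 _)) //; case/andP: (GB (kk n + k)).
  have : 0 <= B * (Q - isum J p) by rewrite mulr_ge0 // subr_ge0.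
  by rewrite ler_norml; lra.
have : e <= H s - H 0.
  have cv : (fun n => G (kk n + s) - G (kk n + 0)) @ F --> H s - H 0.
    by apply: cvgB; exact: HP.
  apply: (sub (fun=> e) _ _ _ (cvg_cst _) cv); near=> n.
  by rewrite addr0 ltW //; case: (kkP n).
by have := Hs 0; rewrite add0r; lra.
Unshelve. all: by end_near.
Qed.

Lemma slow_variation_iter s (L : nat) e : 0 < p s -> 0 < e ->
  exists K, forall k m, (K <= `|k|)%N -> (`|m| <= L)%N -> G k - e <= G (k + m * s).
Proof.
move=> ps; elim: L e => [|L IH] e e0.
  exists 0%N => k m _; rewrite leqn0 => /eqP m0.
  by have -> : m = 0 by [lia]; rewrite mul0r addr0; lra.
have e20 : 0 < e / 2 by lra.
have [K1 K1P] := IH _ e20.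
have [K2 K2P] := slow_variation ps e20.
have pNs : 0 < p (- s) by rewrite p_even.
have [K3 K3P] := slow_variation pNs e20.
exists (K1 + K2 + K3 + (L.+1 * `|s|))%N => k m Kk mL.
have [mL'|mL'] := leqP `|m| L.
  by have := K1P k m; rewrite mL' => /(_ _ isT); have : (K1 <= `|k|)%N by [lia]; move=> -> /(_ isT); lra.
have [m0|m0] := leP 0 m.
  have h1 : (K1 <= `|k|)%N by lia.
  have h2 : (`|(m - 1)%R| <= L)%N by lia.
  have h3 : (K3 <= `|(k + m * s)%R|)%N by nia.
  have := K1P k (m - 1) h1 h2; have := K3P (k + m * s) h3.
  have -> : k + m * s - s = k + (m - 1) * s by ring.
  lra.
have h1 : (K1 <= `|k|)%N by lia.
have h2 : (`|(m + 1)%R| <= L)%N by lia.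
have h3 : (K2 <= `|(k + m * s)%R|)%N by nia.
have := K1P k (m + 1) h1 h2; have := K2P (k + m * s) h3.
have -> : k + m * s + s = k + (m + 1) * s by ring.
lra.
Qed.

End SlowVariation.

Section Decay.
Variable R : realType.

Lemma isum_step (f : int -> R) (s N : nat) : (forall j, 0 <= f j) -> (0 < s)%N ->
  isum N (fun m => f (m * s%:Z)) <= isum (N * s) f.
Proof.
move=> f0 s0; elim: N => [|N IH]; first by rewrite !isum0 mul0r.
rewrite isumS; case: s s0 IH => // s _ IH.
rewrite mulSn addSn addnC isumS -!PoszM.
have -> : - N.+1%:Z * s.+1%:Z = - (N * s.+1 + s).+1%:Z by lia.
have -> : (N.+1 * s.+1)%N%:Z = (N * s.+1 + s).+1%:Z by lia.
by rewrite lerD2r (le_trans IH) // isum_le_nat // leq_addr.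
Qed.

Lemma row_isum_le (f : int -> R) (L : nat) (i : 'I_L) : (forall j, 0 <= f j) ->
  \sum_(i' < L) f (i%:Z - i'%:Z) <= isum L f.
Proof.
move=> f0; have iL := ltn_ord i.
rewrite (reindex_inj rev_ord_inj) /=.
have -> : \sum_(j < L) f (i%:Z - (L - j.+1)%N%:Z) =
    \sum_(i.+1 <= j < L + i.+1) f (j%:Z - L%:Z).
  rewrite -{1}[i.+1]add0n big_addn addnK big_mkord.
  by apply: eq_bigr => j _; have := ltn_ord j => ?; congr f; lia.
rewrite /isum -(big_mkord xpredT (fun j : nat => f (j%:Z - L%:Z))).
have h1 : (i.+1 <= L.*2.+1)%N by lia.
have h2 : (i.+1 <= L + i.+1)%N by lia.
have h3 : (L + i.+1 <= L.*2.+1)%N by lia.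
rewrite (big_cat_nat (leq0n _) h1) (big_cat_nat h2 h3) /=.
by rewrite addrCA lerDl addr_ge0 // sumr_ge0.
Qed.

(** Between L and a much larger L' the weights are at least 1 / (L' + 1), while f keeps there at
    least half of the mass kap L'. Each such block adds kap / 4 to a sum that is bounded by [C]. *)
Lemma log_density (f : int -> R) (kap B C : R) : 0 < kap -> (forall m, 0 <= f m <= B) ->
  (forall L : nat, L%:R * kap <= isum L f) ->
  (forall L, isum L (fun m => f m / (`|m|%N%:R + 1)) <= C) -> False.
Proof.
move=> kap0 fB fL WC.
pose W L := isum L (fun m => f m / (`|m|%N%:R + 1)).
have B0 : 0 <= B by have := fB 0; lra.
have FB L : isum L f <= (L.*2.+1)%:R * B.
  rewrite /isum -[X in X%:R]card_ord -sum1_card natr_sum mulr_suml.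
  by apply: ler_sum => j _; rewrite mul1r; case/andP: (fB (j%:Z - L%:Z)).
have Wstep L L' : (L <= L')%N -> (isum L' f - isum L f) / (L'%:R + 1) <= W L' - W L.
  move=> LL'; suff h t : (L + t <= L')%N ->
      (isum (L + t) f - isum L f) / (L'%:R + 1) <= W (L + t)%N - W L.
    by have := h (L' - L)%N; rewrite subnKC // => /(_ (leqnn _)).
  elim: t => [|t IH]; first by rewrite addn0 !subrr mul0r.
  rewrite addnS => tL; rewrite /W !isumS -/(W (L + t)%N) -/(W L).
  have hj m : (`|m| <= L')%N -> f m / (L'%:R + 1) <= f m / (`|m|%N%:R + 1).
    move=> mL; rewrite ler_wpM2l //; first by case/andP: (fB m).
    by rewrite lef_pV2 ?posrE ?ltr_wpDl // lerD2r ler_nat.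
  have := IH (ltnW tL); have := hj (L + t).+1%:Z tL.
  have := hj (- (L + t).+1%:Z); rewrite abszN => /(_ tL).
  lra.
have big L : exists L', W L + kap / 4 <= W L'.
  (* Beyond [y] the part up to L, at most (2 L + 1) B, is less than half of kap L'. *)
  pose y := (2 * L.*2.+1%:R * B / kap).
  pose L' := (L + (Num.truncn y).+1)%N.
  exists L'; have := Wstep L L' (leq_addr _ _).
  have yL : y < L'%:R by apply: lt_le_trans (truncnS_gt y) _; rewrite ler_nat leq_addl.
  have L1 : 1 <= L'%:R :> R by rewrite ler1n /L' addnS.
  have h : (kap * L'%:R / 2) / (L'%:R + 1) <= (isum L' f - isum L f) / (L'%:R + 1).
    apply: ler_wpM2r; first by rewrite invr_ge0; lra.
    have := FB L; have := fL L'; move: yL; rewrite /y ltr_pdivrMr //; lra.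
  have h2 : kap / 4 <= (kap * L'%:R / 2) / (L'%:R + 1).
    rewrite ler_pdivlMr; last lra.
    have : kap * 1 <= kap * L'%:R by rewrite ler_wpM2l // ltW.
    lra.
  lra.
have : forall n : nat, exists L, n%:R * (kap / 4) <= W L.
  elim=> [|n [L IH]].
    exists 0%N; rewrite mul0r /W; apply: isum_ge0 => m.
    by rewrite divr_ge0 ?addr_ge0 //; case/andP: (fB m).
  have [L' hL'] := big L; exists L'; rewrite -natr1; lra.
move=> /(_ (Num.truncn (C / (kap / 4))).+1) [L]; have := WC L; rewrite -/(W L).
have := truncnS_gt (C / (kap / 4)); rewrite ltr_pdivrMr; lra.
Qed.

Variables (p : int -> R) (Q dlt : R).
Hypotheses (p_ge0 : forall j, 0 <= p j) (p_even : forall j, p (- j) = p j).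
Hypotheses (pQ : forall J, isum J p <= Q) (dlt_gt0 : 0 < dlt).
Hypothesis pQ_lim : forall e, 0 < e -> exists J, Q - isum J p <= e.

(* If [G k_n >= eta] with [|k_n| -> oo], positive definiteness compares the
   average of [G] over differences of a progression with its average near
   [k_n]; slow variation bounds the latter below, so [G] has positive density
   along the progression, against [\sum_k rho k * G k <= 1]. *)
Lemma decaying_supersolution s : s != 0 -> 0 < p s -> exists G : int -> R,
  [/\ forall k, 0 <= G k, 0 < G 0,
      forall J k, isum J (fun j => p j * G (k - j)) <= (Q + rho dlt k) * G k
    & forall e, 0 < e -> exists K, forall k, (K <= `|k|)%N -> G k <= e].
Proof.
wlog s0 : s / 0 < s.
  move=> h s0 ps; have [sp|sn] := ltP 0 s; first exact: h ps.
  by apply: (h (- s)); rewrite ?p_even ?oppr_eq0 //; lia.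
move=> _ ps.
have [G [GB G0 Gsup Gnear [Gsum Gpd]]] := green_limit p_ge0 p_even pQ dlt_gt0.
exists G; split=> //; first by move=> k; case/andP: (GB k).
move=> e e0; apply: contrapT => /forallNP noK.
have {noK} large n : exists2 k, (n <= `|k|)%N & e < G k.
  have /existsNP[k /not_implyP[nk /negP]] := noK n.
  by rewrite -ltNge; exists k.
have Gge k : 0 <= G k by case/andP: (GB k).
have [s' ss'] : exists s', s = s'.+1%:Z by exists `|s|.-1%N; lia.
pose f m := G (m * s).
(* Below, positive definiteness gives 2 A >= Bp >= (L + 1)^2 e / 2, and A is at most L + 1 times the
   sum of f, whence the density e / 4. The last constant comes from rho (m s) >= (dlt / s) / (|m| +
   1). *)
apply: (@log_density f (e / 4) dlt^-1 (s'.+1%:R / dlt)); first lra.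
- by move=> m; exact: GB.
- case=> [|L]; first by rewrite mul0r; apply: isum_ge0 => m; exact: Gge.
  have e20 : 0 < e / 2 by lra.
  have [K KP] := slow_variation_iter p_ge0 p_even pQ pQ_lim dlt_gt0 GB Gsup Gnear L.+1 ps e20.
  have [k Kk ek] := large K.
  (* Weights 1 on a progression near 0 and -1 on its translate by k: the form is 2 A minus the two
     cross terms. *)
  pose w (a : bool * 'I_L.+1) : R := if a.1 then 1 else -1.
  pose pt (a : bool * 'I_L.+1) : int := if a.1 then a.2%:Z * s else k + a.2%:Z * s.
  pose A := \sum_(i < L.+1) \sum_(i' < L.+1) f (i%:Z - i'%:Z).
  pose Bp := \sum_(i < L.+1) \sum_(i' < L.+1) G (k + (i%:Z - i'%:Z) * s).
  pose Bm := \sum_(i < L.+1) \sum_(i' < L.+1) G (- k + (i%:Z - i'%:Z) * s).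
  have pdE : \sum_a \sum_b w a * w b * G (pt a - pt b) = 2 * A - Bp - Bm.
    have split2 (F : bool * 'I_L.+1 -> R) :
        \sum_a F a = \sum_(i < L.+1) F (true, i) + \sum_(i < L.+1) F (false, i).
      transitivity (\sum_(b : bool) \sum_(i < L.+1) F (b, i)); last by rewrite big_bool.
      by rewrite pair_bigA; apply: eq_bigr => -[].
    rewrite split2; under eq_bigr do rewrite split2.
    under [X in _ + X]eq_bigr do rewrite split2.
    rewrite !big_split /= /w /pt /=.
    have -> : \sum_(i < L.+1) \sum_(i0 < L.+1) 1 * 1 * G (i%:Z * s - i0%:Z * s) = A.
      apply: eq_bigr => i _; apply: eq_bigr => i' _.
      by rewrite !mul1r /f; congr G; ring.
    have -> : \sum_(i < L.+1) \sum_(i0 < L.+1) 1 * -1 * G (i%:Z * s - (k + i0%:Z * s)) = - Bm.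
      rewrite /Bm -sumrN; apply: eq_bigr => i _; rewrite -sumrN; apply: eq_bigr => i' _.
      by rewrite mul1r mulN1r; congr (- G _); ring.
    have -> : \sum_(i < L.+1) \sum_(i0 < L.+1) -1 * 1 * G (k + i%:Z * s - i0%:Z * s) = - Bp.
      rewrite /Bp -sumrN; apply: eq_bigr => i _; rewrite -sumrN; apply: eq_bigr => i' _.
      by rewrite mulr1 mulN1r; congr (- G _); ring.
    have -> : \sum_(i < L.+1) \sum_(i0 < L.+1) -1 * -1 * G (k + i%:Z * s - (k + i0%:Z * s)) = A.
      apply: eq_bigr => i _; apply: eq_bigr => i' _.
      by rewrite mulrNN !mul1r /f; congr G; ring.
    by ring.
  have := Gpd _ w pt; rewrite pdE.
  have Bm0 : 0 <= Bm by apply: sumr_ge0 => i _; apply: sumr_ge0.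
  have cst (x : R) : \sum_(i < L.+1) x = L.+1%:R * x.
    by rewrite sumr_const card_ord mulr_natl.
  have BpL : L.+1%:R * (L.+1%:R * (e / 2)) <= Bp.
    rewrite -cst; apply: ler_sum => i _; rewrite -cst; apply: ler_sum => i' _.
    have hm : (`|(i%:Z - i'%:Z)%R| <= L.+1)%N by have := ltn_ord i; have := ltn_ord i'; lia.
    by have := KP k _ Kk hm; lra.
  have AL : A <= L.+1%:R * isum L.+1 f.
    by rewrite -cst; apply: ler_sum => i _; apply: row_isum_le => j; exact: Gge.
  have L0 : 0 < L.+1%:R :> R by rewrite ltr0n.
  move=> h; rewrite -(ler_pM2l L0); lra.
- move=> N; have r0 k : 0 <= rho dlt k * G k by rewrite mulr_ge0 // ltW // rho_gt0.
  have := le_trans (isum_step N r0 (ltn0Sn s')) (Gsum _).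
  rewrite -ss'.
  have h : isum N (fun m => f m / (`|m|%N%:R + 1)) * (dlt / s'.+1%:R) <=
      isum N (fun m => rho dlt (m * s) * G (m * s)).
    rewrite -isumZr; apply: le_isum => m; rewrite -mulrA mulrC ler_wpM2r //; first exact: Gge.
    rewrite /rho mulrC -mulrA ler_wpM2l ?(ltW dlt_gt0) // -invfM lef_pV2 ?posrE.
    + rewrite ss' abszM natrM absz_nat mulrDr mulr1 mulrC lerD2l ler1n //.
    + by rewrite mulr_gt0 ?ltr0n // ltr_wpDl.
    + by rewrite ltr_wpDl.
  move=> h1; have := le_trans h h1.
  rewrite -ler_pdivlMr ?divr_gt0 ?ltr0n // => /le_trans; apply.
  by rewrite invf_div mul1r.
Qed.

End Decay.

(** * The cone property *)

Notation nm := Normc.normc.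

Section ComplexNorm.
Variable R : rcfType.
Implicit Types (x y z : R[i]) (a b : R).

Lemma nm_ge0 x : 0 <= nm x.
Proof. by case: x => a b; exact: sqrtr_ge0. Qed.

Lemma nm0 : nm (0 : R[i]) = 0. Proof. exact: Normc.normc0. Qed.

Lemma nm1 : nm (1 : R[i]) = 1. Proof. exact: Normc.normc1. Qed.

Lemma nm_eq0 x : nm x <= 0 -> x = 0.
Proof. by move=> h; apply: Normc.eq0_normc; apply/eqP; rewrite eq_le h nm_ge0. Qed.

Lemma nmM x y : nm (x * y) = nm x * nm y. Proof. exact: Normc.normcM. Qed.

Lemma nmN x : nm (- x) = nm x. Proof. exact: normcN. Qed.

Lemma nmD x y : nm (x + y) <= nm x + nm y. Proof. exact: le_normcD. Qed.

Lemma nmB x y : nm (x - y) <= nm x + nm y.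
Proof. by rewrite -(nmN y) nmD. Qed.

Lemma nmBC x y : nm (x - y) = nm (y - x).
Proof. by rewrite -nmN opprB. Qed.

Lemma nmB_ge x y : nm x - nm y <= nm (x - y).
Proof. by have := nmD (x - y) y; rewrite subrK; lra. Qed.

Lemma nmD_ge x y : nm x - nm y <= nm (x + y).
Proof. by have := nmB_ge x (- y); rewrite opprK nmN. Qed.

Lemma nm_real a : nm (a%:C)%C = `|a|.
Proof. by rewrite /Normc.normc /= expr0n addr0 sqrtr_sqr. Qed.

Lemma nm_imag a : nm (Complex 0 a) = `|a|.
Proof. by rewrite /Normc.normc /= expr0n add0r sqrtr_sqr. Qed.

Lemma nm_sum (I : Type) (s : seq I) (P : pred I) (F : I -> R[i]) :
  nm (\sum_(i <- s | P i) F i) <= \sum_(i <- s | P i) nm (F i).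
Proof.
elim/big_ind2: _ => [|x1 x2 y1 y2 h1 h2|//]; first by rewrite nm0.
by apply: le_trans (nmD _ _) _; rewrite lerD.
Qed.

Lemma nm_isum J (f : int -> R[i]) : nm (isum J f) <= isum J (fun j => nm (f j)).
Proof. exact: nm_sum. Qed.

Lemma normr_Re x : `|complex.Re x| <= nm x.
Proof.
case: x => a b; rewrite /Normc.normc /= -sqrtr_sqr ler_wsqrtr // lerDl.
exact: sqr_ge0.
Qed.

Lemma normr_Im x : `|complex.Im x| <= nm x.
Proof.
case: x => a b; rewrite /Normc.normc /= -sqrtr_sqr ler_wsqrtr // lerDr.
exact: sqr_ge0.
Qed.

Lemma nm_sqr x : nm x ^+ 2 = complex.Re x ^+ 2 + complex.Im x ^+ 2.
Proof. by case: x => a b; rewrite sqr_sqrtr // addr_ge0 // sqr_ge0. Qed.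

Lemma nm_Re_Im x : nm x <= `|complex.Re x| + `|complex.Im x|.
Proof.
have h : 0 <= `|complex.Re x| + `|complex.Im x| by rewrite addr_ge0.
rewrite -(@ler_pXn2r _ 2) ?nnegrE ?nm_ge0 // nm_sqr.
rewrite -(real_normK (num_real (complex.Re x))) -(real_normK (num_real (complex.Im x))).
have : 0 <= `|complex.Re x| * `|complex.Im x| by rewrite mulr_ge0.
by rewrite sqrrD; lra.
Qed.

End ComplexNorm.

Section Vanishing.
Variable R : realType.

Definition tends0 (f : int -> R) :=
  forall e, 0 < e -> exists K, forall k, (K <= `|k|)%N -> f k <= e.

Lemma tends0_max (f : int -> R) : (forall k, 0 <= f k) -> tends0 f ->
  exists k0, forall k, f k <= f k0.
Proof.
move=> f0 ft; have [[k1 fk1]|none] := pselect (exists k, 0 < f k); last first.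
  exists 0 => k; apply: le_trans (f0 0); rewrite leNgt; apply/negP => fk.
  by apply: none; exists k.
have [K KP] := ft _ fk1.
pose N := (K + `|k1|)%N.
have k1N : (`|(k1 + N%:Z)%R| < N.*2.+1)%N by rewrite /N; lia.
pose F (j : 'I_N.*2.+1) := f (j%:Z - N%:Z).
have [j0 _ j0P] := @arg_maxP _ R 'I_N.*2.+1 (Ordinal k1N) xpredT F isT.
exists (j0%:Z - N%:Z) => k.
have [kN|kN] := leqP `|k| N.
  have kk : (`|(k + N%:Z)%R| < N.*2.+1)%N by lia.
  have := j0P (Ordinal kk) isT; rewrite /F /=; congr (f _ <= _); lia.
have := j0P (Ordinal k1N) isT; rewrite /F /=.
have -> : `|(k1 + N%:Z)%R|%N%:Z - N%:Z = k1 by rewrite /N; lia.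
by apply: le_trans; apply: KP; rewrite /N in kN; lia.
Qed.

End Vanishing.

Section Growth.
Variable R : realType.

Lemma expr_unbounded (x M : R) : 1 < x -> exists n, M < x ^+ n.
Proof.
move=> x1; have bern n : n%:R * (x - 1) < x ^+ n.
  elim: n => [|n IH]; first by rewrite mul0r expr0.
  have h : 1 <= x ^+ n by rewrite exprn_ege1 // ltW.
  have : 1 * (x - 1) <= x ^+ n * (x - 1) by rewrite ler_wpM2r //; lra.
  by rewrite exprSr -natr1; lra.
exists (Num.truncn (M / (x - 1))).+1; apply: lt_trans (bern _).
by rewrite -ltr_pdivrMr ?truncnS_gt // subr_gt0.
Qed.

End Growth.

Section Cone.
Variables (R : realType) (m : nat) (y : 'I_m -> int -> R[i]) (A : 'M[R[i]]_m).
Variables (c r : int -> R) (up : int -> bool) (beta d : R).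

Implicit Types (a b : 'rV[R[i]]_m) (k : int).

Definition comb (a : 'rV[R[i]]_m) (k : int) : R[i] := \sum_i a 0 i * y i k.

(** Annihilation by the product of the A - h says that [a] lies in the sum of the generalized
    eigenspaces of the h; repetitions in the list account for Jordan blocks. *)
Definition kill (hs : seq R[i]) (a : 'rV[R[i]]_m) :=
  foldl (fun b h => b *m (A - h%:M)) a hs.

Lemma combD a b k : comb (a + b) k = comb a k + comb b k.
Proof. by rewrite /comb -big_split; apply: eq_bigr => i _; rewrite mxE mulrDl. Qed.

Lemma combZ z a k : comb (z *: a) k = z * comb a k.
Proof. by rewrite /comb mulr_sumr; apply: eq_bigr => i _; rewrite mxE mulrA. Qed.

Lemma comb0 k : comb 0 k = 0.
Proof. by rewrite /comb big1 // => i _; rewrite mxE mul0r. Qed.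

Lemma combB a b k : comb (a - b) k = comb a k - comb b k.
Proof. by rewrite combD -scaleN1r combZ mulN1r. Qed.

Lemma comb_sum_le a k M : (forall i, nm (a 0 i) <= M) ->
  nm (comb a k) <= M * \sum_i nm (y i k).
Proof.
move=> aM; apply: le_trans (nm_sum _ _ _) _; rewrite mulr_sumr.
by apply: ler_sum => i _; rewrite nmM ler_wpM2r ?nm_ge0.
Qed.

(** Of the operator only a Gershgorin estimate on each row is kept, so that finite sections and
    spans of infinite sequences are covered alike. *)
Hypothesis y_tends0 : forall i, tends0 (fun k => nm (y i k)).
Hypothesis comb_inj : exists2 C : R, 0 <= C & forall a B, (forall k, nm (comb a k) <= B) ->
  forall i, nm (a 0 i) <= C * B.
Hypothesis row_bound : forall a B k, (forall k, nm (comb a k) <= B) ->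
  nm (comb (a *m A) k - (c k)%:C%C * comb a k) <= r k * B.
Hypothesis d_gt0 : 0 < d.
Hypothesis up_ge : forall k, up k -> beta + d <= c k - r k.
Hypothesis nup_le : forall k, ~~ up k -> c k + r k <= beta.

Let Y k := \sum_i nm (y i k).

Let Y_ge0 k : 0 <= Y k. Proof. by apply: sumr_ge0 => i _; exact: nm_ge0. Qed.

Let Y_tends0 : tends0 Y.
Proof.
move=> e e0; have em0 : 0 < e / (m%:R + 1) by rewrite divr_gt0 // ltr_wpDl.
have /choice[K KP] := fun i => y_tends0 i em0.
exists (\max_i K i)%N => k Kk.
apply: (@le_trans _ _ (\sum_(i < m) e / (m%:R + 1))).
  by apply: ler_sum => i _; apply: KP; apply: leq_trans Kk; exact: leq_bigmax.
rewrite sumr_const card_ord -[leLHS]mulr_natl mulrCA ler_piMr ?(ltW e0) //.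
by rewrite ler_pdivrMr ?ltr_wpDl // mul1r lerDl.
Qed.

Lemma comb_tends0 a : tends0 (fun k => nm (comb a k)).
Proof.
move=> e e0; pose M := \sum_i nm (a 0 i).
have M0 : 0 <= M by apply: sumr_ge0 => i _; exact: nm_ge0.
have eM : 0 < e / (M + 1) by rewrite divr_gt0 // ltr_wpDl.
have [K KP] := Y_tends0 eM; exists K => k Kk.
have aM i : nm (a 0 i) <= M.
  by rewrite /M (bigD1 i) //= lerDl sumr_ge0 // => j _; exact: nm_ge0.
apply: le_trans (comb_sum_le k aM) _.
apply: (@le_trans _ _ (M * (e / (M + 1)))); first by rewrite ler_wpM2l // KP.
rewrite mulrCA ler_piMr ?(ltW e0) // ler_pdivrMr ?ltr_wpDl //; lra.
Qed.

Let comb_max a : exists k0, forall k, nm (comb a k) <= nm (comb a k0).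
Proof. by apply: tends0_max => [k|]; [exact: nm_ge0|exact: comb_tends0]. Qed.

(** Induction on the factors: T a = (1 + tau h) a + tau a (A - h), where the second term has one
    factor less. The room between [rho'] and [rho] absorbs the polynomial growth due to Jordan
    blocks. *)
Lemma kill_growth tau rho' rho hs a : 0 <= tau -> 0 <= rho' -> rho' < rho ->
  (forall h, h \in hs -> nm (1 + tau%:C%C * h) <= rho') -> kill hs a = 0 ->
  exists Mb, forall n k,
    nm (comb (iter n (fun b => b + tau%:C%C *: (b *m A)) a) k) <= Mb * rho ^+ n.
Proof.
move=> tau0 rho'0 rr; pose T b := b + tau%:C%C *: (b *m A).
have TD b1 b2 : T (b1 + b2) = T b1 + T b2.
  by rewrite /T mulmxDl scalerDr addrACA.
have TZ z b : T (z *: b) = z *: T b.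
  by rewrite /T -scalemxAl scalerA mulrC -scalerA -scalerDr.
have itD n b1 b2 : iter n T (b1 + b2) = iter n T b1 + iter n T b2.
  by elim: n => //= n ->; rewrite TD.
have itZ n z b : iter n T (z *: b) = z *: iter n T b.
  by elim: n => //= n ->; rewrite TZ.
have rho0 : 0 < rho by lra.
elim: hs a => [|h hs IH] a hh /=.
  move=> a0; exists 0 => n k; rewrite -/(T) mul0r.
  have -> : iter n T a = 0.
    by rewrite (a0 : a = 0); elim: n => //= n ->; rewrite /T mul0mx scaler0 addr0.
  by rewrite comb0 nm0.
move=> kh; have [|Mb MbP] := IH (a *m (A - h%:M)) _ kh.
  by move=> h' h'hs; apply: hh; rewrite inE h'hs orbT.
have [k0 k0P] := comb_max a.
have Mb0 : 0 <= Mb.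
  by have := MbP 0%N 0; rewrite expr0 mulr1; apply: le_trans; exact: nm_ge0.
(* Chosen so that tau Mb <= M1 (rho - rho'), which closes the induction on [n]. *)
pose M1 := nm (comb a k0) + tau * Mb / (rho - rho').
have M10 : 0 <= M1 by rewrite addr_ge0 ?nm_ge0 // divr_ge0 ?mulr_ge0 // subr_ge0 ltW.
have M1k : tau * Mb <= M1 * (rho - rho').
  rewrite /M1 mulrDl divfK ?subr_eq0 ?gt_eqF // lerDr mulr_ge0 ?nm_ge0 // subr_ge0 ltW //.
exists M1; elim=> [|n IHn] k.
  rewrite expr0 mulr1 /=; apply: le_trans (k0P k) _.
  by rewrite /M1 lerDl divr_ge0 ?mulr_ge0 // subr_ge0 ltW.
rewrite iterSr -/T.
have -> : a + tau%:C%C *: (a *m A) = (1 + tau%:C%C * h) *: a + tau%:C%C *: (a *m (A - h%:M)).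
  rewrite mulmxBr mul_mx_scalar scalerBr scalerDl scale1r scalerA -addrA; congr (_ + _).
  by rewrite addrC subrK.
rewrite itD !itZ combD !combZ; apply: le_trans (nmD _ _) _; rewrite !nmM.
rewrite nm_real ger0_norm //.
have h1 : nm (1 + tau%:C%C * h) * nm (comb (iter n T a) k) <= rho' * (M1 * rho ^+ n).
  by apply: ler_pM; rewrite ?nm_ge0 ?IHn // hh // mem_head.
have h2 : tau * nm (comb (iter n T (a *m (A - h%:M))) k) <= tau * (Mb * rho ^+ n).
  by rewrite ler_wpM2l // MbP.
apply: le_trans (lerD h1 h2) _.
have : tau * Mb * rho ^+ n <= M1 * (rho - rho') * rho ^+ n.
  by rewrite ler_wpM2r // exprn_ge0 // ltW.
by rewrite exprS; lra.
Qed.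

(* Explicit Euler steps for the flow [exp (t A)] preserve the cone of those
   combinations whose maximum sits on [up], and expand there by at least
   [1 + tau (beta + d)] per step, faster than eigenvalues with real part at most
   [beta] allow. *)
Lemma cone_growth hs a k0 : (forall h, h \in hs -> complex.Re h <= beta) ->
  kill hs a = 0 -> up k0 -> (forall k, nm (comb a k) <= nm (comb a k0)) -> a = 0.
Proof.
move=> hbeta kh upk0 k0max.
have [C C0 CP] := comb_inj.
suff B0 : nm (comb a k0) <= 0.
  apply/rowP => i; rewrite mxE; apply: nm_eq0; rewrite -(mulr0 C).
  by apply: CP => k; exact: le_trans (k0max k) B0.
rewrite leNgt; apply/negP => B0.
have [kY kYP] := tends0_max Y_ge0 Y_tends0.
pose Msum := \sum_i \sum_j nm (A i j).
have Msum0 : 0 <= Msum by apply: sumr_ge0 => i _; apply: sumr_ge0 => j _; exact: nm_ge0.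
pose C1 := C * Msum * Y kY.
have C10 : 0 <= C1 by rewrite !mulr_ge0.
have AC1 b B k : (forall k, nm (comb b k) <= B) -> nm (comb (b *m A) k) <= C1 * B.
  move=> bB; have bC := CP _ _ bB.
  have B'0 : 0 <= B by apply: le_trans (nm_ge0 _) (bB 0).
  have : forall i, nm ((b *m A) 0 i) <= C * B * Msum.
    move=> i; rewrite mxE; apply: le_trans (nm_sum _ _ _) _.
    apply: (@le_trans _ _ (\sum_j C * B * nm (A j i))).
      by apply: ler_sum => j _; rewrite nmM ler_wpM2r ?nm_ge0.
    rewrite -mulr_sumr ler_wpM2l ?mulr_ge0 //; apply: ler_sum => j _.
    by rewrite (bigD1 i) //= lerDl sumr_ge0 // => l _; exact: nm_ge0.
  move=> /(comb_sum_le k) /le_trans; apply.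
  apply: (@le_trans _ _ (C * B * Msum * Y kY)).
    by rewrite ler_wpM2l ?kYP // !mulr_ge0.
  by rewrite /C1; lra.
(* As c_k may be unbounded, no step size need make 1 + tau c_k nonnegative for all k. Beyond [K]
   every combination is at most half its maximum, which leaves room for a short step without any use
   of c_k. *)
have [|K KP] := @Y_tends0 (2 * (C + 1))^-1.
  by rewrite invr_gt0; lra.
have tail b B k : (forall k, nm (comb b k) <= B) -> (K <= `|k|)%N -> nm (comb b k) <= B / 2.
  move=> bB Kk; have B'0 : 0 <= B by apply: le_trans (nm_ge0 _) (bB 0).
  apply: le_trans (comb_sum_le k (CP _ _ bB)) _.
  apply: (@le_trans _ _ (C * B * (2 * (C + 1))^-1)).
    by rewrite ler_wpM2l ?mulr_ge0 // KP.
  rewrite ler_pdivrMr; last lra.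
  lra.
pose c1 := isum K (fun k => `|c k|).
have c10 : 0 <= c1 by exact: isum_ge0.
pose h2 := \sum_(h <- hs) nm h ^+ 2.
have h20 : 0 <= h2 by apply: sumr_ge0 => h _; exact: sqr_ge0.
(* Makes the second-order term tau^2 |h|^2 at most tau d / 2. *)
pose h3 := h2 / d.
have h30 : 0 <= h3 by rewrite divr_ge0 // ltW.
pose bt : R := `|beta|.
have bt0 : 0 <= bt by exact: normr_ge0.
have btN : - bt <= beta by exact: lerNnormlW.
pose S := 1 + c1 + C1 + bt + d + h3.
have d0 := d_gt0.
have S0 : 0 < S by rewrite /S; lra.
pose tau := (2 * S)^-1.
have tau0 : 0 < tau by rewrite invr_gt0; lra.
have tauS x : 0 <= x <= S -> tau * x <= 1 / 2.
  move=> /andP[x0 xS]; rewrite /tau mulrC ler_pdivrMr; lra.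
have tc1 : tau * c1 <= 1 / 2 by apply: tauS; rewrite /S; lra.
have tC1 : tau * (C1 + bt) <= 1 / 2 by apply: tauS; rewrite /S; lra.
have th3 : tau * h3 <= 1 / 2 by apply: tauS; rewrite /S; lra.
have tb : tau * bt <= 1 / 2 by apply: tauS; rewrite /S; lra.
have tb' : - (1 / 2) <= tau * beta.
  have : - (tau * bt) <= tau * beta.
    by rewrite -mulrN ler_wpM2l // ltW.
  lra.
pose T b := b + tau%:C%C *: (b *m A).
have combT b k : comb (T b) k = comb b k + tau%:C%C * comb (b *m A) k.
  by rewrite /T combD combZ.
have step b k1 : up k1 -> (forall k, nm (comb b k) <= nm (comb b k1)) ->
    0 < nm (comb b k1) -> exists k2, [/\ up k2,
      forall k, nm (comb (T b) k) <= nm (comb (T b) k2)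
      & (1 + tau * (beta + d)) * nm (comb b k1) <= nm (comb (T b) k2)].
  move=> upk1; set B := nm (comb b k1) => bB B'0.
  have TbE k : comb (T b) k = (1 + tau * c k)%:C%C * comb b k +
      tau%:C%C * (comb (b *m A) k - (c k)%:C%C * comb b k).
    by rewrite combT rmorphD rmorphM rmorph1 /=; ring.
  have nmt (x : R[i]) : nm (tau%:C%C * x) = tau * nm x.
    by rewrite nmM nm_real ger0_norm // ltW.
  have k1ge : (1 + tau * (beta + d)) * B <= nm (comb (T b) k1).
    rewrite TbE; apply: le_trans _ (nmD_ge _ _); rewrite nmt nmM nm_real.
    have h1 : (1 + tau * c k1) * B <= `|1 + tau * c k1| * nm (comb b k1).
      by rewrite -/B ler_wpM2r ?(ltW B'0) // ler_norm.
    have h4 : tau * nm (comb (b *m A) k1 - (c k1)%:C%C * comb b k1) <= tau * (r k1 * B).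
      by rewrite ler_wpM2l ?(ltW tau0) // row_bound.
    have h5 : tau * B * (beta + d) <= tau * B * (c k1 - r k1).
      by rewrite ler_wpM2l ?up_ge // mulr_ge0 // ltW.
    lra.
  have nup k : ~~ up k -> nm (comb (T b) k) <= (1 + tau * beta) * B.
    move=> nupk; have [Kk|kK] := leqP K `|k|.
      rewrite combT; apply: le_trans (nmD _ _) _; rewrite nmt.
      have h1 := tail b B k bB Kk.
      have h4 : tau * nm (comb (b *m A) k) <= tau * (C1 * B).
        by rewrite ler_wpM2l ?(ltW tau0) // AC1.
      have h5 : tau * (C1 + bt) * B <= 1 / 2 * B by rewrite ler_wpM2r // ltW.
      have h6 : - (tau * bt) * B <= tau * beta * B.
        by rewrite ler_wpM2r ?(ltW B'0) // -mulrN ler_wpM2l // ltW.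
      lra.
    rewrite TbE; apply: le_trans (nmD _ _) _; rewrite nmt nmM nm_real.
    have ck : - (1 / 2) <= tau * c k.
      have : `|c k| <= c1 by apply: isum_ge_term => //; exact: ltnW.
      move=> ckc; have : tau * `|c k| <= tau * c1 by rewrite ler_wpM2l // ltW.
      have : - (tau * `|c k|) <= tau * c k.
        by rewrite -mulrN ler_wpM2l ?(ltW tau0) // lerNnormlW.
      lra.
    rewrite ger0_norm; last lra.
    have h1 : (1 + tau * c k) * nm (comb b k) <= (1 + tau * c k) * B.
      by rewrite ler_wpM2l ?bB //; lra.
    have h4 : tau * nm (comb (b *m A) k - (c k)%:C%C * comb b k) <= tau * (r k * B).
      by rewrite ler_wpM2l ?(ltW tau0) // row_bound.
    have h5 : tau * B * (c k + r k) <= tau * B * beta.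
      by rewrite ler_wpM2l ?nup_le // mulr_ge0 // ltW.
    lra.
  have [k2 k2P] := comb_max (T b).
  exists k2; split=> //; last exact: le_trans k1ge (k2P k1).
  rewrite -[up k2]negbK; apply/negP => /nup h.
  have := le_trans (le_trans k1ge (k2P k1)) h.
  have : 0 < tau * d * B by rewrite !mulr_gt0.
  lra.
have x0 : 0 < 1 + tau * (beta + d).
  have : 0 < tau * d by rewrite mulr_gt0.
  lra.
have grow n : exists k1, [/\ up k1,
    forall k, nm (comb (iter n T a) k) <= nm (comb (iter n T a) k1)
    & (1 + tau * (beta + d)) ^+ n * nm (comb a k0) <= nm (comb (iter n T a) k1)].
  elim: n => [|n [k1 [up1 max1 ge1]]]; first by exists k0; rewrite expr0 mul1r.
  have p1 : 0 < nm (comb (iter n T a) k1).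
    by apply: lt_le_trans ge1; rewrite mulr_gt0 // exprn_gt0.
  have [k2 [up2 max2 ge2]] := step _ _ up1 max1 p1.
  exists k2; split=> //; apply: le_trans ge2.
  by rewrite exprS -mulrA ler_wpM2l // ltW.
have td : 0 < tau * d by rewrite mulr_gt0.
(* Of the margin [d], one quarter pays for the second-order error of the Euler step and one for the
   room that [kill_growth] needs; growth in the cone has all of it. *)
pose rho' := 1 + tau * (beta + d / 4); pose rho := 1 + tau * (beta + d / 2).
have [| | |Mb MbP] := @kill_growth tau rho' rho hs a (ltW tau0) _ _ _ kh.
- by rewrite /rho'; lra.
- by rewrite /rho' /rho; lra.
- move=> h hin; have rho'0 : 0 <= rho' by rewrite /rho'; lra.
  rewrite -(@ler_pXn2r _ 2) ?nnegrE ?nm_ge0 // nm_sqr.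
  have hh2 : nm h ^+ 2 <= h2.
    rewrite /h2 (big_rem h) //= lerDl; apply: sumr_ge0 => h' _; exact: sqr_ge0.
  have hb := hbeta h hin.
  have -> : complex.Re (1 + tau%:C%C * h) = 1 + tau * complex.Re h.
    by case: h {hin hh2 hb} => u v; rewrite /= mul0r subr0.
  have -> : complex.Im (1 + tau%:C%C * h) = tau * complex.Im h.
    by case: h {hin hh2 hb} => u v; rewrite /= mul0r addr0 add0r.
  have e1 : tau ^+ 2 * nm h ^+ 2 <= tau * d / 2.
    apply: (@le_trans _ _ (tau ^+ 2 * h2)); first by rewrite ler_wpM2l // sqr_ge0.
    have : tau * d * (tau * h3) <= tau * d * (1 / 2) by rewrite ler_wpM2l // ltW.
    have -> : tau * d * (tau * h3) = tau ^+ 2 * h2.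
      by rewrite /h3; field; rewrite gt_eqF.
    lra.
  rewrite nm_sqr in e1.
  have e2 : tau * complex.Re h <= tau * beta by rewrite ler_wpM2l // ltW.
  have : 0 <= (tau * (beta + d / 4)) ^+ 2 by exact: sqr_ge0.
  rewrite /rho'; lra.
have rho0 : 0 < rho by rewrite /rho; lra.
pose x := (1 + tau * (beta + d)) / rho.
have x1 : 1 < x by rewrite ltr_pdivlMr // mul1r /rho; lra.
have [n nP] := expr_unbounded (Mb / nm (comb a k0)) x1.
have [k1 [_ _ ge1]] := grow n.
have := le_trans ge1 (MbP n k1).
rewrite -ler_pdivrMr ?exprn_gt0 // mulrAC -expr_div_n -/x.
by move: nP; rewrite ltr_pdivrMr // => /lt_le_trans /[apply]; rewrite ltxx.
Qed.

End Cone.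

(** * Finite sections *)

Section LinearAlgebra.
Variable R : realType.
Notation C := R[i].

Lemma kill_mul_prod n (A : 'M[C]_n.+1) (s : seq C) (a : 'rV[C]_n.+1) :
  kill A s a = a *m horner_mx A (\prod_(z <- s) ('X - z%:P)).
Proof.
elim: s a => [|z s IH] a; first by rewrite big_nil rmorph1 mulmx1.
rewrite big_cons rmorphM /= rmorphB /= horner_mx_X horner_mx_C -mulmxE mulmxA.
by rewrite -IH.
Qed.

Lemma kill_opp n (A : 'M[C]_n) (s : seq C) (a : 'rV[C]_n) :
  kill A s a = 0 -> kill (- A) (map -%R s) a = 0.
Proof.
suff h (e : C) b : kill (- A) (map -%R s) (e *: b) = ((-1) ^+ size s * e) *: kill A s b.
  by move=> k0; rewrite -[a]scale1r h k0 scaler0.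
elim: s e b => [|z s IH] e b /=; first by rewrite expr0 mul1r.
rewrite -[_ *m (A - _)]scale1r -/(kill A s _) -/(kill (- A) _ _).
have -> : (e *: b) *m (- A - (- z)%:M) = - e *: (1 *: (b *m (A - z%:M))).
  rewrite scale1r scaleNr -scalemxAl -scalerN -mulmxN; congr (_ *: (_ *m _)).
  by rewrite opprB [in RHS]addrC; congr (_ + _); apply/matrixP => i j; rewrite !mxE mulNrn opprK.
by rewrite scale1r IH exprS; congr (_ *: _); ring.
Qed.

Lemma char_poly_split n (A : 'M[C]_n.+1) :
  exists rs : seq C, char_poly A = \prod_(z <- rs) ('X - z%:P).
Proof.
have [rs rsE] := closed_field_poly_normal (char_poly A).
by exists rs; rewrite rsE (monicP (char_poly_monic A)) scale1r.
Qed.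

Lemma coprimep_prod_XsubC (s t : seq C) : (forall z, z \in t -> z \notin s) ->
  coprimep (\prod_(z <- s) ('X - z%:P)) (\prod_(z <- t) ('X - z%:P)).
Proof.
elim: t => [|z t IH] h; first by rewrite big_nil coprimep1.
rewrite big_cons coprimepMr coprimep_XsubC root_prod_XsubC h ?mem_head //=.
by apply: IH => w wt; apply: h; rewrite inE wt orbT.
Qed.

(** Restriction to the coordinates in [G] is injective on the row space of [K]. *)
Lemma rank_le_support n (K : 'M[C]_n) (G : {set 'I_n}) :
  (forall a : 'rV_n, (a <= K)%MS -> (forall i, i \in G -> a 0 i = 0) -> a = 0) ->
  (\rank K <= #|G|)%N.
Proof.
move=> h; pose S : 'M[C]_(n, #|G|) := \matrix_(i, j) (i == enum_val j)%:R.
rewrite -(mxrank_mul_ker K S) [X in (_ + X)%N](_ : _ = 0%N) ?addn0 ?rank_leq_col //.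
apply/eqP; rewrite mxrank_eq0; apply/rowV0P => a; rewrite sub_capmx => /andP[aK].
move=> /sub_kermxP aS; apply: h => // i iG.
have := congr1 (fun M : 'rV_ _ => M 0 (enum_rank_in iG i)) aS.
rewrite !mxE (bigD1 i) //= big1 => [|j ji].
  by rewrite !mxE enum_rankK_in // eqxx mulr1 addr0.
by rewrite !mxE enum_rankK_in // (negbTE ji) mulr0.
Qed.

End LinearAlgebra.

Section ConeOpp.
Variables (R : realType) (m : nat) (y : 'I_m -> int -> R[i]) (A : 'M[R[i]]_m).
Variables (c r : int -> R).
Hypothesis y_tends0 : forall i, tends0 (fun k => nm (y i k)).
Hypothesis comb_inj : exists2 C : R, 0 <= C &
  forall a B, (forall k, nm (comb y a k) <= B) -> forall i, nm (a 0 i) <= C * B.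
Hypothesis row_bound : forall a B k, (forall k, nm (comb y a k) <= B) ->
  nm (comb y (a *m A) k - (c k)%:C%C * comb y a k) <= r k * B.

(** Time reversal: [cone_growth] for -A, -c and the opposite eigenvalues. *)
Lemma cone_growth_opp (low : int -> bool) (beta d : R) hs a k0 : 0 < d ->
  (forall k, low k -> c k + r k <= beta - d) ->
  (forall k, ~~ low k -> beta <= c k - r k) ->
  (forall h, h \in hs -> beta <= complex.Re h) ->
  kill A hs a = 0 -> low k0 -> (forall k, nm (comb y a k) <= nm (comb y a k0)) -> a = 0.
Proof.
move=> d0 lo nlo hb kh l0 mx.
apply: (@cone_growth R m y (- A) (fun k => - c k) r low (- beta) d y_tends0 comb_inj
  _ d0 _ _ (map -%R hs) a k0 _ (kill_opp kh) l0 mx).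
- move=> b B k bB; rewrite rmorphN mulNr mulmxN -scaleN1r combZ mulN1r -opprD nmN.
  exact: row_bound.
- by move=> k /lo; lra.
- by move=> k /nlo; lra.
- move=> _ /mapP[h /hb hh ->].
  by case: h hh => u v /=; lra.
Qed.

(** Gershgorin's argument at a coordinate of maximal modulus. *)
Lemma comb_eigen (z : R[i]) a : a != 0 -> a *m A = z *: a ->
  exists k0, comb y a k0 != 0 /\ `|complex.Re z - c k0| <= r k0.
Proof.
move=> a0 az.
have [C C0 CP] := comb_inj.
have [k0 k0P] : exists k0, forall k, nm (comb y a k) <= nm (comb y a k0).
  apply: tends0_max => [k|]; first exact: nm_ge0.
  exact: comb_tends0.
have B0 : 0 < nm (comb y a k0).
  rewrite ltNge; apply/negP => B0; case/eqP: a0; apply/rowP => i; rewrite mxE.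
  by apply: nm_eq0; rewrite -(mulr0 C); apply: CP => k; exact: le_trans (k0P k) B0.
exists k0; split; first by apply: contraTneq B0 => ->; rewrite nm0 ltxx.
have := row_bound k0 k0P; rewrite az combZ -mulrBl nmM ler_pM2r //.
apply: le_trans; apply: le_trans (normr_Re _).
by case: z {az} => u v /=.
Qed.

End ConeOpp.

Section FiniteSection.
Variables (R : realType) (n : nat) (sig : 'I_n.+1 -> int).
Variables (c kap : int -> R) (q : int -> R[i]) (Q a0 b0 d : R).
Notation C := R[i].

Definition conv (N : nat) (v : int -> C) (k : int) : C :=
  isum N (fun j => q j * v (k - j)).

Let r k := `|kap k| * Q.
Let mid k := [exists m, sig m == k].

Hypothesis sig_inj : injective sig.
Hypothesis qQ : forall N, isum N (fun j => nm (q j)) <= Q.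
Hypothesis d_gt0 : 0 < d.
Hypothesis mid_bound : forall m, a0 <= c (sig m) - r (sig m) /\ c (sig m) + r (sig m) <= b0.
Hypothesis out_bound : forall k, (forall m, sig m != k) ->
  b0 + d <= c k - r k \/ c k + r k <= a0 - d.

Let Q_ge0 : 0 <= Q.
Proof. by apply: le_trans (qQ 0); apply: isum_ge0 => j; exact: nm_ge0. Qed.

Let r_ge0 k : 0 <= r k. Proof. by rewrite mulr_ge0. Qed.

Let a0b0 : a0 <= b0.
Proof. by have := mid_bound ord0; have := r_ge0 (sig ord0); lra. Qed.

Lemma nm_conv_le N v k B : (forall k, nm (v k) <= B) -> nm (conv N v k) <= Q * B.
Proof.
move=> vB; apply: le_trans (nm_isum _ _) _.
apply: (@le_trans _ _ (isum N (fun j => nm (q j)) * B)).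
  by rewrite -isumZr; apply: le_isum => j; rewrite nmM ler_wpM2l ?nm_ge0.
by rewrite ler_wpM2r ?qQ // (le_trans _ (vB 0)) ?nm_ge0.
Qed.

Lemma conv_sum (I : finType) N (z : I -> C) (v : I -> int -> C) k :
  conv N (fun k => \sum_i z i * v i k) k = \sum_i z i * conv N (v i) k.
Proof.
rewrite /conv; under eq_isum do rewrite mulr_sumr.
rewrite isum_exchange; apply: eq_bigr => i _.
by rewrite -isumZ; apply: eq_isum => j; rewrite mulrCA.
Qed.

Section Size.
Variable N : nat.
Hypothesis sigN : forall m, (`|sig m| <= N)%N.

Let D := N.*2.+1.
Let pos (i : 'I_D) : int := i%:Z - N%:Z.
Let y (i : 'I_D) (k : int) : C := (k == pos i)%:R.
(** The transpose of the section, as it acts on row vectors of coefficients. *)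
Let A : 'M[C]_D := \matrix_(j, i)
  ((c (pos i))%:C%C * y j (pos i) + (kap (pos i))%:C%C * conv N (y j) (pos i)).

Let pos_inj : injective pos.
Proof. by move=> i j; rewrite /pos => h; apply/val_inj => /=; lia. Qed.

Let posN i : (`|pos i| <= N)%N.
Proof. by have := ltn_ord i; rewrite /pos /D; lia. Qed.

Let posP k : (`|k| <= N)%N -> exists i, pos i = k.
Proof.
move=> kN; have h : (`|(k + N%:Z)%R| < D)%N by rewrite /D; lia.
by exists (Ordinal h); rewrite /pos /=; lia.
Qed.

Let comb_pos (a : 'rV[C]_D) i : comb y a (pos i) = a 0 i.
Proof.
rewrite /comb (bigD1 i) //= big1 => [|j ji].
  by rewrite /y eqxx mulr1 addr0.
by rewrite /y (inj_eq pos_inj) eq_sym (negbTE ji) mulr0.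
Qed.

Let comb_out (a : 'rV[C]_D) k : (N < `|k|)%N -> comb y a k = 0.
Proof.
move=> kN; rewrite /comb big1 // => i _; rewrite /y.
by case: eqP => [kE|_]; [have := posN i; rewrite -kE; lia|rewrite mulr0].
Qed.

Let combA (a : 'rV[C]_D) k : (`|k| <= N)%N ->
  comb y (a *m A) k = (c k)%:C%C * comb y a k + (kap k)%:C%C * conv N (comb y a) k.
Proof.
move=> /posP[i <-]; rewrite comb_pos mxE.
rewrite (_ : conv N (comb y a) (pos i) = \sum_j a 0 j * conv N (y j) (pos i)); last first.
  exact: conv_sum.
rewrite /comb !mulr_sumr -big_split; apply: eq_bigr => j _.
by rewrite mxE /=; ring.
Qed.

Let yt i : tends0 (fun k => nm (y i k)).
Proof.
move=> e e0; exists N.+1 => k kN; rewrite /y.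
by case: eqP => [kE|_]; [have := posN i; rewrite -kE; lia|rewrite nm0 ltW].
Qed.

Let yinj : exists2 K : R, 0 <= K &
  forall a B, (forall k, nm (comb y a k) <= B) -> forall i, nm (a 0 i) <= K * B.
Proof. by exists 1 => // a B aB i; rewrite mul1r -comb_pos. Qed.

Let yrow a B k : (forall k, nm (comb y a k) <= B) ->
  nm (comb y (a *m A) k - (c k)%:C%C * comb y a k) <= r k * B.
Proof.
move=> aB; have B0 : 0 <= B by apply: le_trans (aB 0); exact: nm_ge0.
have [kN|kN] := leqP `|k| N; last first.
  by rewrite !comb_out // mulr0 subr0 nm0 mulr_ge0.
rewrite combA // addrAC subrr add0r nmM nm_real -mulrA ler_wpM2l //.
exact: nm_conv_le.
Qed.

Let up k := b0 + d <= c k - r k.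
Let low k := c k + r k <= a0 - d.

Let midP k : reflect (exists m, sig m = k) (mid k).
Proof. by apply: (iffP existsP) => -[m h]; exists m; exact/eqP. Qed.

Let tri k : [|| mid k, up k | low k].
Proof.
case: (boolP (mid k)) => //= nm'.
have [m|h|h] := out_bound (k := k); last by rewrite /low h orbT.
  by apply: contraNneq nm' => h; apply/midP; exists m.
by rewrite /up h.
Qed.

Let mid_nup k : mid k -> ~~ up k.
Proof.
move=> /midP[m <-]; rewrite /up -ltNge; have := mid_bound m; have := r_ge0 (sig m).
by have := d_gt0; lra.
Qed.

Let mid_nlow k : mid k -> ~~ low k.
Proof.
move=> /midP[m <-]; rewrite /low -ltNge; have := mid_bound m; have := r_ge0 (sig m).
by have := d_gt0; lra.
Qed.

Let up_nlow k : up k -> ~~ low k.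
Proof.
rewrite /up /low -ltNge; have := r_ge0 k; have := a0b0; have := d_gt0; lra.
Qed.

Let nup_le k : ~~ up k -> c k + r k <= b0.
Proof.
move=> nu; have := tri k; rewrite (negbTE nu) /= => /orP[/midP[m <-]|].
  by case: (mid_bound m).
by rewrite /low; have := a0b0; have := d_gt0; lra.
Qed.

Let nlow_ge k : ~~ low k -> a0 <= c k - r k.
Proof.
move=> nl; have := tri k; rewrite (negbTE nl) orbF => /orP[/midP[m <-]|].
  by case: (mid_bound m).
by rewrite /up; have := a0b0; have := d_gt0; lra.
Qed.

Let ker (rs : seq C) (g : pred C) :=
  kermxpoly A (\prod_(z <- [seq z <- rs | g z]) ('X - z%:P)).

Let kerP rs g (a : 'rV[C]_D) : (a <= ker rs g)%MS -> kill A [seq z <- rs | g z] a = 0.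
Proof. by move=> /sub_kermxP; rewrite kill_mul_prod. Qed.

Let maxat (a : 'rV[C]_D) : exists k0, forall k, nm (comb y a k) <= nm (comb y a k0).
Proof.
apply: tends0_max => [k|]; first exact: nm_ge0.
exact: comb_tends0.
Qed.

Let vanish0 (a : 'rV[C]_D) k0 : (forall k, nm (comb y a k) <= nm (comb y a k0)) ->
  comb y a k0 = 0 -> a = 0.
Proof.
move=> h h0; apply/rowP => i; rewrite mxE -comb_pos.
by apply: nm_eq0; rewrite -(@nm0 R) -h0.
Qed.

Let gm (z : C) := a0 <= complex.Re z <= b0.
Let gu (z : C) := b0 < complex.Re z.
Let gl (z : C) := complex.Re z < a0.

(** Unless [a] is 0, its maximum cannot sit on an [up] or a [low] index, by the forward and the
    backward cone; so it sits on the range of [sig]. *)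
Lemma mid_cone rs (a : 'rV[C]_D) B : (a <= ker rs gm)%MS ->
  (forall m, nm (comb y a (sig m)) <= B) -> 0 <= B -> forall k, nm (comb y a k) <= B.
Proof.
move=> /kerP ka aB B0 k.
have [k0 k0P] := maxat a; apply: le_trans (k0P k) _.
have : mid k0 \/ a = 0.
  have := tri k0 => /or3P[|u0|l0]; [by left|right|right].
    apply: (@cone_growth R D y A c r up b0 d yt yinj yrow d_gt0 _ nup_le _ a k0 _ ka u0 k0P) => //.
    by move=> h; rewrite mem_filter => /andP[/andP[]].
  apply: (@cone_growth_opp R D y A c r yt yinj yrow low a0 d _ a k0 d_gt0 _ nlow_ge _ ka l0 k0P) => //.
  by move=> h; rewrite mem_filter => /andP[/andP[]].
case=> [/midP[m <-]//|->].
by rewrite comb0 nm0.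
Qed.

Let gset (g : pred int) : {set 'I_D} := [set i | g (pos i)].

(** A member without coordinates in [up] has its maximum elsewhere, while its eigenvalues have real
    part at least b0 + d: the backward cone makes it zero. *)
Let rank_up rs : (forall z, z \in rs -> gu z -> b0 + d <= complex.Re z) ->
  (\rank (ker rs gu) <= #|gset up|)%N.
Proof.
move=> rsP; apply: rank_le_support => a /kerP ka a_up.
have [k0 k0P] := maxat a; have [h0|/eqP h0] := pselect (comb y a k0 = 0).
  exact: vanish0 h0.
have nup0 : ~~ up k0.
  apply: contra h0 => u0; have [kN|kN] := leqP `|k0| N; last by rewrite comb_out.
  by have [i iE] := posP kN; rewrite -iE comb_pos a_up // inE iE.
apply: (@cone_growth_opp R D y A c r yt yinj yrow (fun k => ~~ up k) (b0 + d) d _ a k0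
  d_gt0 _ _ _ ka nup0 k0P).
- by move=> k /nup_le; lra.
- by move=> k /negPn.
- by move=> h; rewrite mem_filter => /andP[hg hrs]; exact: rsP.
Qed.

Let rank_low rs : (forall z, z \in rs -> gl z -> complex.Re z <= a0 - d) ->
  (\rank (ker rs gl) <= #|gset low|)%N.
Proof.
move=> rsP; apply: rank_le_support => a /kerP ka a_lo.
have [k0 k0P] := maxat a; have [h0|/eqP h0] := pselect (comb y a k0 = 0).
  exact: vanish0 h0.
have nlow0 : ~~ low k0.
  apply: contra h0 => u0; have [kN|kN] := leqP `|k0| N; last by rewrite comb_out.
  by have [i iE] := posP kN; rewrite -iE comb_pos a_lo // inE iE.
apply: (@cone_growth R D y A c r (fun k => ~~ low k) (a0 - d) d yt yinj yrow d_gt0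
  _ _ _ a k0 _ ka nlow0 k0P).
- by move=> k /nlow_ge; lra.
- by move=> k /negPn.
- by move=> h; rewrite mem_filter => /andP[hg hrs]; exact: rsP.
Qed.

(** The three kernels fill the whole space, and those of [gu] and [gl] are no larger than the index
    sets [up] and [low]; what remains is at least the number of indices in [sig]. *)
Let rank_mid rs : char_poly A = \prod_(z <- rs) ('X - z%:P) -> (n < \rank (ker rs gm))%N.
Proof.
move=> rsE.
(* Every eigenvalue has its real part in some interval [c_k - r_k, c_k + r_k], hence never strictly
   inside one of the gaps of width [d]. *)
have spec z : z \in rs -> exists k0, `|complex.Re z - c k0| <= r k0.
  move=> zrs; have : root (char_poly A) z by rewrite rsE root_prod_XsubC.
  rewrite -eigenvalue_root_char => /eigenvalueP[a az a0'].
  by have [k0 [_ ?]] := comb_eigen yt yinj yrow a0' az; exists k0.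
have hu := @rank_up rs; have hl := @rank_low rs.
have {}hu : (\rank (ker rs gu) <= #|gset up|)%N.
  apply: hu => z /spec[k0]; rewrite ler_norml /gu => /andP[h1 h2] h3.
  have : up k0 by apply: contraLR h3 => /nup_le h4; rewrite -leNgt; lra.
  by rewrite /up; lra.
have {}hl : (\rank (ker rs gl) <= #|gset low|)%N.
  apply: hl => z /spec[k0]; rewrite ler_norml /gl => /andP[h1 h2] h3.
  have : low k0 by apply: contraLR h3 => /nlow_ge h4; rewrite -leNgt; lra.
  by rewrite /low; lra.
have full : (D <= \rank (ker rs gm) + (\rank (ker rs gu) + \rank (ker rs gl)))%N.
  pose P g := \prod_(z <- [seq z <- rs | g z]) ('X - z%:P).
  rewrite /ker -/(P gm) -/(P gu) -/(P gl).
  have PE : char_poly A = P gm * (P gu * P gl).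
    rewrite rsE /P !big_filter (bigID gm) /=; congr (_ * _).
    rewrite (bigID gu) /=; congr (_ * _); apply: eq_bigl => z.
      rewrite /gm /gu; have := a0b0.
      by case: (leP a0 (complex.Re z)); case: (leP (complex.Re z) b0) => //=; lra.
    rewrite /gm /gu /gl; have := a0b0.
    by case: (leP a0 (complex.Re z)); case: (leP (complex.Re z) b0) => //=; lra.
  have co1 : coprimep (P gu) (P gl).
    apply: coprimep_prod_XsubC => z; rewrite !mem_filter => /andP[h _].
    rewrite negb_and; apply/orP; left; move: h; rewrite /gu /gl -leNgt.
    by have := a0b0; lra.
  have co2 : coprimep (P gm) (P gu * P gl).
    rewrite coprimepMr; apply/andP; split; apply: coprimep_prod_XsubC => z;
      rewrite !mem_filter negb_and => /andP[h _]; apply/orP; left; move: h;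
      rewrite /gm /gu /gl negb_and -!ltNge => h; apply/orP; [right|left]; lra.
  have : (kermxpoly A (char_poly A) :=: 1)%MS.
    by apply: kermxpoly_min; apply: mxminpoly_dvd_char.
  rewrite PE => h1.
  have h2 := eqmx_trans (eqmx_sym (kermxpolyM A co2)) h1.
  have h3 := kermxpolyM A co1.
  have hD : \rank (kermxpoly A (P gm) + kermxpoly A (P gu * P gl))%MS = D.
    by case: h2 => h2 _; rewrite h2 mxrank1.
  rewrite -[X in (X <= _)%N]hD.
  apply: leq_trans (mxrank_adds_leqif _ _) _; rewrite leq_add2l.
  case: h3 => h3 _; apply: leq_trans (eq_leq h3) _.
  exact: (mxrank_adds_leqif (kermxpoly A (P gu)) _).1.
have cards : (#|gset mid| + (#|gset up| + #|gset low|) <= D)%N.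
  rewrite -[X in (_ <= X)%N]card_ord -(cardsC (gset mid)) leq_add2l.
  have -> : (#|gset up| + #|gset low|)%N = #|gset up :|: gset low|.
    rewrite cardsU (_ : gset up :&: gset low = finset.set0) ?cards0 ?subn0 //.
    apply/setP => i; rewrite !inE; apply/negP => /andP[h1 h2].
    by have := up_nlow h1; rewrite h2.
  apply/subset_leq_card/fintype.subsetP => i; rewrite !inE => /orP[h|h].
    by apply: contraL h => /mid_nup.
  by apply: contraL h => /mid_nlow.
have cm : (n < #|gset mid|)%N.
  have /choice[f fP] : forall m, exists i, pos i = sig m by move=> m; exact: posP.
  have finj : injective f by move=> m m' h; apply: sig_inj; rewrite -!fP h.
  rewrite -[X in (X <= _)%N]card_ord -(card_imset _ finj); apply/subset_leq_card/fintype.subsetP.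
  move=> _ /imsetP[m _ ->]; rewrite inE fP; apply/midP; by exists m.
lia.
Qed.

(** Evaluation on [sig] is injective on the middle space by [mid_cone] and onto by [rank_mid]. [X]
    is the dual basis, [Lam] the restricted operator, and the norm bound is [mid_cone] again. *)
Lemma finite_section : exists (X : 'I_n.+1 -> int -> C) (Lam : 'M[C]_n.+1),
  [/\ forall m m', X m (sig m') = (m == m')%:R,
      forall m k, (N < `|k|)%N -> X m k = 0,
      forall m k, (`|k| <= N)%N ->
        (c k)%:C%C * X m k + (kap k)%:C%C * conv N (X m) k = \sum_m' Lam m m' * X m' k
    & forall (a : 'I_n.+1 -> C) B k, (forall m, nm (a m) <= B) ->
        nm (\sum_m a m * X m k) <= B].
Proof.
have [rs rsE] := char_poly_split A.
have rk := rank_mid rsE; set K := ker rs gm in rk.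
have stK : stablemx K A by exact: comm_mx_stable_kermxpoly.
pose S : 'M[C]_(D, n.+1) := \matrix_(i, m) (pos i == sig m)%:R.
have aS (a : 'rV[C]_D) m : (a *m S) 0 m = comb y a (sig m).
  rewrite mxE; apply: eq_bigr => i _; rewrite mxE /y.
  by rewrite [pos i == _]eq_sym.
have inj (a : 'rV[C]_D) : (a <= K)%MS -> (forall m, comb y a (sig m) = 0) -> a = 0.
  move=> aK a0'; have h := @mid_cone rs a 0 aK _ (lexx _).
  apply: (@vanish0 a 0) => [k|]; last apply: nm_eq0.
    by apply: le_trans (nm_ge0 _); apply: h => m; rewrite a0' nm0.
  by apply: h => m; rewrite a0' nm0.
have full : row_full (K *m S).
  have h : \rank (K *m S) = \rank K.
    rewrite -[RHS](mxrank_mul_ker K S) [X in (_ + X)%N](_ : _ = 0%N) ?addn0 //.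
    apply/eqP; rewrite mxrank_eq0; apply/rowV0P => a; rewrite sub_capmx => /andP[aK].
    by move=> /sub_kermxP h; apply: inj => // m; rewrite -aS h mxE.
  by rewrite /row_full eqn_leq rank_leq_col h.
have /row_fullP[B BK] := full.
pose X := B *m K; have XS : X *m S = 1%:M by rewrite /X -mulmxA.
have rowXK m : (row m X <= K)%MS.
  by apply: submx_trans (row_sub _ _) _; rewrite /X submxMl.
have Xs m m' : comb y (row m X) (sig m') = (m == m')%:R.
  by rewrite -aS -row_mul XS !mxE.
have expand (a : 'rV[C]_D) : (a <= K)%MS -> forall k,
    comb y a k = \sum_m comb y a (sig m) * comb y (row m X) k.
  move=> aK k.
  have -> : a = \sum_m comb y a (sig m) *: row m X.
    apply/eqP; rewrite -subr_eq0; apply/eqP; apply: inj => [|m].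
      rewrite addmx_sub // eqmx_opp summx_sub // => m _.
      exact: scalemx_sub.
    rewrite combB; apply/eqP; rewrite subr_eq0; apply/eqP.
    have -> : comb y (\sum_m' comb y a (sig m') *: row m' X) (sig m) =
        \sum_m' comb y a (sig m') * comb y (row m' X) (sig m).
      elim/big_ind2: _ => [|? ? ? ? <- <-|i _]; rewrite ?comb0 ?combD ?combZ //.
    rewrite (bigD1 m) //= Xs eqxx mulr1 big1 ?addr0 // => m' mm'.
    by rewrite Xs (negbTE mm') mulr0.
  have cs (F : 'I_n.+1 -> C) k' : comb y (\sum_m' F m' *: row m' X) k' =
      \sum_m' F m' * comb y (row m' X) k'.
    by elim/big_ind2: _ => [|? ? ? ? <- <-|i _]; rewrite ?comb0 ?combD ?combZ.
  rewrite cs; apply: eq_bigr => m _; rewrite cs; congr (_ * _).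
  rewrite (bigD1 m) //= Xs eqxx mulr1 big1 ?addr0 // => m' mm'.
  by rewrite Xs (negbTE mm') mulr0.
exists (fun m => comb y (row m X)), (\matrix_(m, m') comb y (row m X *m A) (sig m')).
split=> //.
- by move=> m k kN; rewrite comb_out.
- move=> m k kN; rewrite -combA // expand; last first.
    by apply: submx_trans (submxMr A (rowXK m)) stK.
  by apply: eq_bigr => m' _; rewrite mxE.
- move=> a B' k aB.
  have cs k' : comb y (\sum_m' a m' *: row m' X) k' = \sum_m' a m' * comb y (row m' X) k'.
    by elim/big_ind2: _ => [|? ? ? ? <- <-|i _]; rewrite ?comb0 ?combD ?combZ.
  rewrite -cs; apply: (@mid_cone rs).
  + by apply: summx_sub => m _; exact: scalemx_sub.
  + move=> m; rewrite cs (bigD1 m) //= Xs eqxx mulr1 big1 ?addr0 // => m' mm'.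
    by rewrite Xs (negbTE mm') mulr0.
  + by apply: le_trans (nm_ge0 _) (aB ord0).
Qed.

End Size.
End FiniteSection.

Section UltraLimitC.
Variables (R : realType) (F : set_system nat) (UF : UltraFilter F).
Notation C := R[i].

Definition ulim (f : nat -> C) (l : C) :=
  forall e : R, 0 < e -> F [set n | nm (f n - l) <= e].

Let PF : ProperFilter F. Proof. exact: ultra_proper. Qed.

Lemma ulim_near f g l : (forall e : R, 0 < e -> F [set n | nm (g n - f n) <= e]) ->
  ulim f l -> ulim g l.
Proof.
move=> fg fl e e0; have e20 : 0 < e / 2 by lra.
apply: filterS (filterI (fg _ e20) (fl _ e20)) => n [/= h1 h2].
by have := nmD (g n - f n) (f n - l); rewrite addrA subrK; lra.
Qed.

Lemma ulim_cst l : ulim (fun=> l) l.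
Proof. by move=> e e0; apply: filterS filterT => n _ /=; rewrite subrr nm0 ltW. Qed.

Lemma ulimD f g l l' : ulim f l -> ulim g l' -> ulim (fun n => f n + g n) (l + l').
Proof.
move=> fl gl e e0; have e20 : 0 < e / 2 by lra.
apply: filterS (filterI (fl _ e20) (gl _ e20)) => n [/= h1 h2].
by rewrite opprD addrACA; have := nmD (f n - l) (g n - l'); lra.
Qed.

Lemma ulimZ z f l : ulim f l -> ulim (fun n => z * f n) (z * l).
Proof.
move=> fl e e0; have z0 := nm_ge0 z.
have ez : 0 < e / (nm z + 1) by rewrite divr_gt0 // ltr_wpDl.
apply: filterS (fl _ ez) => n /= h; rewrite -mulrBr nmM.
apply: (@le_trans _ _ (nm z * (e / (nm z + 1)))); first by rewrite ler_wpM2l.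
by rewrite mulrA ler_pdivrMr; lra.
Qed.

Lemma ulim_bounded f l B : (forall n, nm (f n) <= B) -> ulim f l -> nm l <= B.
Proof.
move=> fB fl; apply/ler_addgt0Pr => e e0.
have [n /= h] := filter_ex (fl _ e0).
by have := nmB_ge l (f n); rewrite nmBC; have := fB n; lra.
Qed.

Lemma ulim_uniq f l l' : ulim f l -> ulim f l' -> l = l'.
Proof.
move=> fl fl'; apply/eqP; rewrite -subr_eq0; apply/eqP; apply: nm_eq0.
apply/ler_addgt0Pr => e e0; rewrite add0r; have e20 : 0 < e / 2 by lra.
have [n [/= h1 h2]] := filter_ex (filterI (fl _ e20) (fl' _ e20)).
rewrite nmBC in h1; have := nmD (l - f n) (f n - l'); rewrite addrA subrK; lra.
Qed.

Lemma ulimM f g l l' B : (forall n, nm (g n) <= B) ->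
  ulim f l -> ulim g l' -> ulim (fun n => f n * g n) (l * l').
Proof.
move=> gB fl gl; have B0 : 0 <= B by apply: le_trans (gB 0%N); exact: nm_ge0.
apply: (@ulim_near (fun n => l * g n)); last exact: ulimZ.
move=> e e0; have eB : 0 < e / (B + 1) by rewrite divr_gt0 // ltr_wpDl.
apply: filterS (fl _ eB) => n /= h; rewrite -mulrBl nmM.
apply: (@le_trans _ _ (e / (B + 1) * B)); first by apply: ler_pM; rewrite ?nm_ge0.
by rewrite mulrAC ler_pdivrMr; lra.
Qed.

Lemma ulim_sum (I : Type) (s : seq I) (f : I -> nat -> C) (l : I -> C) :
  (forall i, ulim (f i) (l i)) -> ulim (fun n => \sum_(i <- s) f i n) (\sum_(i <- s) l i).
Proof.
move=> fl; elim: s => [|i s IH].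
  rewrite big_nil (_ : (fun _ => _) = fun=> 0) => [|]; first exact: ulim_cst.
  by apply/funext => n; rewrite big_nil.
rewrite big_cons (_ : (fun _ => _) = fun n => f i n + \sum_(j <- s) f j n) => [|].
  exact: ulimD.
by apply/funext => n; rewrite big_cons.
Qed.

Lemma ultra_bounded_ulim f B : (forall n, nm (f n) <= B) -> exists l, ulim f l.
Proof.
move=> fB.
have [u hu] := @ultra_bounded_cvg R F UF (fun n => complex.Re (f n)) B
  (fun n => le_trans (normr_Re _) (fB n)).
have [v hv] := @ultra_bounded_cvg R F UF (fun n => complex.Im (f n)) B
  (fun n => le_trans (normr_Im _) (fB n)).
exists (Complex u v) => e e0; have e20 : 0 < e / 2 by lra.
have hu' : F [set n | `|u - complex.Re (f n)| < e / 2] by move/cvgrPdist_lt : hu; apply.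
have hv' : F [set n | `|v - complex.Im (f n)| < e / 2] by move/cvgrPdist_lt : hv; apply.
apply: filterS (filterI hu' hv') => n [/= h1 h2]; rewrite nmBC.
apply: le_trans (nm_Re_Im _) _; case: (f n) h1 h2 => a b /=; lra.
Qed.

End UltraLimitC.

(** * Rows of a graph over the coordinates of the component *)

Section RowDecay.
Variables (R : realType) (n : nat) (sig : 'I_n.+1 -> int).
Variables (c kap : int -> R) (Q a0 b0 d : R).
Notation C := R[i].
Let r k := `|kap k| * Q.
(** [T] is the truncated convolution in [section_decay] and the full one in [lam_strip]. *)
Variables (T : (int -> C) -> int -> C) (X : 'I_n.+1 -> int -> C) (Lam : 'M[C]_n.+1).

Hypotheses (Q_ge0 : 0 <= Q) (d_gt0 : 0 < d).
Hypothesis mid_bound : forall m, a0 <= c (sig m) - r (sig m) /\ c (sig m) + r (sig m) <= b0.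
Hypothesis out_bound : forall k, (forall m, sig m != k) ->
  b0 + d <= c k - r k \/ c k + r k <= a0 - d.
Hypothesis Xsig : forall m m', X m (sig m') = (m == m')%:R.
Hypothesis Xbound : forall (a : 'I_n.+1 -> C) B k, (forall m, nm (a m) <= B) ->
  nm (\sum_m a m * X m k) <= B.
Hypothesis Tsum : forall (a : 'I_n.+1 -> C) k,
  T (fun k => \sum_m a m * X m k) k = \sum_m a m * T (X m) k.
Hypothesis Tbound : forall v B k, (forall k, nm (v k) <= B) -> nm (T v k) <= Q * B.

Lemma span_row k : (forall m, (c k)%:C%C * X m k + (kap k)%:C%C * T (X m) k =
    \sum_m' Lam m m' * X m' k) ->
  forall a : 'rV[C]_n.+1, \sum_m (a *m Lam) 0 m * X m k =
    (c k)%:C%C * (\sum_m a 0 m * X m k)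
    + (kap k)%:C%C * T (fun k => \sum_m a 0 m * X m k) k.
Proof.
move=> h a; rewrite Tsum.
transitivity (\sum_m' a 0 m' * \sum_m Lam m' m * X m k).
  under eq_bigr => m _ do rewrite mxE mulr_suml.
  rewrite exchange_big; apply: eq_bigr => m' _ /=; rewrite mulr_sumr.
  by apply: eq_bigr => m _; rewrite mulrA.
rewrite !mulr_sumr -big_split; apply: eq_bigr => m _ /=.
by rewrite -h; ring.
Qed.

Lemma span_sig (a : 'I_n.+1 -> C) m : \sum_m' a m' * X m' (sig m) = a m.
Proof.
rewrite (bigD1 m) //= Xsig eqxx mulr1 big1 ?addr0 // => m' mm'.
by rewrite Xsig (negbTE mm') mulr0.
Qed.

Hypothesis Xrow_sig : forall m m', (c (sig m'))%:C%C * X m (sig m') +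
  (kap (sig m'))%:C%C * T (X m) (sig m') = \sum_m'' Lam m m'' * X m'' (sig m').

(** The coordinates on [sig] are the entries of [a], and by [Xbound] no other coordinate is larger
    than [B], so [Tbound] applies to the whole sequence. *)
Lemma lam_gershgorin (a : 'rV[C]_n.+1) m B : (forall m, nm (a 0 m) <= B) ->
  nm ((a *m Lam) 0 m - (c (sig m))%:C%C * a 0 m) <= r (sig m) * B.
Proof.
move=> aB; have := span_row (Xrow_sig ^~ m) a.
rewrite (span_sig (fun m => (a *m Lam) 0 m)) (span_sig (fun m => a 0 m)) => ->.
rewrite addrAC subrr add0r nmM nm_real -mulrA ler_wpM2l //.
by apply: Tbound => k; apply: Xbound.
Qed.

Lemma vec_max (a : 'rV[C]_n.+1) : exists m0, forall m, nm (a 0 m) <= nm (a 0 m0).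
Proof.
have [m0 _ h] := @arg_maxP _ R 'I_n.+1 ord0 xpredT (fun m => nm (a 0 m)) isT.
by exists m0 => m; exact: h.
Qed.

Lemma lam_eigen (z : C) (a : 'rV[C]_n.+1) : a != 0 -> a *m Lam = z *: a ->
  exists m, nm (z - (c (sig m))%:C%C) <= r (sig m).
Proof.
move=> a0' az; have [m hm] := vec_max a; exists m.
have B0 : 0 < nm (a 0 m).
  rewrite ltNge; apply/negP => B0; case/eqP: a0'; apply/rowP => i; rewrite mxE.
  by apply: nm_eq0; exact: le_trans (hm i) B0.
by have := lam_gershgorin m hm; rewrite az mxE -mulrBl nmM ler_pM2r.
Qed.

Lemma phase (x : C) : exists2 b : C, nm b <= 1 & b * x = (nm x)%:C%C.
Proof.
have [->|x0] := eqVneq x 0; first by exists 0; rewrite ?nm0 ?mulr0.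
have nx : nm x != 0 by apply: contra_neq x0 => h; apply: nm_eq0; rewrite h.
exists ((nm x)%:C%C / x); last by rewrite divfK.
by rewrite nmM Normc.normcV nm_real ger0_norm ?nm_ge0 // divff.
Qed.

Let g k : R := \sum_m nm (X m k).

(** Row k reads a (Lam - c_k) X_k = kappa_k T(a X)_k, and Lam - c_k expands by r_k + d in the
    maximum norm. Its inverse is applied to a vector of phases that turns the left side into the sum
    of moduli [g k]. *)
Lemma row_ineq k N (p : int -> R) : (forall m, sig m != k) ->
  (forall m, (c k)%:C%C * X m k + (kap k)%:C%C * T (X m) k = \sum_m' Lam m m' * X m' k) ->
  (forall v, nm (T v k) <= isum N (fun j => p j * nm (v (k - j)))) ->
  (forall j, 0 <= p j) ->
  (r k + d) * g k <= `|kap k| * isum N (fun j => p j * g (k - j)).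
Proof.
move=> knS hk Tk p0.
have d0 := d_gt0.
have rk0 : 0 <= r k by rewrite mulr_ge0.
have dist0 : 0 < r k + d by lra.
have expand (a : 'rV[C]_n.+1) m0 : (forall m, nm (a 0 m) <= nm (a 0 m0)) ->
    (r k + d) * nm (a 0 m0) <= nm ((a *m (Lam - (c k)%:C%C%:M)) 0 m0).
  move=> hm; have h1 := lam_gershgorin m0 hm.
  have -> : (a *m (Lam - (c k)%:C%C%:M)) 0 m0 =
      (c (sig m0) - c k)%:C%C * a 0 m0 + ((a *m Lam) 0 m0 - (c (sig m0))%:C%C * a 0 m0).
    by rewrite mulmxBr mul_mx_scalar !mxE rmorphB /=; ring.
  apply: le_trans _ (nmD_ge _ _); rewrite nmM nm_real.
  have [h2 h3] := mid_bound m0.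
  have h4 : (r k + d + r (sig m0)) * nm (a 0 m0) <= `|c (sig m0) - c k| * nm (a 0 m0).
    apply: ler_wpM2r; first exact: nm_ge0.
    by case: (out_bound knS) => h5; rewrite ler_normr; apply/orP; [right|left]; lra.
  lra.
have unit : Lam - (c k)%:C%C%:M \in unitmx.
  rewrite -row_free_unit -kermx_eq0; apply/rowV0P => a /sub_kermxP ha.
  have [m0 hm] := vec_max a; have := expand a m0 hm; rewrite ha mxE nm0 => h.
  apply/rowP => m; rewrite mxE; apply: nm_eq0; apply: le_trans (hm m) _.
  by rewrite -(pmulr_rle0 _ dist0).
have /choice[bb bbP] : forall m, exists b : C, nm b <= 1 /\ b * X m k = (nm (X m k))%:C%C.
  by move=> m; have [b ? ?] := phase (X m k); exists b.
pose bv : 'rV[C]_n.+1 := \row_m bb m.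
pose a := bv *m invmx (Lam - (c k)%:C%C%:M).
have aE : a *m (Lam - (c k)%:C%C%:M) = bv by rewrite mulmxKV.
have [m0 hm] := vec_max a.
have a1 : (r k + d) * nm (a 0 m0) <= 1.
  by apply: le_trans (expand a m0 hm) _; rewrite aE mxE; case: (bbP m0).
pose u l := \sum_m a 0 m * X m l.
have gE : (g k)%:C%C = (kap k)%:C%C * T u k.
  have -> : (g k)%:C%C = \sum_m bv 0 m * X m k.
    by rewrite rmorph_sum; apply: eq_bigr => m _; rewrite mxE; case: (bbP m).
  rewrite -aE mulmxBr mul_mx_scalar.
  have -> : \sum_m (a *m Lam - (c k)%:C%C *: a) 0 m * X m k =
      \sum_m (a *m Lam) 0 m * X m k - (c k)%:C%C * u k.
    by rewrite /u mulr_sumr -sumrB; apply: eq_bigr => m _; rewrite !mxE; ring.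
  by rewrite (span_row hk) -/(u k) addrAC subrr add0r.
have g0 l : 0 <= g l by apply: sumr_ge0 => m _; exact: nm_ge0.
have uB l : nm (u l) <= nm (a 0 m0) * g l.
  apply: le_trans (nm_sum _ _ _) _; rewrite mulr_sumr; apply: ler_sum => m _.
  by rewrite nmM ler_wpM2r ?nm_ge0.
have -> : g k = nm ((kap k)%:C%C * T u k) by rewrite -gE nm_real ger0_norm.
rewrite nmM nm_real mulrCA ler_wpM2l //.
apply: (@le_trans _ _ ((r k + d) * isum N (fun j => p j * nm (u (k - j))))).
  by rewrite ler_wpM2l ?Tk // ltW.
rewrite -isumZ; apply: le_isum => j; rewrite mulrCA ler_wpM2l //.
apply: (@le_trans _ _ ((r k + d) * (nm (a 0 m0) * g (k - j)))).
  by rewrite ler_wpM2l ?uB // ltW.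
by rewrite mulrA ler_piMl.
Qed.

End RowDecay.

(** * The limit of the finite sections *)

Section Convolution.
Variables (R : realType) (q : int -> R[i]) (Q : R) (cv : (int -> R[i]) -> int -> R[i]).
Notation C := R[i].
Hypothesis qQ : forall N, isum N (fun j => nm (q j)) <= Q.
Hypothesis qQ_lim : forall e, 0 < e -> exists J, Q - isum J (fun j => nm (q j)) <= e.
Hypothesis cv_near : forall v B k J, (forall k, nm (v k) <= B) ->
  nm (cv v k - conv q J v k) <= B * (Q - isum J (fun j => nm (q j))).

Lemma cv_bound v B k : (forall k, nm (v k) <= B) -> nm (cv v k) <= Q * B.
Proof.
move=> vB; have h1 := cv_near k 0 vB.
have h2 : nm (conv q 0 v k) <= isum 0 (fun j => nm (q j)) * B.
  rewrite /conv !isum0 nmM ler_wpM2l ?nm_ge0 //.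
by have := nmB_ge (cv v k) (conv q 0 v k); lra.
Qed.

(** [cv] is known only through [cv_near], so linearity is inherited from the truncated
    convolutions. *)
Lemma cv_sum (I : finType) (z : I -> C) (v : I -> int -> C) B k :
  (forall i k, nm (v i k) <= B) ->
  cv (fun k => \sum_i z i * v i k) k = \sum_i z i * cv (v i) k.
Proof.
move=> vB; pose Z := \sum_i nm (z i).
have Z0 : 0 <= Z by apply: sumr_ge0 => i _; exact: nm_ge0.
have zB l : nm (\sum_i z i * v i l) <= Z * B.
  apply: le_trans (nm_sum _ _ _) _; rewrite mulr_suml; apply: ler_sum => i _.
  by rewrite nmM ler_wpM2l ?nm_ge0.
apply/eqP; rewrite -subr_eq0; apply/eqP; apply: nm_eq0.
apply/ler_addgt0Pr => e e0; rewrite add0r.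
pose ZB := `|Z * B|.
have ZB0 : 0 <= ZB by exact: normr_ge0.
have ZBle : Z * B <= ZB by exact: ler_norm.
have [|J hJ] := @qQ_lim (e / (2 * ZB + 1)); first by rewrite divr_gt0 //; lra.
have t0 : 0 <= Q - isum J (fun j => nm (q j)) by rewrite subr_ge0.
have h1 := cv_near k J zB.
rewrite conv_sum in h1.
have h2 : nm (\sum_i z i * cv (v i) k - \sum_i z i * conv q J (v i) k) <=
    Z * B * (Q - isum J (fun j => nm (q j))).
  rewrite -sumrB; apply: le_trans (nm_sum _ _ _) _; rewrite -mulrA mulr_suml.
  apply: ler_sum => i _; rewrite -mulrBr nmM ler_wpM2l ?nm_ge0 //.
  exact: cv_near.
rewrite nmBC in h2.
have h3 := nmD (cv (fun k => \sum_i z i * v i k) k - \sum_i z i * conv q J (v i) k)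
  (\sum_i z i * conv q J (v i) k - \sum_i z i * cv (v i) k).
rewrite addrA subrK in h3.
have h4 : Z * B * (Q - isum J (fun j => nm (q j))) <= ZB * (e / (2 * ZB + 1)).
  apply: (@le_trans _ _ (ZB * (Q - isum J (fun j => nm (q j))))).
    by rewrite ler_wpM2r.
  by rewrite ler_wpM2l.
have h5 : 2 * (ZB * (e / (2 * ZB + 1))) <= e.
  rewrite !mulrA ler_pdivrMr; lra.
lra.
Qed.

End Convolution.

Section SpectralData.
Variables (R : realType) (n : nat) (sig : 'I_n.+1 -> int).
Variables (c kap : int -> R) (q : int -> R[i]) (Q a0 b0 d W : R).
Variable cv : (int -> R[i]) -> int -> R[i].
Notation C := R[i].
Let r k := `|kap k| * Q.
Let p j := nm (q j).

Hypothesis sig_inj : injective sig.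
Hypothesis qQ : forall N, isum N p <= Q.
Hypothesis qQ_lim : forall e, 0 < e -> exists J, Q - isum J p <= e.
Hypothesis q_even : forall j, p (- j) = p j.
Hypothesis q_neq0 : exists2 s, s != 0 & q s != 0.
Hypotheses (W_gt0 : 0 < W) (kapW : forall k, `|kap k| <= W * (`|k|%N%:R + 1)).
Hypothesis cv_near : forall v B k J, (forall k, nm (v k) <= B) ->
  nm (cv v k - conv q J v k) <= B * (Q - isum J p).
Hypothesis d_gt0 : 0 < d.
Hypothesis mid_bound : forall m, a0 <= c (sig m) - r (sig m) /\ c (sig m) + r (sig m) <= b0.
Hypothesis out_bound : forall k, (forall m, sig m != k) ->
  b0 + d <= c k - r k \/ c k + r k <= a0 - d.

Let p_ge0 j : 0 <= p j. Proof. exact: nm_ge0. Qed.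

Let Q_ge0 : 0 <= Q.
Proof. by apply: le_trans (qQ 0); exact: isum_ge0. Qed.

(** By [kapW] a lower bound of d / |kappa_k|, the relative surplus in [row_ineq]. *)
Let rho' (k : int) : R := d / (W * (`|k|%N%:R + 1)).

Lemma uniform_supersolution : exists H : int -> R,
  [/\ forall k, 0 <= H k, forall m, 1 <= H (sig m), tends0 H
    & forall J k, isum J (fun j => p j * H (k - j)) <= (Q + rho' k) * H k].
Proof.
have far (x z : int) (K N : nat) : (K + N <= `|x|)%N -> (`|z| <= N)%N ->
    (K <= `|(x - z)%R|)%N by lia.
have [s s0 qs] := q_neq0.
have ps : 0 < p s.
  rewrite lt_neqAle p_ge0 andbT eq_sym; apply: contraNneq qs => h.
  by apply/eqP/nm_eq0; rewrite -/(p s) h.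
pose S := (\max_m `|sig m|)%N.
have sS m : (`|sig m| <= S)%N by exact: leq_bigmax.
(* Smaller by the factor S + 1 because G is translated to the points of [sig], and |k| + 1 <= (S +
   1) (|k - sig m| + 1). *)
pose e := d / (W * (S%:R + 1)).
have WS0 : 0 < W * (S%:R + 1) by rewrite mulr_gt0 // ltr_wpDl.
have e0 : 0 < e by rewrite divr_gt0.
have [G [G0 G00 Gsup Gt]] := decaying_supersolution p_ge0 q_even qQ e0 qQ_lim s0 ps.
pose H k := (G 0)^-1 * \sum_m G (k - sig m).
have i0 : 0 <= (G 0)^-1 by rewrite invr_ge0 ltW.
exists H; split.
- by move=> k; rewrite mulr_ge0 // sumr_ge0.
- move=> m; rewrite /H (bigD1 m) //= subrr mulrDr mulVf ?gt_eqF // lerDl mulr_ge0 //.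
  by rewrite sumr_ge0.
- move=> t t0; have tn0 : 0 < t * G 0 / n.+1%:R.
    by rewrite divr_gt0 ?ltr0n // mulr_gt0.
  have [K KP] := Gt _ tn0.
  exists (K + S)%N => k Kk; rewrite /H mulrC ler_pdivrMr //.
  apply: (@le_trans _ _ (\sum_(m < n.+1) t * G 0 / n.+1%:R)).
    by apply: ler_sum => m _; apply: KP; exact: far Kk (sS m).
  by rewrite sumr_const card_ord -[leLHS]mulr_natr divfK // pnatr_eq0.
- move=> J k.
  have -> : isum J (fun j => p j * H (k - j)) =
      (G 0)^-1 * \sum_m isum J (fun j => p j * G (k - sig m - j)).
    rewrite -isum_exchange -isumZ; apply: eq_isum => j.
    rewrite /H mulrCA mulr_sumr; congr (_ * _); apply: eq_bigr => m _.
    by rewrite addrAC.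
  rewrite /H mulrCA ler_wpM2l // mulr_sumr; apply: ler_sum => m _.
  apply: le_trans (Gsup J (k - sig m)) _; rewrite ler_wpM2r // lerD2l.
  rewrite /rho /rho' /e -mulrA ler_wpM2l ?(ltW d_gt0) // -invfM lef_pV2 ?posrE; first last.
  + by rewrite mulr_gt0 // ltr_wpDl.
  + by rewrite mulr_gt0 // ltr_wpDl.
  rewrite -mulrA ler_wpM2l ?(ltW W_gt0) //.
  have : (`|k| + 1 <= (S + 1) * (`|(k - sig m)%R| + 1))%N by have := sS m; nia.
  by rewrite -(ler_nat R) !natrM !natrD; lra.
Qed.

(** Maximum principle for the positive part of g - H. It is attained because g has finite support;
    not on [sig], where g = 1 <= H; and elsewhere [row_ineq] contradicts the supersolution by the
    strict surplus rho'. *)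
Lemma section_decay H N (X : 'I_n.+1 -> int -> C) (Lam : 'M[C]_n.+1) :
  (forall k, 0 <= H k) -> (forall m, 1 <= H (sig m)) ->
  (forall J k, isum J (fun j => p j * H (k - j)) <= (Q + rho' k) * H k) ->
  (forall m m' : 'I_n.+1, X m (sig m') = (m == m')%:R) ->
  (forall m k, (N < `|k|)%N -> X m k = 0) ->
  (forall m k, (`|k| <= N)%N ->
     (c k)%:C%C * X m k + (kap k)%:C%C * conv q N (X m) k = \sum_m' Lam m m' * X m' k) ->
  (forall (a : 'I_n.+1 -> C) B k, (forall m, nm (a m) <= B) ->
     nm (\sum_m a m * X m k) <= B) ->
  (forall m, (`|sig m| <= N)%N) ->
  forall k, \sum_m nm (X m k) <= H k.
Proof.
move=> H0 HS Hsup Xsig Xout Xrow Xb sigN.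
pose g k := \sum_m nm (X m k).
have g0 k : 0 <= g k by apply: sumr_ge0 => m _; exact: nm_ge0.
have gout k : (N < `|k|)%N -> g k = 0.
  by move=> kN; rewrite /g big1 // => m _; rewrite Xout // nm0.
pose f k := Num.max (g k - H k) 0.
have [||k0 k0P] := @tends0_max R f.
- by move=> k; rewrite le_max lexx orbT.
- move=> e e0; exists N.+1 => k Nk.
  by rewrite /f gout // sub0r; case: (leP (- H k) 0); have := H0 k; lra.
move=> k; have [fk0|fk0] := leP (f k0) 0.
  have := le_trans (k0P k) fk0; rewrite /f ge_max => /andP[]; rewrite -/(g k); lra.
exfalso; have fE : f k0 = g k0 - H k0.
  by move: fk0; rewrite /f; case: (leP (g k0 - H k0) 0); lra.
have gk0 : 0 < g k0 by have := H0 k0; move: fk0; rewrite fE; lra.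
have k0N : (`|k0| <= N)%N.
  by rewrite leqNgt; apply/negP => /gout h; move: gk0; rewrite h ltxx.
have k0S m : sig m != k0.
  apply/negP => /eqP h; have := HS m; move: fk0; rewrite fE -h.
  rewrite /g (bigD1 m) //= Xsig eqxx nm1 big1 ?addr0 => [|m' mm']; first lra.
  by rewrite Xsig (negbTE mm') nm0.
have d0 := d_gt0.
have Tk v : nm (conv q N v k0) <= isum N (fun j => p j * nm (v (k0 - j))).
  by apply: le_trans (nm_isum _ _) _; apply: le_isum => j; rewrite nmM.
have ineq : (r k0 + d) * g k0 <= `|kap k0| * isum N (fun j => p j * g (k0 - j)).
  have Tsum (a : 'I_n.+1 -> C) k' : conv q N (fun k0 => \sum_m a m * X m k0) k' =
      \sum_m a m * conv q N (X m) k' by exact: conv_sum.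
  have Tb v B k' : (forall k, nm (v k) <= B) -> nm (conv q N v k') <= Q * B.
    by move=> vB; exact: nm_conv_le.
  have Xrs m m' := Xrow m (sig m') (sigN m').
  have h := (row_ineq Q_ge0 d0 mid_bound out_bound Xsig Xb Tsum Tb Xrs k0S
    (fun m => Xrow m k0 k0N) Tk p_ge0).
  exact: h.
(* Without coupling in this row, the inequality alone forces g k0 <= 0. *)
have [kz|kz] := eqVneq (kap k0) 0.
  by move: ineq; rewrite /r kz normr0 !mul0r add0r pmulr_rle0 // leNgt gk0.
have kp : 0 < `|kap k0| by rewrite normr_gt0.
have rk : `|kap k0| * rho' k0 <= d.
  rewrite /rho' mulrCA ler_piMr ?(ltW d0) // ler_pdivrMr ?mul1r //.
  by rewrite mulr_gt0 // ltr_wpDl.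
have rp : 0 < rho' k0 by rewrite divr_gt0 // mulr_gt0 // ltr_wpDl.
have h1 : (Q + rho' k0) * g k0 <= isum N (fun j => p j * g (k0 - j)).
  rewrite -(ler_pM2l kp); apply: le_trans ineq.
  by rewrite mulrA ler_wpM2r // /r; lra.
have h2 := Hsup N k0.
have h3 : isum N (fun j => p j * g (k0 - j)) - isum N (fun j => p j * H (k0 - j)) <= Q * f k0.
  rewrite -isumB; apply: (@le_trans _ _ (isum N p * f k0)); last first.
    by rewrite ler_wpM2r // ltW.
  rewrite -isumZr; apply: le_isum => j; rewrite -mulrBr ler_wpM2l //.
  by apply: le_trans (k0P (k0 - j)); rewrite le_max lexx.
have : 0 < rho' k0 * f k0 by rewrite mulr_gt0.
by rewrite fE in h3 *; lra.
Qed.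

(** [H] is the same for all sections, so it dominates the limit as well, which therefore lies in
    c_0. *)
Lemma spectral_data : exists (X : 'I_n.+1 -> int -> C) (Lam : 'M[C]_n.+1),
  [/\ forall m m', X m (sig m') = (m == m')%:R,
      forall (a : 'I_n.+1 -> C) B k, (forall m, nm (a m) <= B) ->
        nm (\sum_m a m * X m k) <= B,
      forall m, tends0 (fun k => nm (X m k))
    & forall m k,
        (c k)%:C%C * X m k + (kap k)%:C%C * cv (X m) k = \sum_m' Lam m m' * X m' k].
Proof.
have [H [H0 HS Ht Hsup]] := uniform_supersolution.
pose S := (\max_m `|sig m|)%N.
have sS m i : (`|sig m| <= S + i)%N by apply: leq_trans (leq_addr _ _); exact: leq_bigmax.
have /choice[X] : forall i, exists (X : 'I_n.+1 -> int -> C), exists (Lam : 'M[C]_n.+1),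
  [/\ forall m m', X m (sig m') = (m == m')%:R,
      forall m k, (S + i < `|k|)%N -> X m k = 0,
      forall m k, (`|k| <= S + i)%N ->
        (c k)%:C%C * X m k + (kap k)%:C%C * conv q (S + i) (X m) k = \sum_m' Lam m m' * X m' k
    & forall (a : 'I_n.+1 -> C) B k, (forall m, nm (a m) <= B) ->
        nm (\sum_m a m * X m k) <= B].
  by move=> i; exact: (finite_section sig_inj qQ d_gt0 mid_bound out_bound (sS ^~ i)).
move=> /choice[Lam XL].
have Xs i m m' : X i m (sig m') = (m == m')%:R by case: (XL i).
have Xrow i m k : (`|k| <= S + i)%N -> (c k)%:C%C * X i m k +
    (kap k)%:C%C * conv q (S + i) (X i m) k = \sum_m' Lam i m m' * X i m' k.
  by case: (XL i) => _ _ + _; apply.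
have Xb i (a : 'I_n.+1 -> C) B k : (forall m, nm (a m) <= B) ->
    nm (\sum_m a m * X i m k) <= B by case: (XL i) => _ _ _; apply.
have XH i k : \sum_m nm (X i m k) <= H k.
  case: (XL i) => h1 h2 h3 h4.
  exact: (section_decay H0 HS Hsup h1 h2 h3 h4 (sS ^~ i)).
have X1 i m k : nm (X i m k) <= 1.
  pose dl m' : C := (m' == m)%:R.
  have <- : \sum_m' dl m' * X i m' k = X i m k.
    rewrite (bigD1 m) //= /dl eqxx mul1r big1 ?addr0 // => m' /negbTE ->.
    by rewrite mul0r.
  by apply: Xb => m'; rewrite /dl; case: (m' == m); rewrite ?nm0 ?nm1.
(* At an index in [sig] the right-hand side of the row reduces to one entry of [Lam], so the entries
   are bounded uniformly in the section. *)
have LamB i m m' : nm (Lam i m m') <= `|c (sig m')| + `|kap (sig m')| * Q.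
  have := Xrow i m (sig m') (sS m' i).
  rewrite (@span_sig _ _ sig _ (Xs i)) => <-.
  apply: le_trans (nmD _ _) _; rewrite !nmM !nm_real; apply: lerD.
    by rewrite ler_piMr // X1.
  rewrite ler_wpM2l // -[leRHS]mulr1; exact: nm_conv_le.
have [F UF Foo] := ultra_nat.
have PF : ProperFilter F by exact: ultra_proper.
have /choice[Y' YP'] : forall mk : 'I_n.+1 * int, exists l, ulim F (fun i => X i mk.1 mk.2) l.
  by move=> mk; apply: (ultra_bounded_ulim UF) => i; exact: X1.
pose Y m k := Y' (m, k).
have YP m k : ulim F (fun i => X i m k) (Y m k) by exact: (YP' (m, k)).
have /choice[Mu' MuP'] : forall mm : 'I_n.+1 * 'I_n.+1, exists l,
    ulim F (fun i => Lam i mm.1 mm.2) l.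
  by move=> mm; apply: (ultra_bounded_ulim UF) => i; exact: LamB.
pose Mu m m' := Mu' (m, m').
have MuP m m' : ulim F (fun i => Lam i m m') (Mu m m') by exact: (MuP' (m, m')).
have Yb (a : 'I_n.+1 -> C) B k : (forall m, nm (a m) <= B) -> nm (\sum_m a m * Y m k) <= B.
  move=> aB; apply: (@ulim_bounded _ F UF (fun i => \sum_m a m * X i m k)).
    by move=> i; exact: Xb.
  by apply: ulim_sum => m; exact: ulimZ.
have Y1 m k : nm (Y m k) <= 1.
  by apply: (@ulim_bounded _ F UF (fun i => X i m k)).
exists Y, (\matrix_(m, m') Mu m m'); split => //.
- move=> m m'; apply: (@ulim_uniq _ F UF (fun i => X i m (sig m'))); first exact: YP.
  rewrite (_ : (fun i => _) = fun=> (m == m')%:R); first exact: ulim_cst.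
  by apply/funext => i; rewrite Xs.
- move=> m e e0; have [K KP] := Ht _ e0; exists K => k Kk.
  apply: (@ulim_bounded _ F UF (fun i => X i m k)); last exact: YP.
  move=> i; apply: le_trans (KP k Kk); apply: le_trans (XH i k).
  by rewrite (bigD1 m) //= lerDl sumr_ge0 // => m' _; exact: nm_ge0.
- move=> m k.
  have rhs : ulim F (fun i => \sum_m' Lam i m m' * X i m' k)
      (\sum_m' (\matrix_(m, m') Mu m m') m m' * Y m' k).
    apply: ulim_sum => m'; rewrite mxE.
    by apply: (@ulimM _ F UF _ _ _ _ 1) => // i; exact: X1.
  have lhs : ulim F (fun i => (c k)%:C%C * X i m k + (kap k)%:C%C * conv q (S + i) (X i m) k)
      ((c k)%:C%C * Y m k + (kap k)%:C%C * cv (Y m) k).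
    apply: (ulimD UF); first exact: ulimZ.
    apply: (ulimZ UF) => e e0.
    (* One third each for the truncation error of the section, the convergence of finitely many
       terms, and the truncation error of the limit. *)
    have [|J hJ] := @qQ_lim (e / 3); first lra.
    have t0 : 0 <= Q - isum J p by rewrite subr_ge0.
    have cJ : ulim F (fun i => conv q J (X i m) k) (conv q J (Y m) k).
      by apply: (ulim_sum UF) => j; exact: ulimZ.
    have e30 : 0 < e / 3 by lra.
    have FJ : F [set i | (J <= S + i)%N].
      by apply: Foo; exists J => // i /= Ji; apply: leq_trans (leq_addl _ _).
    apply: filterS (filterI (cJ _ e30) FJ) => i [/= h1 Ji].
    have h2 : nm (conv q (S + i) (X i m) k - conv q J (X i m) k) <= e / 3.
      apply: le_trans hJ; rewrite -(subnKC Ji).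
      move: (S + i - J)%N => t; rewrite /conv.
      apply: (@le_trans _ _ (isum (J + t) p - isum J p)); last by rewrite lerB.
      elim: t => [|t IH]; first by rewrite addn0 !subrr nm0.
      rewrite addnS !isumS.
      have hj j : nm (q j * X i m (k - j)) <= p j.
        by rewrite nmM ler_piMr ?nm_ge0 ?X1.
      rewrite [X in nm X]addrAC [leRHS]addrAC; apply: le_trans (nmD _ _) _.
      apply: (lerD IH); apply: le_trans (nmD _ _) _.
      by apply: lerD; exact: hj.
    have h3 := cv_near k J (Y1 m).
    rewrite mul1r in h3; rewrite nmBC in h3.
    have := nmD (conv q (S + i) (X i m) k - conv q J (X i m) k)
      (conv q J (X i m) k - conv q J (Y m) k).
    rewrite addrA subrK.
    have := nmD (conv q (S + i) (X i m) k - conv q J (Y m) k)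
      (conv q J (Y m) k - cv (Y m) k).
    rewrite addrA subrK; lra.
  apply: (ulim_uniq UF lhs); apply: (ulim_near UF _ rhs) => e e0.
  have Fk : F [set i | (`|k| <= S + i)%N].
    by apply: Foo; exists `|k|%N => // i /= ki; apply: leq_trans (leq_addl _ _).
  by apply: filterS Fk => i /= ki; rewrite Xrow // subrr nm0 ltW.
Qed.

End SpectralData.

(** * Counting generalized eigenvectors *)

Section CountFromSpan.
Variables (R : realType) (n : nat) (X : 'I_n.+1 -> int -> CC R) (Lam : 'M[R[i]]_n.+1).
Variables (L : (int -> CC R) -> int -> CC R) (A : set (CC R)).
Notation C := R[i].

Definition span (a : 'rV[C]_n.+1) (k : int) : CC R := \sum_m a 0 m * X m k.

Hypothesis span_inj : forall a, (forall k, span a k = 0) -> a = 0.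
Hypothesis span_vanishing : forall a, vanishing (span a).
Hypothesis L_span : forall a k, L (span a) k = span (a *m Lam) k.
Hypothesis Lam_eigen : forall (z : C) (a : 'rV[C]_n.+1),
  a != 0 -> a *m Lam = z *: a -> A z.
(** Applied along a Jordan chain, this puts every generalized eigenvector belonging to a point of
    [A] into the span. *)
Hypothesis resolvent_span : forall (z : CC R) (v : int -> CC R) g,
  A z -> vanishing v -> (forall k, L v k - z * v k = span g k) ->
  exists a, forall k, v k = span a k.

Lemma spanD a b k : span (a + b) k = span a k + span b k.
Proof. exact: (combD X a b k). Qed.

Lemma spanZ z a k : span (z *: a) k = z * span a k.
Proof. exact: (combZ X z a k). Qed.

Lemma spanB a b k : span (a - b) k = span a k - span b k.
Proof. exact: (combB X a b k). Qed.

Lemma span0 k : span 0 k = 0.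
Proof. exact: (comb0 X k). Qed.

Lemma L_sub_span z a k : L (span a) k - z * span a k = span (a *m (Lam - z%:M)) k.
Proof. by rewrite L_span mulmxBr mul_mx_scalar spanB spanZ. Qed.

Lemma gen_ker_span z j a : a *m (Lam - z%:M) ^+ j = 0 -> gen_ker L z j (span a).
Proof.
elim: j a => [|j IH] a; first by rewrite expr0 mulmx1 => ->; apply/funext => k; exact: span0.
rewrite exprS mulmxA => h; split; first exact: span_vanishing.
rewrite (_ : (fun k => _) = span (a *m (Lam - z%:M))); first exact: IH.
by apply/funext => k; rewrite L_sub_span.
Qed.

Lemma gen_kerP z j v : A z -> gen_ker L z j v ->
  exists2 a, v = span a & a *m (Lam - z%:M) ^+ j = 0.
Proof.
move=> Az; elim: j v => [|j IH] v.
  by move=> ->; exists 0; [apply/funext => k; rewrite span0|rewrite mul0mx].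
move=> [vv /IH[g gE gj]].
have [a aE] : exists a, forall k, v k = span a k.
  apply: (resolvent_span (z := z) (g := g)) => // k.
  by have := congr1 (fun f => f k) gE.
have {}aE : v = span a by apply/funext.
exists a => //; rewrite exprS mulmxA.
suff -> : a *m (Lam - z%:M) = g by [].
apply/eqP; rewrite -subr_eq0; apply/eqP/span_inj => k.
rewrite spanB -L_sub_span -aE.
by have := congr1 (fun f => f k) gE => /= ->; rewrite subrr.
Qed.

(** Let char_poly B = q X^m with q(0) nonzero. Bezout for q and X^j combines Cayley-Hamilton with
    the assumption to give a B^m = 0, and m <= n + 1. *)
Lemma nilpotent_stable (B : 'M[C]_n.+1) (a : 'rV[C]_n.+1) j :
  a *m B ^+ j = 0 -> a *m B ^+ n.+1 = 0.
Proof.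
move=> aj.
have p0 : char_poly B != 0 by rewrite monic_neq0 // char_poly_monic.
have [m [q q0 qE]] := multiplicity_XsubC (char_poly B) 0.
rewrite polyC0 subr0 in qE.
have {}q0 : ~~ root q 0 by move: q0; rewrite p0.
have mn : (m <= n.+1)%N.
  have := size_char_poly B; rewrite qE size_mulXn; last first.
    by apply: contra_neq p0 => q0'; rewrite qE q0' mul0r.
  have : (0 < size q)%N by rewrite size_poly_gt0; apply: contra_neq p0 => h; rewrite qE h mul0r.
  lia.
have co : coprimep q ('X^j).
  by rewrite coprimep_expr //; have := coprimep_XsubC q 0; rewrite polyC0 subr0 => ->.
have /Bezout_eq1_coprimepP[[u w] /= uw] := co.
have : a *m horner_mx B ('X^m * (u * q + w * 'X^j)) = 0.
  rewrite mulrDr.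
  have -> : 'X^m * (u * q) = char_poly B * u by rewrite qE; ring.
  have -> : 'X^m * (w * 'X^j) = 'X^j * ('X^m * w) by ring.
  rewrite rmorphD /= rmorphM /= Cayley_Hamilton mul0r add0r rmorphM /= rmorphXn /= horner_mx_X.
  by rewrite -mulmxE mulmxA aj mul0mx.
rewrite uw mulr1 rmorphXn /= horner_mx_X => am.
have -> : B ^+ n.+1 = B ^+ m *m B ^+ (n.+1 - m) by rewrite mulmxE -exprD subnKC.
by rewrite mulmxA am mul0mx.
Qed.

(** The multiplicities are the dimensions of the generalized eigenspaces of [Lam], which over the
    complex numbers fill the whole space. *)
Lemma count_from_span : eigenvalue_count L A n.+1.
Proof.
have [rs rsE] := char_poly_split Lam.
pose s := undup rs.
pose V z := geigenspace Lam z.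
have rootP z : z \in s -> exists2 a : 'rV[C]_n.+1, a != 0 & a *m Lam = z *: a.
  rewrite mem_undup => zrs; have : root (char_poly Lam) z by rewrite rsE root_prod_XsubC.
  by rewrite -eigenvalue_root_char => /eigenvalueP[a ? ?]; exists a.
have VP z (a : 'rV[C]_n.+1) : reflect (a *m (Lam - z%:M) ^+ n.+1 = 0) (a <= V z)%MS.
  by rewrite /V geigenspaceE; exact: sub_kermxP.
have sA z : z \in s -> A z by move=> /rootP[a a0 az]; exact: Lam_eigen az.
exists s, (fun z => \rank (V z)); split.
- exact: undup_uniq.
- move=> z; split=> [zs|[Az [v [vv v0 vL]]]].
    split; first exact: sA.
    have [a a0 az] := rootP z zs; exists (span a); split; first exact: span_vanishing.
      move=> h; case/eqP: a0; apply: span_inj => k; by rewrite h.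
    by move=> k; rewrite L_span az spanZ.
  have [a aE ak] : exists2 a, v = span a & a *m (Lam - z%:M) ^+ 1 = 0.
    apply: (gen_kerP (j := 1)) => //; split=> //=.
    by apply/funext => k; rewrite -vL subrr.
  rewrite mem_undup -root_prod_XsubC -rsE -eigenvalue_root_char.
  apply/eigenvalueP; exists a; last first.
    apply/eqP => a0; apply: v0; rewrite aE a0; apply/funext => k; exact: span0.
  by apply/eqP; rewrite -subr_eq0 -mul_mx_scalar -mulmxBr -[_ - _]expr1 ak.
- move=> z zs; have Az := sA z zs.
  pose b (i : 'I_(\rank (V z))) := row i (row_base (V z)).
  have cmb (a : 'I_(\rank (V z)) -> CC R) k : \sum_i a i * span (b i) k =
      span ((\row_i a i) *m row_base (V z)) k.
    rewrite mulmx_sum_row.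
    have -> : span (\sum_i (\row_i a i) 0 i *: row i (row_base (V z))) k =
        \sum_i span ((\row_i a i) 0 i *: row i (row_base (V z))) k.
      elim/big_ind2: _ => [|? ? ? ? <- <-|//]; rewrite ?span0 ?spanD //.
    by apply: eq_bigr => i _; rewrite spanZ mxE.
  exists (fun i => span (b i)); split.
  + move=> i; exists n.+1; apply: gen_ker_span; apply/VP.
    by apply: submx_trans (row_sub _ _) _; rewrite eq_row_base.
  + move=> a ha; have h : (\row_i a i) *m row_base (V z) = 0.
      by apply: span_inj => k; rewrite -cmb.
    have : (\row_i a i) = 0 :> 'rV[C]_(\rank (V z)).
      by apply: (row_free_inj (row_base_free (V z))); rewrite h mul0mx.
    by move=> /rowP e i; have := e i; rewrite !mxE.
  + move=> v [j /(gen_kerP Az)[a -> /nilpotent_stable/VP]].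
    rewrite -(eq_row_base (V z)) => /submxP[w wE].
    exists (fun i => w 0 i) => k; rewrite cmb wE; congr (span (_ *m _) k).
    by apply/rowP => i; rewrite mxE.
- rewrite (big_nth 0) big_mkord.
  pose I := 'I_(size s).
  have inj_s : {in predT &, injective (fun i : I => s`_i)}.
    move=> i j _ _ h; apply/val_inj; apply/eqP.
    by rewrite -(nth_uniq 0 (ltn_ord i) (ltn_ord j) (undup_uniq rs)) h.
  have full : (1%:M <= \sum_(i < size s) V s`_i)%MS.
    pose p (i : I) := ('X - (s`_i)%:P) ^+ count_mem s`_i rs.
    have pE : char_poly Lam = \prod_(i : I) p i.
      rewrite rsE -big_undup_iterop_count (big_nth 0) big_mkord.
      by apply: eq_bigr => i _.
    have co : {in predT &, forall i j : I, j != i -> coprimep (p i) (p j)}.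
      move=> i j _ _ ij; rewrite /p coprimep_expr // coprimep_expl //.
      rewrite coprimep_XsubC root_XsubC.
      by rewrite (inj_in_eq inj_s).
    have h1 : (kermxpoly Lam (char_poly Lam) :=: 1)%MS.
      by apply: kermxpoly_min; exact: mxminpoly_dvd_char.
    have h2 : (kermxpoly Lam (char_poly Lam) <= \sum_(i : I) kermxpoly Lam (p i))%MS.
      by rewrite pE; have /eqmxP/andP[] := kermxpoly_prod Lam co.
    have /eqmxP/andP[_ h3] := h1.
    apply: submx_trans (submx_trans h3 h2) _; apply: sumsmxS => i _.
    rewrite /V geigenspaceE; apply/sub_kermxP.
    have cn : (count_mem (s`_i)%R rs <= n.+1)%N.
      have := size_char_poly Lam; rewrite rsE size_prod_XsubC => -[<-].
      exact: count_size.
    have : kermxpoly Lam (p i) *m (Lam - (s`_i)%:M) ^+ count_mem s`_i rs = 0.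
      by rewrite /kermxpoly /p rmorphXn /= rmorphB /= horner_mx_X horner_mx_C mulmx_ker.
    have -> : (Lam - (s`_i)%:M) ^+ n.+1 = (Lam - (s`_i)%:M) ^+ count_mem s`_i rs *m
        (Lam - (s`_i)%:M) ^+ (n.+1 - count_mem s`_i rs) by rewrite mulmxE -exprD subnKC.
    by rewrite mulmxA => ->; rewrite mul0mx.
  have := mxdirect_sum_geigenspace Lam inj_s.
  rewrite mxdirectE /= => /eqP <-.
  by apply/eqP; rewrite eqn_leq rank_leq_row /= -{1}(mxrank1 C n.+1) mxrankS.
Qed.

End CountFromSpan.

Section SpectralCount.
Variables (R : realType) (n : nat) (sig : 'I_n.+1 -> int).
Variables (c kap : int -> R) (q : int -> R[i]) (Q a0 b0 d W : R).
Variable cv : (int -> R[i]) -> int -> R[i].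
Notation C := R[i].
Let r k := `|kap k| * Q.
Let p j := nm (q j).

Hypothesis sig_inj : injective sig.
Hypothesis qQ : forall N, isum N p <= Q.
Hypothesis qQ_lim : forall e, 0 < e -> exists J, Q - isum J p <= e.
Hypothesis cv_near : forall v B k J, (forall k, nm (v k) <= B) ->
  nm (cv v k - conv q J v k) <= B * (Q - isum J p).
Hypothesis d_gt0 : 0 < d.
Hypothesis mid_bound : forall m, a0 <= c (sig m) - r (sig m) /\ c (sig m) + r (sig m) <= b0.
Hypothesis out_bound : forall k, (forall m, sig m != k) ->
  b0 + d <= c k - r k \/ c k + r k <= a0 - d.

Let Q_ge0 : 0 <= Q.
Proof. by apply: le_trans (qQ 0); apply: isum_ge0 => j; exact: nm_ge0. Qed.

Let r_ge0 k : 0 <= r k. Proof. by rewrite mulr_ge0. Qed.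

Section Unique.
Variables (X : 'I_n.+1 -> int -> C) (Lam : 'M[C]_n.+1).
Hypothesis Xsig : forall m m', X m (sig m') = (m == m')%:R.
Hypothesis Xbound : forall (a : 'I_n.+1 -> C) B k, (forall m, nm (a m) <= B) ->
  nm (\sum_m a m * X m k) <= B.
Hypothesis Xt : forall m, tends0 (fun k => nm (X m k)).
Hypothesis Xrow : forall m k,
  (c k)%:C%C * X m k + (kap k)%:C%C * cv (X m) k = \sum_m' Lam m m' * X m' k.

Let X1 m k : nm (X m k) <= 1.
Proof.
pose dl m' : C := (m' == m)%:R.
have <- : \sum_m' dl m' * X m' k = X m k.
  rewrite (bigD1 m) //= /dl eqxx mul1r big1 ?addr0 // => m' /negbTE ->.
  by rewrite mul0r.
by apply: Xbound => m'; rewrite /dl; case: (m' == m); rewrite ?nm0 ?nm1.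
Qed.

Lemma lam_strip (z : C) (a : 'rV[C]_n.+1) : a != 0 -> a *m Lam = z *: a ->
  exists m, nm (z - (c (sig m))%:C%C) <= r (sig m).
Proof.
have Tb v B k := @cv_bound R q Q cv cv_near v B k.
have Ts (a' : 'I_n.+1 -> C) k := cv_sum qQ qQ_lim cv_near a' k X1.
have Xr m m' := Xrow m (sig m').
exact: (lam_eigen Xsig Xbound Ts Tb Xr).
Qed.

(* [u] together with the columns of [X] spans a space invariant under the
   operator, with all eigenvalues in the strip; the cone property forces a
   member vanishing on the range of [sig] to be zero. *)
Lemma invariant_vanish (h : C) (u : int -> C) (g : 'I_n.+1 -> C) :
  a0 <= complex.Re h <= b0 -> tends0 (fun k => nm (u k)) ->
  (forall m, u (sig m) = 0) ->
  (forall k, (c k)%:C%C * u k + (kap k)%:C%C * cv u k = h * u k + \sum_m g m * X m k) ->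
  forall k, u k = 0.
Proof.
move=> hh ut us urow k1; apply/eqP; apply: contrapT => /negP uk1.
(* [u] joins the X as one more generator. [M] is block triangular, so its eigenvalues are [h] and
   those of [Lam], all in the strip. *)
pose y (i : 'I_(1 + n.+1)) : int -> C := match fintype.split i with inl _ => u | inr m => X m end.
pose M : 'M[C]_(1 + n.+1) := block_mx h%:M (\row_m g m) 0 Lam.
have yl i : y (lshift _ i) = u by rewrite /y (unsplitK (inl i)).
have yr m : y (rshift 1 m) = X m by rewrite /y (unsplitK (inr m)).
have combE (a : 'rV[C]_(1 + n.+1)) k :
    comb y a k = a 0 (lshift _ ord0) * u k + \sum_m a 0 (rshift 1 m) * X m k.
  rewrite /comb big_split_ord /= big_ord1 yl; congr (_ + _).
  by apply: eq_bigr => m _; rewrite yr.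
have [ku kuP] : exists k0, forall k, nm (u k) <= nm (u k0).
  by apply: tends0_max => // k; exact: nm_ge0.
have u0 : 0 < nm (u k1).
  rewrite lt_neqAle nm_ge0 andbT eq_sym; apply/negP => /eqP h0.
  have z : u k1 = 0 by apply: nm_eq0; rewrite h0.
  by move: uk1; rewrite z eqxx.
have yb i k : nm (y i k) <= nm (u ku) + 1.
  rewrite -[ (i) ]splitK; case: (fintype.split i) => [j|m] /=.
    by rewrite yl; have := kuP k; lra.
  by rewrite yr; have := X1 m k; have := nm_ge0 (u ku); lra.
have yrow i k : (c k)%:C%C * y i k + (kap k)%:C%C * cv (y i) k = \sum_j M i j * y j k.
  rewrite big_split_ord /= big_ord1 yl -[ (i) ]splitK; case: (fintype.split i) => [j|m] /=.
    rewrite yl urow (ord1 j) /M block_mxEul mxE eqxx mulr1n; congr (_ + _).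
    by apply: eq_bigr => m _; rewrite block_mxEur mxE yr.
  rewrite yr Xrow /M block_mxEdl mxE mul0r add0r.
  by apply: eq_bigr => m' _; rewrite block_mxEdr yr.
have yt i : tends0 (fun k => nm (y i k)).
  by rewrite -[ (i) ]splitK; case: (fintype.split i) => [j|m] /=; rewrite ?yl ?yr.
have yinj : exists2 K : R, 0 <= K &
    forall a B, (forall k, nm (comb y a k) <= B) -> forall i, nm (a 0 i) <= K * B.
  (* The coefficients of the X are read off on [sig], where [u] vanishes, and are at most B; at [k1]
     the coefficient of [u] is then at most 2 B / |u k1|. *)
  exists (1 + 2 / nm (u k1)).
    by rewrite addr_ge0 // divr_ge0 // nm_ge0.
  move=> a B aB i; have B0 : 0 <= B by apply: le_trans (aB 0); exact: nm_ge0.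
  have h2 : 0 <= 2 / nm (u k1) * B by rewrite mulr_ge0 // divr_ge0 // nm_ge0.
  have ar m : nm (a 0 (rshift 1 m)) <= B.
    have := aB (sig m); rewrite combE us mulr0 add0r.
    by rewrite (@span_sig R n sig X Xsig (fun m => a 0 (rshift 1 m))).
  rewrite -[ (i) ]splitK; case: (fintype.split i) => [j|m] /=; last by have := ar m; lra.
  rewrite (ord1 j); have := aB k1; rewrite combE => h3.
  have h4 := Xbound k1 ar.
  have h5 := nmD_ge (a 0 (lshift n.+1 ord0) * u k1) (\sum_m a 0 (rshift 1 m) * X m k1).
  rewrite nmM in h5.
  have : nm (a 0 (lshift n.+1 ord0)) <= 2 * B / nm (u k1).
    by rewrite ler_pdivlMr //; lra.
  have -> : 2 * B / nm (u k1) = 2 / nm (u k1) * B by ring.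
  lra.
have yM a k : comb y (a *m M) k = (c k)%:C%C * comb y a k + (kap k)%:C%C * cv (comb y a) k.
  rewrite (cv_sum qQ qQ_lim cv_near (fun i => a 0 i) k yb) /comb !mulr_sumr -big_split /=.
  under eq_bigr => j _ do rewrite mxE mulr_suml.
  rewrite exchange_big; apply: eq_bigr => i _ /=.
  transitivity (a 0 i * \sum_j M i j * y j k).
    by rewrite mulr_sumr; apply: eq_bigr => j _; rewrite mulrA.
  by rewrite -yrow; ring.
have yrb a B k : (forall k, nm (comb y a k) <= B) ->
    nm (comb y (a *m M) k - (c k)%:C%C * comb y a k) <= r k * B.
  move=> aB; rewrite yM addrAC subrr add0r nmM nm_real -mulrA ler_wpM2l //.
  exact: (cv_bound cv_near).
have [rs rsE] := char_poly_split M.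
have rsP z : z \in rs -> a0 <= complex.Re z <= b0.
  move=> zrs; have : root (char_poly M) z by rewrite rsE root_prod_XsubC.
  rewrite -eigenvalue_root_char => /eigenvalueP[a].
  rewrite -[a]hsubmxK; set w := lsubmx a; set a' := rsubmx a.
  rewrite /M mul_row_block mulmx0 addr0 scale_row_mx => /eq_row_mx[e1 e2] a0'.
  have [w0|w0] := eqVneq w 0.
    have a'0 : a' != 0 by apply: contra_neq a0' => ->; rewrite w0 row_mx0.
    rewrite w0 mul0mx add0r in e2.
    have [m hm] := lam_strip a'0 e2.
    have := le_trans (normr_Re _) hm.
    have [h1 h2] := mid_bound m.
    case: (z) => x1 x2 /=; rewrite ler_norml; lra.
  suff -> : z = h by [].
  have : w 0 0 != 0.
    by apply: contra_neq w0 => w00; apply/rowP => i; rewrite (ord1 i) w00 mxE.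
  move=> /mulIf; apply; have := congr1 (fun f : 'M[C]_1 => f 0 0) e1.
  by rewrite mul_mx_scalar !mxE.
pose a : 'rV[C]_(1 + n.+1) := row_mx 1%:M 0.
have au k : comb y a k = u k.
  rewrite combE /a row_mxEl mxE eqxx mulr1n mul1r big1 ?addr0 // => m _.
  by rewrite row_mxEr mxE mul0r.
have ka : kill M rs a = 0.
  (* The list consists of all roots of the characteristic polynomial with multiplicity, so it
     annihilates every vector. *)
  by rewrite kill_mul_prod -rsE Cayley_Hamilton mulmx0.
have k0P k : nm (comb y a k) <= nm (comb y a ku) by rewrite !au.
have ku0 : u ku != 0.
  apply/negP => /eqP h0; have := kuP k1; rewrite h0 nm0; lra.
have az : a = 0 -> False.
  move=> ha; have := au ku; rewrite ha comb0 => h0.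
  by move: ku0; rewrite -h0 eqxx.
have kuS m : sig m != ku by apply/negP => /eqP e; move: ku0; rewrite -e us eqxx.
have a0b0 : a0 <= b0 by lra.
have d0 := d_gt0.
have mbE k : [exists m, sig m == k] -> a0 <= c k - r k /\ c k + r k <= b0.
  by move=> /existsP[m /eqP <-]; exact: mid_bound.
have obE k : ~~ [exists m, sig m == k] -> b0 + d <= c k - r k \/ c k + r k <= a0 - d.
  by rewrite negb_exists => /forallP h0; apply: out_bound => m; exact: h0.
case: (out_bound kuS) => hku; apply: az.
- apply: (@cone_growth R _ y M c r (fun k => b0 + d <= c k - r k) b0 d yt yinj yrb d0 _ _ rs
    a ku _ ka hku k0P) => //.
    move=> k; rewrite -ltNge => nup.
    case: (boolP [exists m, sig m == k]) => [/mbE[]//|/obE[]]; lra.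
  by move=> z /rsP; lra.
- apply: (@cone_growth_opp R _ y M c r yt yinj yrb (fun k => c k + r k <= a0 - d) a0 d rs
    a ku d0 _ _ _ ka hku k0P) => //.
    move=> k; rewrite -ltNge => nlo.
    case: (boolP [exists m, sig m == k]) => [/mbE[]//|/obE[]]; lra.
  by move=> z /rsP; lra.
Qed.

End Unique.

Hypothesis q_even : forall j, p (- j) = p j.
Hypothesis q_neq0 : exists2 s, s != 0 & q s != 0.
Hypotheses (W_gt0 : 0 < W) (kapW : forall k, `|kap k| <= W * (`|k|%N%:R + 1)).
Variables (L : (int -> CC R) -> int -> CC R) (A : set (CC R)).
Hypothesis LE : forall v k, L v k =
  Complex 0 1 * ((c k)%:C%C * v k + (kap k)%:C%C * cv v k).
Hypothesis A_strip : forall z, A z -> a0 <= complex.Im z <= b0.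
Hypothesis A_disk : forall m z,
  nm (z - Complex 0 (c (sig m))) <= r (sig m) -> A z.

Lemma tends0_vanishing (v : int -> CC R) : vanishing v <-> tends0 (fun k => nm (v k)).
Proof.
split=> [[vp vn] e e0|vt].
  have /cvgrPdist_lt/(_ e e0)[N1 _ h1] := vp.
  have /cvgrPdist_lt/(_ e e0)[N2 _ h2] := vn.
  exists (maxn N1 N2) => k; rewrite geq_max => /andP[k1 k2].
  have := h1 `|k|%N k1; have := h2 `|k|%N k2; rewrite /= !sub0r !normrN.
  rewrite !ger0_norm ?nm_ge0 //.
  have [k0|k0] := leP 0 k; first by rewrite gez0_abs // => _ /ltW.
  by rewrite ltz0_abs // opprK => /ltW.
split; apply/cvgrPdist_le => e e0; have [K KP] := vt e e0; exists K => //= j Kj.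
- by rewrite sub0r normrN ger0_norm ?nm_ge0 //; exact: KP.
- by rewrite sub0r normrN ger0_norm ?nm_ge0 //; apply: KP; rewrite abszN.
Qed.

Lemma spectral_count : eigenvalue_count L A n.+1.
Proof.
have [X [Lam [Xsig Xbound Xt Xrow]]] := spectral_data sig_inj qQ qQ_lim q_even q_neq0
  W_gt0 kapW cv_near d_gt0 mid_bound out_bound.
have X1 m k : nm (X m k) <= 1.
  pose dl m' : C := (m' == m)%:R.
  have <- : \sum_m' dl m' * X m' k = X m k.
    rewrite (bigD1 m) //= /dl eqxx mul1r big1 ?addr0 // => m' /negbTE ->.
    by rewrite mul0r.
  by apply: Xbound => m'; rewrite /dl; case: (m' == m); rewrite ?nm0 ?nm1.
pose I1 : C := Complex 0 1.
have I2 : I1 * I1 = -1 by rewrite /I1; apply/eqP; rewrite eq_complex /= !mul0r !mulr0 mulr1 !oppr0 addr0 sub0r !eqxx.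
have nI : nm I1 = 1 by rewrite nm_imag normr1.
have sp_sig a m : span X a (sig m) = a 0 m by exact: (span_sig Xsig (fun m => a 0 m)).
have sp_b a k : nm (span X a k) <= \sum_m nm (a 0 m).
  apply: Xbound => m; rewrite (bigD1 m) //= lerDl sumr_ge0 // => m' _; exact: nm_ge0.
have Hspan a k : (c k)%:C%C * span X a k + (kap k)%:C%C * cv (span X a) k =
    span X (a *m Lam) k.
  have Ts (a' : 'I_n.+1 -> C) k' := cv_sum qQ qQ_lim cv_near a' k' X1.
  exact: (esym (span_row Ts (Xrow ^~ k) a)).
apply: (@count_from_span R n X (I1 *: Lam)).
- by move=> a h; apply/rowP => m; rewrite -sp_sig h mxE.
- by move=> a; apply/tends0_vanishing; exact: (comb_tends0 Xt a).
- by move=> a k; rewrite LE Hspan -scalemxAr spanZ.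
- move=> z a a0' az; have {}az : a *m Lam = (- I1 * z) *: a.
    apply/eqP; rewrite -subr_eq0; apply/eqP.
    have : I1 *: (a *m Lam - (- I1 * z) *: a) = 0.
      by rewrite scalerBr scalemxAr az scalerA mulrA mulrN I2 opprK mul1r subrr.
    move=> /eqP; rewrite scaler_eq0 => /orP[/eqP I0|/eqP //].
    by move: nI; rewrite I0 nm0 => /eqP; rewrite eq_sym oner_eq0.
  have [m hm] := lam_strip Xsig Xbound Xrow a0' az.
  apply: (A_disk (m := m)); apply: le_trans hm.
  have -> : z - Complex 0 (c (sig m)) = I1 * (- I1 * z - (c (sig m))%:C%C).
    rewrite mulrBr mulrA mulrN I2 opprK mul1r; congr (_ - _).
    by apply/eqP; rewrite eq_complex /=; apply/andP; split; apply/eqP; ring.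
  by rewrite nmM nI mul1r.
- move=> z v g /A_strip zs /tends0_vanishing vt vg.
  (* The member of the span that agrees with [v] on [sig]: the difference vanishes there and solves
     an equation of the same kind, so [invariant_vanish] applies. *)
  pose a : 'rV[C]_n.+1 := \row_m v (sig m).
  exists a => k; apply/eqP; rewrite -subr_eq0; apply/eqP; move: k.
  pose h : C := - I1 * z.
  have [kv kvP] : exists k0, forall k, nm (v k) <= nm (v k0).
    by apply: tends0_max => // k; exact: nm_ge0.
  have Hv k : (c k)%:C%C * v k + (kap k)%:C%C * cv v k = h * v k + - I1 * span X g k.
    rewrite -vg LE mulrBr !mulrA mulNr I2 opprK mul1r; rewrite /h; ring.
  have cvB k : cv (fun k => v k - span X a k) k = cv v k - cv (span X a) k.
    have := @cv_sum R q Q cv qQ qQ_lim cv_near bool (fun b => if b then 1 else -1)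
      (fun b => if b then v else span X a) (nm (v kv) + \sum_m nm (a 0 m)) k.
    rewrite big_bool /= mul1r mulN1r => <-.
      by congr (cv _ k); apply/funext => k'; rewrite big_bool /= mul1r mulN1r.
    have s0 : 0 <= \sum_m nm (a 0 m) by apply: sumr_ge0 => m _; exact: nm_ge0.
    move=> [] k'; first by have := kvP k'; lra.
    by have := sp_b a k'; have := nm_ge0 (v kv); lra.
  pose g' : 'rV[C]_n.+1 := h *: a + - I1 *: g - a *m Lam.
  apply: (invariant_vanish Xsig Xbound Xt Xrow (h := h) (g := fun m => g' 0 m)).
  + by rewrite /h; case: (z) zs => x1 x2 /=; lra.
  + move=> e e0; have e20 : 0 < e / 2 by lra.
    have [K1 h1] := vt _ e20; have [K2 h2] := comb_tends0 Xt a e20.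
    exists (maxn K1 K2) => k; rewrite geq_max => /andP[/h1 h1' /h2 h2'].
    by apply: le_trans (nmB _ _) _; rewrite /span; move: h1' h2'; rewrite /comb; lra.
  + by move=> m; rewrite sp_sig mxE subrr.
  + move=> k; rewrite cvB.
    have -> : \sum_m g' 0 m * X m k = h * span X a k - I1 * span X g k - span X (a *m Lam) k.
      by rewrite -/(span X g' k) /g' spanB spanD !spanZ mulNr.
    rewrite -Hspan.
    have e1 := Hv k.
    have -> : (c k)%:C%C * (v k - span X a k) + (kap k)%:C%C * (cv v k - cv (span X a) k) =
      ((c k)%:C%C * v k + (kap k)%:C%C * cv v k) -
      ((c k)%:C%C * span X a k + (kap k)%:C%C * cv (span X a) k) by ring.
    rewrite e1; ring.
Qed.

End SpectralCount.

(** * Fourier coefficients *)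

Section IntegerSeq.

Definition zseq (N : nat) : seq int := [seq j%:Z - N%:Z | j <- iota 0 N.*2.+1].

Lemma isum_zseq (V : nmodType) N (f : int -> V) : isum N f = \sum_(x <- zseq N) f x.
Proof. by rewrite /isum big_map -(big_mkord xpredT (fun j : nat => f (j%:Z - N%:Z))). Qed.

Lemma zseq_uniq N : uniq (zseq N).
Proof. by rewrite map_inj_uniq ?iota_uniq // => i j h; lia. Qed.

Lemma mem_zseq N x : (x \in zseq N) = (`|x| <= N)%N.
Proof.
apply/mapP/idP => [[j]|xN]; first by rewrite mem_iota => jN ->; lia.
by exists `|(x + N%:Z)%R|%N; [rewrite mem_iota; lia|lia].
Qed.

Lemma sum_subseq_split (V : nmodType) (s t : seq int) (f : int -> V) :
  uniq s -> uniq t -> {subset s <= t} ->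
  \sum_(x <- t) f x = \sum_(x <- s) f x + \sum_(x <- t | x \notin s) f x.
Proof.
move=> us ut st; rewrite (bigID (mem s)) /=; congr (_ + _).
rewrite -big_filter; apply: perm_big; apply: uniq_perm; rewrite ?filter_uniq //.
by move=> x; rewrite mem_filter andb_idr //; exact: st.
Qed.

Lemma sum_seq_le_isum (R : numDomainType) (s : seq int) N (f : int -> R) :
  (forall x, 0 <= f x) -> uniq s -> (forall x, x \in s -> (`|x| <= N)%N) ->
  \sum_(x <- s) f x <= isum N f.
Proof.
move=> f0 us sN; rewrite isum_zseq (@sum_subseq_split _ s (zseq N)) ?zseq_uniq //.
  by rewrite lerDl sumr_ge0.
by move=> x /sN; rewrite mem_zseq.
Qed.

End IntegerSeq.

Section L1.
Variables (R : realType) (q : int -> CC R).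
Hypotheses (q0 : q 0 = 0) (qfin : (l1enorm q < +oo)%E).
Notation C := R[i].
Let p j := nm (q j).
Let Q := l1norm q.

Let p_ge0 j : 0 <= p j. Proof. exact: nm_ge0. Qed.

Let l1_fin : l1enorm q \is a fin_num.
Proof. by rewrite ge0_fin_numE // esum_ge0 // => k _; rewrite lee_fin nm_ge0. Qed.

Let l1E : l1enorm q = Q%:E. Proof. by rewrite /Q /l1norm fineK. Qed.

Lemma isum_le_l1norm N : isum N p <= Q.
Proof.
rewrite -lee_fin -l1E; apply: esum_ge.
pose s := [seq x <- zseq N | x != 0].
exists [set` s].
  split; first exact: finite_seq.
  by move=> x /=; rewrite mem_filter => /andP[].
rewrite -fsbig_seq ?filter_uniq ?zseq_uniq // sumEFin lee_fin.
rewrite isum_zseq (bigID (pred1 0)) /= big1 ?add0r => [|x /eqP ->]; last first.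
  by rewrite /p q0 nm0.
by rewrite /s big_filter.
Qed.

Lemma l1norm_tail e : 0 < e -> exists J, Q - isum J p <= e.
Proof.
move=> e0; have [_ [A [Af _] <-]] := ub_ereal_sup_adherent e0 l1_fin.
rewrite -/(esum _ _) -/(l1enorm q) l1E fsbig_finite // sumEFin -EFinB lte_fin => h.
pose s : seq int := finmap.enum_fset (fset_set A).
exists (\max_(x <- s) `|x|)%N.
have : \sum_(x <- s) p x <= isum (\max_(x <- s) `|x|)%N p.
  apply: sum_seq_le_isum => //; first exact: finmap.fset_uniq.
  by move=> x xs; apply: (leq_bigmax_seq (F := fun x : int => `|x|%N)).
by move: h; rewrite -/s -/p; lra.
Qed.

Lemma cvg_complexP (f : nat -> CC R) (l : CC R) :
  (forall e : R, 0 < e -> exists N, forall n, (N <= n)%N -> nm (f n - l) <= e) ->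
  f @ \oo --> l.
Proof.
move=> h; apply/cvgrPdist_le => e e0.
have [er e0'] : e = (complex.Re e)%:C%C /\ 0 < complex.Re e.
  by move: e0; case: e => a b; rewrite ltcE /= => /andP[/eqP -> ->].
have [N NP] := h _ e0'; exists N => // n /= Nn.
by rewrite distrC er [X in X <= _]/Num.norm /= lecR; exact: NP.
Qed.

(** [conv] sums a window centred at k, [sumZ] windows centred at 0. Once N >= J + |k| the latter
    contain the former, and the terms in between weigh at most B times the tail of [p]. *)
Lemma sumZ_conv_near (v : int -> CC R) B k J : (forall k, nm (v k) <= B) ->
  nm (sumZ (fun m => q (k - m) * v m) - conv q J v k) <= B * (Q - isum J p).
Proof.
move=> vB; have B0 : 0 <= B by apply: le_trans (vB 0); exact: nm_ge0.
pose f m := q (k - m) * v m.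
pose S N : C := isum N f.
have near J' N : (J' + `|k| <= N)%N -> nm (S N - conv q J' v k) <= B * (Q - isum J' p).
  move=> JN; pose s := [seq k - j | j <- zseq J'].
  have ku (t : seq int) : uniq t -> uniq [seq k - j | j <- t].
    by move=> ut; rewrite map_inj_uniq // => i j h; lia.
  have us : uniq s by apply: ku; exact: zseq_uniq.
  have sN : {subset s <= zseq N}.
    by move=> _ /mapP[j + ->]; rewrite !mem_zseq; lia.
  have -> : conv q J' v k = \sum_(x <- s) f x.
    rewrite /conv isum_zseq [RHS]big_map; apply: eq_bigr => j _.
    by rewrite /f subKr.
  rewrite /S isum_zseq (sum_subseq_split f us (zseq_uniq N) sN) addrAC subrr add0r.
  apply: le_trans (nm_sum _ _ _) _.
  apply: (@le_trans _ _ (B * \sum_(x <- zseq N | x \notin s) p (k - x))).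
    by rewrite mulr_sumr; apply: ler_sum => x _; rewrite nmM mulrC ler_wpM2r ?nm_ge0.
  apply: ler_wpM2l => //; rewrite lerBrDl.
  have -> : isum J' p = \sum_(x <- s) p (k - x).
    by rewrite isum_zseq [RHS]big_map; apply: eq_bigr => j _; rewrite subKr.
  rewrite -(sum_subseq_split (fun x => p (k - x)) us (zseq_uniq N) sN).
  rewrite -(big_map (fun x => k - x) xpredT p).
  apply: le_trans (isum_le_l1norm (N + `|k|)).
  apply: sum_seq_le_isum => //; first by apply: ku; exact: zseq_uniq.
  by move=> _ /mapP[j + ->]; rewrite mem_zseq; lia.
have [F UF Foo] := ultra_nat.
have PF : ProperFilter F by exact: ultra_proper.
have SB N : nm (S N) <= Q * B.
  apply: le_trans (nm_isum _ _) _; rewrite isum_zseq.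
  apply: (@le_trans _ _ ((\sum_(x <- zseq N) p (k - x)) * B)).
    by rewrite mulr_suml; apply: ler_sum => x _; rewrite nmM ler_wpM2l ?nm_ge0.
  rewrite ler_wpM2r // -(big_map (fun x => k - x) xpredT p).
  apply: le_trans (isum_le_l1norm (N + `|k|)).
  apply: sum_seq_le_isum => //.
    by rewrite map_inj_uniq ?zseq_uniq // => i j h; lia.
  by move=> _ /mapP[j + ->]; rewrite mem_zseq; lia.
(* An ultrafilter provides a candidate for the limit; the same estimate then shows that the partial
   sums converge to it. *)
have [l lP] := ultra_bounded_ulim UF SB.
have lnear J' : nm (l - conv q J' v k) <= B * (Q - isum J' p).
  apply/ler_addgt0Pr => e e0.
  have FN : F [set N | (J' + `|k| <= N)%N].
    by apply: Foo; exists (J' + `|k|)%N.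
  have [N [/= h1 h2]] := filter_ex (filterI (lP _ e0) FN).
  have := near _ _ h2; rewrite nmBC in h1.
  by have := nmD (l - S N) (S N - conv q J' v k); rewrite addrA subrK; lra.
suff -> : sumZ f = l by exact: lnear.
apply: cvg_lim => //; apply: cvg_complexP => e e0.
have [|J' hJ'] := @l1norm_tail (e / (2 * (B + 1))).
  by rewrite divr_gt0 //; lra.
exists (J' + `|k|)%N => N /near h1; have h2 := lnear J'.
rewrite nmBC in h2.
have := nmD (S N - conv q J' v k) (conv q J' v k - l); rewrite addrA subrK -/(S N).
have t0 : 0 <= Q - isum J' p by rewrite subr_ge0 isum_le_l1norm.
have : B * (Q - isum J' p) <= e / 2.
  apply: (@le_trans _ _ (B * (e / (2 * (B + 1))))); first by rewrite ler_wpM2l.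
  by rewrite mulrA ler_pdivrMr; lra.
rewrite /S; lra.
Qed.

End L1.

Section FourierCoef.
Variables (R : realType) (T : R) (Q : R -> R).
Local Notation mu := (@lebesgue_measure R).

(** No integrability is assumed: when the integral of the positive or negative part is infinite,
    [fine] gives 0 on both sides. *)
Lemma RintegralN_total (D : set R) (f : R -> R) :
  \int[mu]_(x in D) (- f x) = - \int[mu]_(x in D) f x.
Proof.
rewrite /Rintegral.
rewrite integralE [in RHS]integralE.
have -> : ((fun x => (- f x)%:E) ^\+ = (EFin \o f) ^\-)%E.
  by rewrite -funeposN.
have -> : ((fun x => (- f x)%:E) ^\- = (EFin \o f) ^\+)%E.
  by rewrite -funenegN.
have : (0 <= \int[mu]_(x in D) ((EFin \o f)^\+ x))%E by exact: integral_ge0.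
have : (0 <= \int[mu]_(x in D) ((EFin \o f)^\- x))%E by exact: integral_ge0.
case: (\int[mu]_(x in D) ((EFin \o f)^\+ x))%E => [a| |] //;
case: (\int[mu]_(x in D) ((EFin \o f)^\- x))%E => [b| |] //= _ _.
- by rewrite opprB.
- by rewrite oppr0.
- by rewrite oppr0.
- by rewrite oppr0.
Qed.

Lemma fourier_coef0 : \int[mu]_(x in `[0, T]) Q x = 0 -> fourier_coef T Q 0 = 0.
Proof.
move=> Q0; rewrite /fourier_coef.
have -> : \int[mu]_(x in `[0, T]) (Q x * cos (2 * pi * 0%:~R * x / T)) = 0.
  rewrite -[RHS]Q0; congr Rintegral; apply/funext => x.
  by rewrite mulr0 !mul0r cos0 mulr1.
have -> : \int[mu]_(x in `[0, T]) (Q x * sin (2 * pi * 0%:~R * x / T)) = 0.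
  rewrite (_ : (fun x => _) = fun=> 0).
    by rewrite /Rintegral integral0.
  by apply/funext => x; rewrite mulr0 !mul0r sin0 mulr0.
by rewrite mulr0 oppr0.
Qed.

(** Q is real, so the two coefficients are conjugate. *)
Lemma nm_fourier_coefN k : nm (fourier_coef T Q (- k)) = nm (fourier_coef T Q k).
Proof.
rewrite /fourier_coef.
have -> : \int[mu]_(x in `[0, T]) (Q x * cos (2 * pi * (- k)%:~R * x / T)) =
    \int[mu]_(x in `[0, T]) (Q x * cos (2 * pi * k%:~R * x / T)).
  by congr Rintegral; apply/funext => x; rewrite mulrNz mulrN !mulNr cosN.
have -> : \int[mu]_(x in `[0, T]) (Q x * sin (2 * pi * (- k)%:~R * x / T)) =
    - \int[mu]_(x in `[0, T]) (Q x * sin (2 * pi * k%:~R * x / T)).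
  rewrite -RintegralN_total; congr Rintegral; apply/funext => x.
  by rewrite mulrNz mulrN !mulNr sinN mulrN.
by rewrite /Normc.normc mulrN opprK sqrrN.
Qed.

End FourierCoef.

(** * Components of the union of the disks *)

Section Topology.
Variable R : realType.

Lemma connectedU1_closure (T : topologicalType) (E : set T) (x : T) :
  connected E -> closure E x -> connected (E `|` [set x]).
Proof.
move=> Ec Ex; apply/connectedP => S [S0 SE Ssep].
have sub : E `|` [set x] `<=` closure E.
  by move=> y [Ey|->]; [exact: subset_closure|].
have h (A B : set T) : separated A B -> B !=set0 -> B `<=` E `|` [set x] -> ~ E `<=` A.
  move=> [clAB _] [y By] BE EA.
  have : (closure A `&` B) y by split => //; exact: (closureS EA (sub _ (BE _ By))).
  by rewrite clAB.
have ES : E `<=` S false `|` S true by move=> y Ey; rewrite -SE; left.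
have [EA|EB] := connected_subset Ssep ES Ec.
- by apply: (h _ _ Ssep (S0 true)) EA; rewrite SE => y; right.
- have Ssep' : separated (S true) (S false) by rewrite separatedC.
  by apply: (h _ _ Ssep' (S0 false)) EB; rewrite SE => y; left.
Qed.

Lemma component_absorb (T : topologicalType) (U B : set T) (z : T) : connected B ->
  B `<=` U -> B `&` connected_component U z !=set0 -> B `<=` connected_component U z.
Proof.
move=> Bc BU [y [By Ay]]; rewrite (same_connected_component Ay).
exact: connected_component_max.
Qed.

Lemma lipschitz_continuous_fromC (f : CC R -> R) :
  (forall x y, `|f x - f y| <= nm (x - y)) -> continuous f.
Proof.
move=> fl x V /nbhs_ballP[e /= e0 eV].
have ec : 0 < (e%:C)%C :> CC R by rewrite ltcR.
apply: (@filterS _ (nbhs x) (nbhs_filter x) (ball x ((e%:C)%C : CC R))) => [y|].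
  rewrite -ball_normE /ball_ /= [X in X < _]/Num.norm /= ltcR => h; apply: eV.
  by rewrite -ball_normE /ball_ /=; exact: le_lt_trans (fl _ _) h.
exact: nbhsx_ballx.
Qed.

Lemma lipschitz_continuous_toC (f : R -> CC R) (K : R) :
  (forall x y, nm (f x - f y) <= K * `|x - y|) -> continuous f.
Proof.
move=> fl x; apply/cvgrPdist_lt => e e0.
have [er e0'] : e = (complex.Re e)%:C%C /\ 0 < complex.Re e.
  by move: e0; case: e => a b; rewrite ltcE /= => /andP[/eqP -> ->].
have K0 : 0 <= K.
  by have := le_trans (nm_ge0 _) (fl 1 0); rewrite subr0 normr1 mulr1.
have eK : 0 < complex.Re e / (K + 1) by rewrite divr_gt0 //; lra.
near=> y; rewrite er [X in X < _]/Num.norm /= ltcR.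
apply: le_lt_trans (fl _ _) _.
have : `|x - y| < complex.Re e / (K + 1) by near: y; exact: cvgr_dist_lt eK.
rewrite ltr_pdivlMr; last lra.
move=> h; apply: le_lt_trans h; rewrite mulrC mulrDr mulr1 lerDl //.
Unshelve. all: by end_near.
Qed.

Lemma connected_ball (x0 : CC R) (r : R) : 0 <= r ->
  connected [set z : CC R | nm (z - x0) <= r].
Proof.
move=> r0; pose seg (z : CC R) : R -> CC R := fun t => x0 + (t%:C)%C * (z - x0).
have -> : [set z : CC R | nm (z - x0) <= r] =
    \bigcup_(z in [set z : CC R | nm (z - x0) <= r]) (seg z @` `[0, 1]).
  apply/seteqP; split=> [z zr|_ [z /= zr [t t01 <-]]] /=.
    exists z => //; exists 1; first by rewrite /= in_itv /= ler01 lexx.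
    by rewrite /seg rmorph1 mul1r addrC subrK.
  move: t01; rewrite /= in_itv /= => /andP[t0 t1].
  rewrite /seg addrAC subrr add0r nmM nm_real ger0_norm //.
  by apply: le_trans zr; rewrite ler_piMl // nm_ge0.
apply: bigcup_connected.
  exists x0 => z _; exists 0; first by rewrite /= in_itv /= ler01 lexx.
  by rewrite /seg rmorph0 mul0r addr0.
move=> z _; apply: connected_continuous_connected; first exact: segment_connected.
apply: continuous_subspaceT; apply: (@lipschitz_continuous_toC _ (nm (z - x0))) => s t.
rewrite /seg opprD addrACA subrr add0r -mulrBl -rmorphB nmM nm_real mulrC //.
Qed.

End Topology.

Section DiskGeometry.
Variables (R : realType) (c r : int -> R).
Hypothesis r_ge0 : forall k, 0 <= r k.
Let D k : set (CC R) := [set z | nm (z - Complex 0 (c k)) <= r k].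
Let U := \bigcup_(k in [set: int]) D k.

Lemma imag_in_disk k (t : R) : D k (Complex 0 t) <-> `|t - c k| <= r k.
Proof.
suff <- : nm (Complex 0 t - Complex 0 (c k) : CC R) = `|t - c k| by [].
by rewrite -nm_imag; congr nm; apply/eqP; rewrite eq_complex /= subrr !eqxx.
Qed.

Lemma disk_conn k : connected (D k). Proof. exact: connected_ball. Qed.

Lemma disk_sub k : D k `<=` U. Proof. by move=> z Dz; exists k. Qed.

Lemma disk_Im k z : D k z -> `|complex.Im z - c k| <= r k.
Proof. by move=> /(le_trans (normr_Im _)); case: z. Qed.

Section Component.
Variables (n : nat) (sig : 'I_n.+1 -> int) (A : set (CC R)) (z0 : CC R).
Hypothesis AE : A = connected_component U z0.
Hypothesis sigP : forall k, D k `<=` A <-> exists m, sig m = k.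

Let D_meet k z : D k z -> A z -> D k `<=` A.
Proof.
rewrite AE => Dz Az; apply: component_absorb; [exact: disk_conn|exact: disk_sub|].
by exists z.
Qed.

Let sigD m : D (sig m) `<=` A. Proof. by apply/sigP; exists m. Qed.

Lemma component_cover z : A z -> exists m, D (sig m) z.
Proof.
move=> Az; have Uz : U z by move: Az; rewrite AE; exact: connected_component_sub.
have [k _ Dz] := Uz; have /sigP[m mk] := D_meet Dz Az.
by exists m; rewrite mk.
Qed.

(** A disk has the same imaginary parts as its trace on the imaginary axis, since its centre lies
    there. Those of the component form an interval, which the traces fill; a further disk whose
    trace met this interval would share a point with the component. *)
Lemma component_hull : exists a0 b0,
  [/\ forall m, a0 <= c (sig m) - r (sig m) /\ c (sig m) + r (sig m) <= b0,
      A (Complex 0 a0), A (Complex 0 b0),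
      forall t, a0 <= t <= b0 -> exists m, `|t - c (sig m)| <= r (sig m)
    & forall k, (forall m, sig m != k) -> b0 < c k - r k \/ c k + r k < a0].
Proof.
have [m1 _ h1] := @arg_minP _ R 'I_n.+1 ord0 xpredT (fun m => c (sig m) - r (sig m)) isT.
have [m2 _ h2] := @arg_maxP _ R 'I_n.+1 ord0 xpredT (fun m => c (sig m) + r (sig m)) isT.
set a0 := c (sig m1) - r (sig m1) in h1; set b0 := c (sig m2) + r (sig m2) in h2.
have h1' m : a0 <= c (sig m) - r (sig m) by exact: h1.
have h2' m : c (sig m) + r (sig m) <= b0 by exact: h2.
have Aa : A (Complex 0 a0).
  apply: (@sigD m1); apply/imag_in_disk; rewrite /a0 addrAC subrr add0r normrN ger0_norm //.
have Ab : A (Complex 0 b0).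
  by apply: (@sigD m2); apply/imag_in_disk; rewrite /b0 addrAC subrr add0r ger0_norm.
have ImA : is_interval (@complex.Im R @` A).
  apply/connected_intervalP/connected_continuous_connected.
    by rewrite AE; exact: component_connected.
  apply: continuous_subspaceT; apply: lipschitz_continuous_fromC => x y.
  by apply: le_trans (normr_Im _); case: x => ? ?; case: y.
have fill t : a0 <= t <= b0 -> exists m, `|t - c (sig m)| <= r (sig m).
  move=> tab; have [z Az zt] : (@complex.Im R @` A) t.
    by apply: (ImA a0 b0) => //; [exists (Complex 0 a0)|exists (Complex 0 b0)].
  have [m Dm] := component_cover Az; exists m.
  by rewrite -zt; exact: disk_Im.
exists a0, b0; split=> //.
move=> k kS; have [h3|h3] := ltP b0 (c k - r k); [by left|right].
  rewrite ltNge; apply/negP => h4.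
  (* A common point of [a0, b0] and the trace of disk k. *)
  pose t := Num.max a0 (c k - r k).
  have ab : a0 <= b0 by have := h1' m2; have := r_ge0 (sig m2); have := h2' m2; lra.
  have rk := r_ge0 k.
  have tb : a0 <= t <= b0 by rewrite /t le_max lexx /= ge_max ab h3.
  have tk : `|t - c k| <= r k.
    rewrite ler_norml /t lerBlDr lerBrDr; apply/andP; split.
      by rewrite le_max; apply/orP; right; lra.
    by rewrite ge_max; apply/andP; split; lra.
  have [m hm] := fill t tb.
  have Dk : D k (Complex 0 t) by apply/imag_in_disk.
  have At : A (Complex 0 t) by apply: (@sigD m); apply/imag_in_disk.
  by have /sigP[m' m'k] := D_meet Dk At; have := kS m'; rewrite m'k eqxx.
Qed.

Lemma finite_gap (f : int -> R) e K : exists2 d, 0 < d & forall k, (`|k| < K)%N ->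
  e < f k -> e + d <= f k.
Proof.
elim: K => [|K [d d0 IH]]; first by exists 1.
(* Where x does not exceed [e] there is no constraint, and 1 is an arbitrary positive value. *)
pose g (x : R) := if e < x then x - e else 1.
have g0 x : 0 < g x by rewrite /g; case: (ltP e x) => [ex|_]; [lra|exact: ltr01].
have ge x : e < x -> e + g x <= x by rewrite /g => ->; lra.
exists (Num.min d (Num.min (g (f K%:Z)) (g (f (- K%:Z))))).
  by rewrite !lt_min d0 !g0.
move=> k kK ek; have [kK'|kK'] := ltnP `|k| K.
  have := IH k kK' ek; have : Num.min d (Num.min (g (f K%:Z)) (g (f (- K%:Z)))) <= d.
    by rewrite ge_min lexx.
  lra.
have [kE|kE] : k = K%:Z \/ k = - K%:Z by lia.
  have : Num.min d (Num.min (g (f K%:Z)) (g (f (- K%:Z)))) <= g (f k).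
    by rewrite kE !ge_min lexx !orbT.
  by have := ge _ ek; lra.
have : Num.min d (Num.min (g (f K%:Z)) (g (f (- K%:Z)))) <= g (f k).
  by rewrite kE !ge_min lexx !orbT.
by have := ge _ ek; lra.
Qed.

Hypothesis r_large : exists K, forall k, (K <= `|k|)%N -> 1 <= r k.

(* Disks accumulating at [i s e] from one side, having radius at least [1],
   share a common point; their union is connected with [i s e] in its closure and
   would belong to the component. *)
Lemma component_gap (s e : R) : s * s = 1 -> A (Complex 0 (s * e)) ->
  exists2 d, 0 < d & forall k, (forall m, sig m != k) ->
    e < s * c k - r k -> e + d <= s * c k - r k.
Proof.
move=> ss Ae; have [K KP] := r_large.
have [d d0 dP] := finite_gap (fun k => s * c k - r k) e K.
apply: contrapT => noex.
have close (t : R) : 0 < t -> exists k, [/\ forall m, sig m != k, 1 <= r k,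
    e < s * c k - r k & s * c k - r k < e + t].
  move=> t0; apply: contrapT => nok; apply: noex.
  exists (Num.min d t) => [|k kS ek]; first by rewrite lt_min d0.
  rewrite leNgt; apply/negP => kd.
  have kt : s * c k - r k < e + t.
    by apply: lt_le_trans kd _; rewrite lerD2l ge_min lexx orbT.
  have kdd : s * c k - r k < e + d.
    by apply: lt_le_trans kd _; rewrite lerD2l ge_min lexx.
  have [kK|kK] := ltnP `|k| K; first by have := dP k kK ek; lra.
  by apply: nok; exists k; split=> //; exact: KP.
(* [s] is 1 or -1, so that one statement serves the upper and, after reflection, the lower end of
   the component. *)
have ns : `|s| = 1.
  have h : `|s| * `|s| = 1 by rewrite -normrM ss normr1.
  have : (`|s| - 1) * (`|s| + 1) = 0 by rewrite mulrBl mulrDr h; ring.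
  move/eqP; rewrite mulf_eq0 => /orP[/eqP|/eqP]; first lra.
  by have := normr_ge0 s; lra.
have inD k t : `|t - s * c k| <= r k -> D k (Complex 0 (s * t)).
  move=> h; apply/imag_in_disk; apply: le_trans h.
  have -> : s * t - c k = s * (t - s * c k) by rewrite mulrBr mulrA ss mul1r.
  by rewrite normrM ns mul1r.
pose P k := [/\ 1 <= r k, e < s * c k - r k & s * c k - r k < e + 1].
pose E := \bigcup_(k in P) D k.
have Ec : connected E.
  apply: bigcup_connected => [|k _]; last exact: disk_conn.
  (* A disk of radius at least 1 whose near end lies between e and e + 1 reaches past e + 2. *)
  exists (Complex 0 (s * (e + 2))) => k [h1 h2 h3]; apply: inD.
  by rewrite ler_norml; lra.
have Ecl : closure E (Complex 0 (s * e)).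
  move=> B /(@nbhs_ballP _ (CC R)) [eps /= eps0 hB].
  have [er e0'] : eps = (complex.Re eps)%:C%C /\ 0 < complex.Re eps.
    by move: eps0; case: (eps) => a b; rewrite ltcE /= => /andP[/eqP -> ->].
  have [|k [kS h1 h2 h3]] := close (Num.min 1 (complex.Re eps)).
    by rewrite lt_min ltr01 e0'.
  have h4 : s * c k - r k < e + 1.
    by apply: lt_le_trans h3 _; rewrite lerD2l ge_min lexx.
  have h5 : s * c k - r k < e + complex.Re eps.
    by apply: lt_le_trans h3 _; rewrite lerD2l ge_min lexx orbT.
  exists (Complex 0 (s * (s * c k - r k))); split.
    exists k; first by split.
    by apply: inD; rewrite addrAC subrr add0r normrN ger0_norm.
  apply: hB; rewrite -ball_normE /ball_ /= er [X in X < _]/Num.norm /= ltcR.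
  have h6 : nm (Complex 0 (s * e) - Complex 0 (s * (s * c k - r k)) : CC R) =
      `|s * (e - (s * c k - r k))|.
    rewrite -nm_imag; congr nm; apply/eqP; rewrite eq_complex /=.
    by apply/andP; split; apply/eqP; ring.
  suff h7 : nm (Complex 0 (s * e) - Complex 0 (s * (s * c k - r k)) : CC R) < complex.Re eps.
    exact: h7.
  by rewrite h6 normrM ns mul1r ltr_norml; lra.
have Esub : E `|` [set Complex 0 (s * e)] `<=` A.
  rewrite AE; apply: component_absorb.
  - exact: connectedU1_closure.
  - move=> z [[k _ Dz]|->]; first by exists k.
    by move: Ae; rewrite AE; exact: connected_component_sub.
  - by exists (Complex 0 (s * e)); split; [right|rewrite -AE].
have [k [kS h1 h2 h3]] := close 1 ltr01.
have : D k `<=` A by move=> z Dz; apply: Esub; left; exists k.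
by move=> /sigP[m mk]; have := kS m; rewrite mk eqxx.
Qed.

Lemma component_separated : exists a0 b0 d,
  [/\ 0 < d, forall m, a0 <= c (sig m) - r (sig m) /\ c (sig m) + r (sig m) <= b0
    & forall k, (forall m, sig m != k) -> b0 + d <= c k - r k \/ c k + r k <= a0 - d].
Proof.
have [a0 [b0 [hm Aa Ab _ out]]] := component_hull.
have [|d1 d10 h1] := @component_gap 1 b0 (mulr1 1); first by rewrite mul1r.
have [||d2 d20 h2] := @component_gap (-1) (- a0).
- by rewrite mulrNN mulr1.
- by rewrite mulrNN mul1r.
exists a0, b0, (Num.min d1 d2); split=> //; first by rewrite lt_min d10.
have l1 : Num.min d1 d2 <= d1 by rewrite ge_min lexx.
have l2 : Num.min d1 d2 <= d2 by rewrite ge_min lexx orbT.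
move=> k kS; case: (out k kS) => h; [left|right].
  by have := h1 k kS; rewrite mul1r => /(_ h); lra.
have := h2 k kS; rewrite mulN1r => h3.
have : - a0 < - c k - r k by lra.
by move=> /h3; lra.
Qed.

End Component.
End DiskGeometry.

(** * The operator and the disks of the theorem *)

Section Assembly.
Variables (R : realType) (T c mu : R) (omega Q : R -> R).
Hypotheses (T_gt0 : 0 < T)
  (Q_mean0 : \int[lebesgue_measure]_(x in `[0, T]) Q x = 0)
  (Q_summable : (l1enorm (fourier_coef T Q) < +oo)%E)
  (mu_gt : - (1 / 2) < mu) (mu_le : mu <= 1 / 2).

Let q := fourier_coef T Q.
Let Qn := l1norm q.
Let kap := wavenumber T mu.
Let cc k := omega (kap k) + c * kap k.
Let r k := `|kap k| * Qn.
Let L := linop T c mu omega Q.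
Let D := disk T c mu omega Q.
Let U := disks T c mu omega Q.
Let D' k : set (CC R) := [set z | nm (z - Complex 0 (cc k)) <= r k].

Let q0 : q 0 = 0. Proof. exact: fourier_coef0. Qed.

Let W_gt0 : 0 < 2 * pi / T.
Proof. by rewrite divr_gt0 // mulr_gt0 // pi_gt0. Qed.

Let kapE k : `|kap k| = 2 * pi / T * `|k%:~R + mu|.
Proof. by rewrite /kap /wavenumber normrM ger0_norm // ltW. Qed.

Let DE : D = D'.
Proof. by apply/funext => k; rewrite /D' /r kapE. Qed.

Let UE : U = \bigcup_(k in [set: int]) D' k.
Proof. by rewrite -DE. Qed.

Let Qn_ge0 : 0 <= Qn.
Proof. by apply: le_trans (isum_le_l1norm q0 Q_summable 0); apply: isum_ge0 => j; exact: nm_ge0. Qed.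

Let r_ge0 k : 0 <= r k. Proof. by rewrite mulr_ge0. Qed.

Let normrz (k : int) : `|k%:~R : R| = `|k|%N%:R.
Proof. by rewrite -intr_norm natr_absz. Qed.

Let kap_le k : `|kap k| <= 2 * pi / T * (`|k|%N%:R + 1).
Proof.
rewrite kapE ler_wpM2l ?(ltW W_gt0) //; apply: le_trans (ler_normD _ _) _.
by rewrite normrz lerD2l ler_norml; move: mu_gt mu_le; lra.
Qed.

Let LE v k : L v k =
  Complex 0 1 * ((cc k)%:C%C * v k + (kap k)%:C%C * mulQ T Q v k).
Proof.
rewrite /L /linop /i_omega_D /ddx /multiplier -/(kap k).
have -> : Complex 0 (omega (kap k)) = Complex 0 1 * (omega (kap k))%:C%C :> R[i].
  by apply/eqP; rewrite eq_complex /=; apply/andP; split; apply/eqP; ring.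
have -> : Complex 0 (kap k) = Complex 0 1 * (kap k)%:C%C :> R[i].
  by apply/eqP; rewrite eq_complex /=; apply/andP; split; apply/eqP; ring.
have -> : ((cc k)%:C)%C = (omega (kap k))%:C%C + (c%:C)%C * (kap k)%:C%C :> R[i].
  by apply/eqP; rewrite eq_complex /=; apply/andP; split; apply/eqP; rewrite /cc; ring.
have key (i x w o d z : R[i]) : i * o * x + d * (i * z * x) + i * z * w =
    i * ((o + d * z) * x + z * w) by ring.
exact: key.
Qed.

Let conv_near v B k J : (forall k, nm (v k) <= B) ->
  nm (mulQ T Q v k - conv q J v k) <= B * (Qn - isum J (fun j => nm (q j))).
Proof. exact: (sumZ_conv_near q0 Q_summable). Qed.

Lemma disk_center_mem k : D k (disk_center T c mu omega k).
Proof. by rewrite DE; apply/(imag_in_disk cc r k (cc k)); rewrite subrr normr0. Qed.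

Lemma disk_is_connected k : connected (D k).
Proof. by rewrite DE; exact: disk_conn. Qed.

(** Gershgorin's argument: a coordinate of maximal modulus exists because [v] vanishes at
    infinity. *)
Lemma eigenvalue_in_disks lam : op_eigenvalue L lam -> U lam.
Proof.
move=> [v [/tends0_vanishing vt v0 vL]].
have [k0 k0P] : exists k0, forall k, nm (v k) <= nm (v k0).
  by apply: tends0_max => // k; exact: nm_ge0.
have B0 : 0 < nm (v k0).
  rewrite ltNge; apply/negP => B0; apply: v0; apply/funext => k.
  by apply: nm_eq0; exact: le_trans (k0P k) B0.
rewrite UE; exists k0 => //; rewrite /D' /= -(ler_pM2r B0) -nmM.
have -> : (lam - Complex 0 (cc k0)) * v k0 = Complex 0 1 * ((kap k0)%:C%C * mulQ T Q v k0).
  rewrite mulrBl vL LE.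
  have -> : Complex 0 (cc k0) = Complex 0 1 * (cc k0)%:C%C :> CC R.
    by apply/eqP; rewrite eq_complex /=; apply/andP; split; apply/eqP; ring.
  have key (i x w a : R[i]) : i * (a * x + w) - i * a * x = i * w by ring.
  exact: key.
rewrite nmM nm_imag normr1 mul1r nmM nm_real /r -mulrA ler_wpM2l //.
by apply: (@cv_bound R q Qn _ conv_near).
Qed.

Lemma component_count (A : set (CC R)) n (sig : 'I_n.+1 -> int) :
  is_component U A -> injective sig ->
  (forall k, D k `<=` A <-> exists m, sig m = k) -> eigenvalue_count L A n.+1.
Proof.
move=> [z0 _ AE] sig_inj sigP; rewrite UE in AE; rewrite DE in sigP.
have sigD m : D' (sig m) `<=` A by apply/sigP; exists m.
have cover := component_cover r_ge0 AE sigP.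
(* The gap argument needs large disks. If [Qn] is 0, the disks are points and the operator is
   diagonal, so the count is done directly. *)
have [Q0|Q0] := eqVneq Qn 0.
  have r0 k : r k = 0 by rewrite /r Q0 mulr0.
  have [a0 [b0 [hm Aa Ab fill out]]] := component_hull r_ge0 AE sigP.
  have ab : b0 <= a0.
    rewrite leNgt; apply/negP => ab.
    (* n + 2 distinct points of [a0, b0] cannot be covered by n + 1 disks of radius 0. *)
    pose t (i : 'I_n.+2) : R := a0 + (b0 - a0) * (i%:R / n.+1%:R).
    have tab i : a0 <= t i <= b0.
      have i0 : 0 <= i%:R / n.+1%:R :> R by rewrite divr_ge0.
      have i1 : i%:R / n.+1%:R <= 1 :> R.
        by rewrite ler_pdivrMr ?ltr0n // mul1r ler_nat -ltnS.
      have h0 : 0 <= (b0 - a0) * (i%:R / n.+1%:R) by rewrite mulr_ge0 // subr_ge0 ltW.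
      have h1 : (b0 - a0) * (i%:R / n.+1%:R) <= (b0 - a0) * 1.
        by rewrite ler_wpM2l // subr_ge0 ltW.
      by rewrite /t lerDl h0 /= -lerBrDl; apply: le_trans h1 _; rewrite mulr1.
    have /choice[f fP] := fun i => fill _ (tab i).
    have finj : injective f.
      move=> i j fij; have := fP i; have := fP j; rewrite fij !r0 !normr_le0 !subr_eq0.
      move=> /eqP <- /eqP; rewrite /t => /addrI /mulfI h.
      have ba : b0 - a0 != 0 by rewrite subr_eq0 gt_eqF.
      have /(mulIf _) := h ba; rewrite invr_eq0 pnatr_eq0 => /(_ isT) /eqP.
      by rewrite eqr_nat => /eqP /val_inj.
    by have := leq_card f finj; rewrite !card_ord ltnn.
  have cs m : cc (sig m) = a0 by have := hm m; rewrite r0; lra.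
  have cn k : (forall m, sig m != k) -> cc k != a0.
    move=> kS; have := hm ord0; case: (out k kS); rewrite r0 r0 => h1 h2.
      by rewrite gt_eqF //; lra.
    by rewrite lt_eqF //; lra.
  pose X (m : 'I_n.+1) (k : int) : CC R := (k == sig m)%:R.
  have span_sig a m : span X a (sig m) = a 0 m.
    rewrite /span (bigD1 m) //= /X eqxx mulr1 big1 ?addr0 // => m' mm'.
    by rewrite (inj_eq sig_inj) eq_sym (negbTE mm') mulr0.
  have span_out a k : (forall m, sig m != k) -> span X a k = 0.
    move=> kS; rewrite /span big1 // => m _; rewrite /X eq_sym.
    by rewrite (negbTE (kS m)) mulr0.
  have Xt m : tends0 (fun k => nm (X m k)).
    move=> e e0; exists (`|sig m|.+1)%N => k km; rewrite /X.
    by case: eqP => [kE|_]; [rewrite kE ltnn in km|rewrite nm0 ltW].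
  have van a : tends0 (fun k => nm (span X a k)) by exact: (comb_tends0 Xt a).
  have Lv v k : tends0 (fun k => nm (v k)) -> L v k = Complex 0 (cc k) * v k.
    move=> vt; have [k0 k0P] : exists k0, forall k, nm (v k) <= nm (v k0).
      by apply: tends0_max => // k'; exact: nm_ge0.
    have -> : L v k = Complex 0 1 * ((cc k)%:C%C * v k + (kap k)%:C%C * 0).
      rewrite LE; congr (_ * (_ + _ * _)); apply: nm_eq0.
      by have := cv_bound conv_near k k0P; rewrite Q0 mul0r.
    rewrite mulr0 addr0 mulrA; congr (_ * _).
    by apply/eqP; rewrite eq_complex /=; apply/andP; split; apply/eqP; ring.
  have Az z : A z <-> z = Complex 0 a0.
    split=> [/cover[m]|->]; last exact: Aa.
    rewrite /= r0 cs => h; apply/eqP; rewrite -subr_eq0; apply/eqP.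
    exact: nm_eq0.
  apply: (@count_from_span R n X ((Complex 0 a0 : R[i])%:M)).
  - by move=> a h; apply/rowP => m; rewrite -span_sig h mxE.
  - by move=> a; apply/tends0_vanishing.
  - move=> a k; rewrite Lv // mul_mx_scalar spanZ.
    have [[m <-]|kS] := pselect (exists m, sig m = k); first by rewrite cs.
    by rewrite span_out ?mulr0 // => m; apply/eqP => mk; apply: kS; exists m.
  - move=> z a a0' /eqP; rewrite mul_mx_scalar -subr_eq0 -scalerBl scaler_eq0 (negbTE a0') orbF.
    by rewrite subr_eq0 => /eqP <-; apply/Az.
  - move=> z v g /Az -> /tends0_vanishing vt h.
    exists (\row_m v (sig m)) => k.
    have [[m <-]|kS] := pselect (exists m, sig m = k); first by rewrite span_sig mxE.
    have kS' m : sig m != k by apply/eqP => mk; apply: kS; exists m.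
    rewrite span_out //; have := h k; rewrite span_out // Lv // -mulrBl => /eqP.
    rewrite mulf_eq0 => /orP[|/eqP //]; rewrite subr_eq0 eq_complex /= => /andP[_].
    by rewrite (negbTE (cn k kS')).
have Qp : 0 < Qn by rewrite lt_neqAle eq_sym Q0.
have r_large : exists K, forall k, (K <= `|k|)%N -> 1 <= r k.
  have w0 : 0 < 2 * pi / T * Qn by rewrite mulr_gt0.
  (* One unit more than the truncation requires absorbs the shift by [mu]. *)
  exists (Num.truncn (1 / (2 * pi / T * Qn))).+2 => k Kk.
  rewrite /r kapE mulrAC -ler_pdivrMl // mulrC.
  have h1 : `|k|%N%:R - 1 <= `|k%:~R + mu|.
    have := ler_normB (k%:~R + mu) mu; rewrite addrK normrz.
    have : `|mu| <= 1 by rewrite ler_norml; move: mu_gt mu_le; lra.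
    lra.
  have h2 := truncnS_gt (1 / (2 * pi / T * Qn)).
  have h3 : (Num.truncn (1 / (2 * pi / T * Qn))).+2%:R <= `|k|%N%:R :> R by rewrite ler_nat.
  rewrite -natr1 in h3; lra.
have [a0 [b0 [d [d0 mid out]]]] := component_separated r_ge0 AE sigP r_large.
have q_neq0 : exists2 s, s != 0 & q s != 0.
  apply: contrapT => noq; have qz s : q s = 0.
    apply/eqP; apply: contrapT => /negP qs; apply: noq; exists s => //.
    by apply: contraNneq qs => ->; rewrite q0.
  have e0 : 0 < Qn / 2 by lra.
  have [J hJ] := l1norm_tail Q_summable e0.
  move: hJ; rewrite -/q -/Qn (@eq_isum _ _ _ (fun=> 0)) => [|j]; last by rewrite qz nm0.
  by rewrite /isum big1 // subr0; lra.
apply: (@spectral_count R n sig cc kap q Qn a0 b0 d (2 * pi / T) (mulQ T Q)) => //.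
- by move=> N; exact: isum_le_l1norm.
- by move=> e e0; exact: l1norm_tail.
- by move=> j; exact: nm_fourier_coefN.
- move=> z /cover[m Dz]; have := disk_Im Dz; have [h1 h2] := mid m.
  by rewrite ler_norml; lra.
Qed.

End Assembly.

Theorem theorem2p1 (R : realType) (T c : R) (omega Q : R -> R)
  (T_gt0 : 0 < T)
  (omega_odd : forall k : R, omega (- k) = - omega k)
  (Q_periodic : forall x : R, Q (x + T) = Q x)
  (Q_mean0 : \int[lebesgue_measure]_(x in `[0, T]) Q x = 0)
  (Q_summable : (l1enorm (fourier_coef T Q) < +oo)%E)
  (Q_series : forall x : R,
     Complex (Q x) 0 =
     sumZ (fun k : int => if k == 0 then 0 else
             fourier_coef T Q k * cexpi (2 * pi * k%:~R * x / T)))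
  (mu : R) (mu_gt : - (1 / 2) < mu) (mu_le : mu <= 1 / 2) :
  let L := linop T c mu omega Q in
  let D := disk T c mu omega Q in
  let U := disks T c mu omega Q in
  [/\ (* the nonzero eigenvalues lie in the union of the disks *)
      forall lam : CC R, lam != 0 -> op_eigenvalue L lam -> U lam,
      (* a component consisting of n disks contains n eigenvalues *)
      forall (A : set (CC R)) (n : nat),
        is_component U A ->
        ([set k : int | D k `<=` A] #= `I_n)%card ->
        eigenvalue_count L A n
    & (* a disk disjoint from all others, i.e. the case n = 1: it is by itself a
         component (no other disks accumulate at it) *)
      forall k : int,
        (forall j : int, j != k -> D j `&` D k = set0) ->
        is_component U (D k) ->
        eigenvalue_count L (D k) 1].
Proof.
move=> L D U; split.
- by move=> lam _; exact: eigenvalue_in_disks.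
- move=> A n Ac cardA; have [f [fim finj fsurj]] := elimT card_set_bijP cardA.
  (* A component is nonempty and contains each disk that it meets, so n = 0 does not occur. *)
  case: n {cardA} fim fsurj => [|n] fim fsurj.
    have [z Uz Az] := Ac; have [k _ Dz] := Uz.
    have : D k `<=` A.
      rewrite Az; apply: component_absorb.
      + exact: disk_is_connected.
      + by move=> y Dy; exists k.
      + by exists z; split => //; exact: connected_component_refl.
    by move=> /fim; rewrite /= ltn0.
  have /choice[sig sigP] : forall i : 'I_n.+1, exists k, D k `<=` A /\ f k = i :> nat.
    by move=> i; have [k Dk fk] := fsurj i (ltn_ord i); exists k.
  apply: (component_count T_gt0 Q_mean0 Q_summable mu_gt mu_le (sig := sig)) => //.
  + move=> i j h; apply/val_inj => /=.
    by have [_ <-] := sigP i; have [_ <-] := sigP j; rewrite h.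
  + move=> k; split=> [Dk|[m <-]]; last by case: (sigP m).
    exists (Ordinal (fim k Dk)); have [Ds fs] := sigP (Ordinal (fim k Dk)).
    by apply: finj; rewrite ?inE.
- move=> k dis Dc.
  apply: (component_count T_gt0 Q_mean0 Q_summable mu_gt mu_le (sig := fun _ : 'I_1 => k)) => //.
  + by move=> i j _; rewrite (ord1 i) (ord1 j).
  (* Another disk inside [D k] would meet it at its own centre. *)
  + move=> j; split=> [Djk|[_ <-] //]; exists ord0; apply/eqP; apply: contrapT => /negP kj.
    have cD : D j (disk_center T c mu omega j).
      exact: disk_center_mem.
    have : (D j `&` D k) (disk_center T c mu omega j) by split => //; exact: Djk.
    by rewrite dis // eq_sym.
Qed.
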